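(* Assume that $f=\mathfrak d+b$ and $\sigma$ satisfy Hypothesis (A), that $\psi$ satisfies Hypothesis (P), and that $G$ satisfies Hypothesis (G) (all stated in the context). Let $\lambda\in\mathbb R$, $v:\mathbb R^d\to\mathbb R$ locally Lipschitz and $\xi:\mathbb R^d\to\mathbb R^{1\times d}$ measurable be such that, for every $x\in\overline G$, the processes $Y_t^x=v(X_t^x)$ and $Z_t^x=\xi(X_t^x)$ satisfy $Z^x\in\mathscr M^2(\mathbb R_+,\mathbb R^{1\times d})$ and $$Y_t^x=Y_T^x+\int_t^T[\psi(X_s^x,Z_s^x)-\lambda]\,ds-\int_t^T Z_s^x\,dW_s,\qquad \forall\,0\le t\le T<+\infty$$ (such $(v,\xi,\lambda)$ exist under these hypotheses). Then $(v,\lambda)$ is a viscosity solution of the elliptic PDE $$\begin{cases}\mathscr L v(x)+\psi(x,\nabla v(x)\sigma(x))=\lambda, & x\in G,\\ \dfrac{\partial v}{\partial n}(x)=0,& x\in\partial G,\end{cases}\qquad \mathscr L u(x)=\tfrac12\operatorname{Tr}\big(\sigma(x)\,{}^t\sigma(x)\nabla^2u(x)\big)+\nabla u(x)f(x).$$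
   Context: $d\ge 1$ is an integer; $(\cdot,\cdot)$ and $|\cdot|$ are the Euclidean scalar product and norm ($|\cdot|$ also denotes a norm on matrices), and $|||\cdot|||$ is the operator norm on $\mathbb R^{d\times d}$; for the matrix field $\sigma^{-1}$, $|||\sigma^{-1}|||$ means $\sup_x|||\sigma^{-1}(x)|||$. $(\Omega,\mathcal F,\mathbb P)$ is a complete probability space carrying a standard $\mathbb R^d$-valued Brownian motion $W$, and $(\mathcal F_t)_{t\ge0}$ is its natural filtration augmented by the null sets. $\mathscr M^2(\mathbb R_+,\mathbb R^{1\times d})$ is the space of progressively measurable $\mathbb R^{1\times d}$-valued processes $Z$ with $\mathbb E\int_0^T|Z_s|^2ds<\infty$ for all $T>0$. Hypothesis (A), on $f=\mathfrak d+b:\mathbb R^d\to\mathbb R^d$ and $\sigma:\mathbb R^d\to\mathbb R^{d\times d}$: (i) $\mathfrak d:\mathbb R^d\to\mathbb R^d$ is $\eta$-dissipative for some $\eta>0$, i.e. $(\mathfrak d(x)-\mathfrak d(x'),x-x')\le-\eta|x-x'|^2$ for all $x,x'$; it is locally Lipschitz and has polynomial growth: there are $C,\nu>0$ with $|\mathfrak d(x)|\le C(1+|x|^\nu)$ for all $x$; (ii) $b:\mathbb R^d\to\mathbb R^d$ is Lipschitz and $|b|$ is bounded by $B$; (iii) $\sigma$ is Lipschitz, $\sigma(x)$ is invertible for every $x$, and $|\sigma|$ and $|\sigma^{-1}|$ are bounded by $\sigma_\infty$; (iv) there exists $\Lambda\ge0$ such that $|(y,\sigma(x+y)-\sigma(x))|\le\Lambda|y|$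 for all $x,y\in\mathbb R^d$, where $(y,M)$ denotes the row vector ${}^t y\,M$, and there exists $\lambda_0>0$ such that $2(\lambda_0-\lambda_0^2\Lambda^2)>|||\sigma^{-1}|||^2$. Hypothesis (P), on $\psi:\mathbb R^d\times\mathbb R^{1\times d}\to\mathbb R$: $\psi$ is measurable and there exists $M_\psi\in\mathbb R$ such that for all $x\in\mathbb R^d$ and $z,z'\in\mathbb R^{1\times d}$: $\psi(\cdot,z)$ is continuous, $|\psi(x,0)|\le M_\psi$, and $|\psi(x,z)-\psi(x,z')|\le M_\psi|z-z'|$. Hypothesis (G): $G$ is an open convex subset of $\mathbb R^d$ (not necessarily bounded), and there is a $C^2$ function $\phi:\mathbb R^d\to\mathbb R$ with bounded partial derivatives such that $G=\{\phi>0\}$, $\partial G=\{\phi=0\}$ and $|\nabla\phi(x)|=1$ for all $x\in\partial G$. For $x\in\overline G$, $(X^x,K^x)$ is the unique continuous adapted solution, with $X^x$ valued in $\overline G$ and $K^x$ real-valued, non-decreasing and starting from $0$, of the reflected SDE $$X_t^x=x+\int_0^t f(X_s^x)ds+\int_0^t\sigma(X_s^x)dW_s+\int_0^t\nabla\phi(X_s^x)dK_s^x,\qquad K_t^x=\int_0^t\mathbf 1_{\{X_s^x\in\partial G\}}dK_s^x,\quad t\ge0.$$ Gradients of scalar functions in $\mathscr L$ and in $\psi(x,\nabla v\,\sigma)$ are row vectors. Viscosity solution (usual generalized Neumann sense): $v$ is continuous on $\overline G$ and, for every $\chi\in C^2(\mathbb R^d)$ and $x_0\in\overline G$, writing $F_\chi(x_0)=-\mathscr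 L\chi(x_0)-\psi(x_0,\nabla\chi(x_0)\sigma(x_0))+\lambda$ and $\partial_\phi\chi(x_0)=(\nabla\phi(x_0),\nabla\chi(x_0))$: if $v-\chi$ has a local maximum relative to $\overline G$ at $x_0$, then $F_\chi(x_0)\le0$ if $x_0\in G$ and $\min\{F_\chi(x_0),-\partial_\phi\chi(x_0)\}\le0$ if $x_0\in\partial G$; if $v-\chi$ has a local minimum relative to $\overline G$ at $x_0$, then $F_\chi(x_0)\ge0$ if $x_0\in G$ and $\max\{F_\chi(x_0),-\partial_\phi\chi(x_0)\}\ge0$ if $x_0\in\partial G$. *)

(* Defs.v *)
From HB Require Import structures.
From mathcomp Require Import all_boot all_order all_algebra.
From mathcomp Require Import all_classical all_reals all_analysis.

Set Implicit Arguments.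
Unset Strict Implicit.
Unset Printing Implicit Defensive.

Import Order.TTheory GRing.Theory Num.Theory.
Import numFieldNormedType.Exports.

Local Open Scope classical_set_scope.
Local Open Scope ring_scope.

(** Vectors of [R^d] are columns ['cV[R]_d], gradients and the processes [Z]
    are rows ['rV[R]_d].  The norm of the library on matrices is the sup norm,
    hence the Euclidean structure below. *)

Definition boundary {T : topologicalType} (A : set T) : set T :=
  closure A `\` interior A.

Section euclidean.
Context {R : realType}.

Definition inner m n (A B : 'M[R]_(m, n)) : R := \sum_i \sum_j A i j * B i j.

(** Euclidean norm of vectors (rows or columns), Frobenius norm of matrices. *)
Definition enorm m n (A : 'M[R]_(m, n)) : R := Num.sqrt (inner A A).

Definition opnorm d (A : 'M[R]_d) : R :=
  sup [set enorm (A *m y) | y in [set y : 'cV[R]_d | enorm y <= 1]].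

Definition elipschitz d m n (h : 'cV[R]_d -> 'M[R]_(m, n)) : Prop :=
  exists L : R, forall x y, enorm (h x - h y) <= L * enorm (x - y).

Definition loc_elipschitz d m n (h : 'cV[R]_d -> 'M[R]_(m, n)) : Prop :=
  forall x0, exists L r : R, 0 < r /\
    forall x y, enorm (x - x0) < r -> enorm (y - x0) < r ->
      enorm (h x - h y) <= L * enorm (x - y).

Definition loc_lipschitz d (v : 'cV[R]_d -> R) : Prop :=
  loc_elipschitz (fun x => (v x)%:M : 'M[R]_1).

End euclidean.

Section calculus.
Context {R : realType} {d : nat}.
Implicit Types u : 'cV[R]_d -> R.

Definition partial (i : 'I_d) u (x : 'cV[R]_d) : R := 'D_(delta_mx i 0) u x.

Definition is_C1 u : Prop :=
  forall i, (forall x, derivable u x (delta_mx i 0)) /\ continuous (partial i u).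

Definition is_C2 u : Prop := is_C1 u /\ forall i, is_C1 (partial i u).

Definition grad u x : 'rV[R]_d := \row_i partial i u x.

Definition hess u x : 'M[R]_d := \matrix_(i, j) partial j (partial i u) x.

End calculus.

Section hypotheses.
Context {R : realType} {d : nat}.
Implicit Types (dd b f : 'cV[R]_d -> 'cV[R]_d) (sigma : 'cV[R]_d -> 'M[R]_d).
Implicit Types (psi : 'cV[R]_d -> 'rV[R]_d -> R) (G : set 'cV[R]_d).

Definition dissipative (eta : R) dd : Prop :=
  forall x x', inner (dd x - dd x') (x - x') <= - eta * enorm (x - x') ^+ 2.

Definition hypA dd b sigma : Prop :=
  [/\ [/\ (exists2 eta : R, 0 < eta & dissipative eta dd),
          loc_elipschitz dd
        & exists C nu : R, [/\ 0 < C, 0 < nu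
            & forall x, enorm (dd x) <= C * (1 + enorm x `^ nu)]],
      elipschitz b /\ (exists B : R, forall x, enorm (b x) <= B),
      [/\ elipschitz sigma,
          (forall x, sigma x \in unitmx)
        & exists sigma_oo : R, forall x,
            enorm (sigma x) <= sigma_oo /\ enorm (invmx (sigma x)) <= sigma_oo]
    & (exists2 Lam : R,
          0 <= Lam /\ (forall x y,
            enorm (y^T *m (sigma (x + y) - sigma x)) <= Lam * enorm y)
        & exists2 lam0 : R, 0 < lam0 &
            sup (range (fun x => opnorm (invmx (sigma x)))) ^+ 2
              < 2 * (lam0 - lam0 ^+ 2 * Lam ^+ 2))].

(** [F] is meant to be a sigma-algebra: measurability with respect to [F] and
    the Borel sets of [T]. *)
Definition measurable_wrt {S : Type} {T : topologicalType}
    (F : set (set S)) (h : S -> T) : Prop :=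
  forall U : set T, open U -> F (h @^-1` U).

Definition borel (T : topologicalType) : set (set T) := <<s @open T >>.
Arguments borel T : clear implicits.

Definition hypP psi : Prop :=
  measurable_wrt (borel ('cV[R]_d * 'rV[R]_d)%type) (fun p => psi p.1 p.2) /\
  exists M : R, forall x z z',
    [/\ continuous (fun y => psi y z),
        `|psi x 0| <= M
      & `|psi x z - psi x z'| <= M * enorm (z - z')].

Definition hypG G (phi : 'cV[R]_d -> R) : Prop :=
  [/\ open G, convex_set (G : set (convex_lmodType 'cV[R]_d)),
      is_C2 phi,
      (exists M : R, forall x i j,
         `|partial i phi x| <= M /\ `|partial j (partial i phi) x| <= M)
    & [/\ G = [set x | 0 < phi x],
          boundary G = [set x | phi x = 0]
        & forall x, boundary G x -> enorm (grad phi x) = 1]].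

(** Elliptic operator and viscosity solutions of the Neumann problem. *)

Definition Lop f sigma (u : 'cV[R]_d -> R) (x : 'cV[R]_d) : R :=
  2^-1 * \tr (sigma x *m (sigma x)^T *m hess u x) + (grad u x *m f x) 0 0.

Definition viscosity_solution G (phi : 'cV[R]_d -> R) f sigma psi (lam : R)
    (v : 'cV[R]_d -> R) : Prop :=
  let F chi x := - Lop f sigma chi x - psi x (grad chi x *m sigma x) + lam in
  let dphi chi x := inner (grad phi x) (grad chi x) in
  {within closure G, continuous v} /\
  forall (chi : 'cV[R]_d -> R) x0, is_C2 chi -> closure G x0 ->
    ((\forall x \near within (closure G) (nbhs x0),
        v x - chi x <= v x0 - chi x0) ->
      (G x0 -> F chi x0 <= 0) /\
      (boundary G x0 -> Num.min (F chi x0) (- dphi chi x0) <= 0)) /\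
    ((\forall x \near within (closure G) (nbhs x0),
        v x0 - chi x0 <= v x - chi x) ->
      (G x0 -> 0 <= F chi x0) /\
      (boundary G x0 -> 0 <= Num.max (F chi x0) (- dphi chi x0))).

End hypotheses.

Arguments borel T : clear implicits.

Section processes.
Context {R : realType} {d : nat} {disp : measure_display}
  {Omega : measurableType disp} (P : probability Omega R).
(** Processes are functions on all of [R]; only times [0 <= t] matter. *)
Implicit Types (W : R -> Omega -> 'cV[R]_d) (Z : R -> Omega -> 'rV[R]_d).

Notation leb := (@lebesgue_measure R).

Definition natural_filtration W (t : R) : set (set Omega) :=
  <<s [set A | exists (s : R) (U : set 'cV[R]_d),
         [/\ 0 <= s <= t, open U & A = W s @^-1` U]] `|` P.-negligible >>.

Definition adapted {T : topologicalType} W (X : R -> Omega -> T) : Prop :=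
  forall t : R, 0 <= t -> measurable_wrt (natural_filtration W t) (X t).

Definition progressive {T : topologicalType} W (X : R -> Omega -> T) : Prop :=
  forall t : R, 0 <= t -> forall U : set T, open U ->
    <<s [set D | exists A B, [/\ measurable (A : set R),
                                 natural_filtration W t B & D = A `*` B]] >>
      [set p : R * Omega | 0 <= p.1 <= t /\ U (X p.1 p.2)].

Definition as_continuous {T : topologicalType} (X : R -> Omega -> T) : Prop :=
  {ae P, forall w, {within `[0, +oo[, continuous (fun t => X t w)}}.

Definition brownian W : Prop :=
  [/\ (forall t : R, 0 <= t -> measurable_wrt (measurable : set (set Omega)) (W t)),
      {ae P, forall w, W 0 w = 0},
      as_continuous W,
      (forall s t : R, 0 <= s < t -> forall B : 'I_d -> set R,
         (forall i, measurable (B i)) ->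
         P [set w | forall i, B i (W t w i 0 - W s w i 0)]
         = (\prod_(i < d) normal_prob 0 (Num.sqrt (t - s)) (B i))%E)
    & (forall s t : R, 0 <= s < t -> forall A (U : set 'cV[R]_d),
         natural_filtration W s A -> borel _ U ->
         P (A `&` [set w | U (W t w - W s w)])
         = (P A * P [set w | U (W t w - W s w)%R])%E)].

Definition M2 W Z : Prop :=
  progressive W Z /\
  forall T : R, 0 < T ->
    (\int[P]_w \int[leb]_(s in `[0%R, T]) ((enorm (Z s w) ^+ 2)%:E) < +oo)%E.

(** Ito integral of [Z] in [M2], through approximation by simple processes:
    finite sums of [1_{]lo, hi]} * coef] with [coef] bounded and
    [F_lo]-measurable. *)

Record step := Step { lo : R; hi : R; coef : Omega -> 'rV[R]_d }.

Definition simple W (S : seq step) : Prop :=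
  forall k, (k < size S)%N ->
    let e := nth (Step 0 0 (fun=> 0)) S k in
    [/\ 0 <= lo e <= hi e,
        measurable_wrt (natural_filtration W (lo e)) (coef e)
      & exists C : R, forall w, enorm (coef e w) <= C].

Definition simple_val (S : seq step) (s : R) (w : Omega) : 'rV[R]_d :=
  \sum_(e <- S) if lo e < s <= hi e then coef e w else 0.

Definition simple_int W (S : seq step) (t : R) (w : Omega) : R :=
  \sum_(e <- S)
    (coef e w *m (W (Num.min (hi e) t) w - W (Num.min (lo e) t) w)) 0 0.

Definition ito_integral W Z (I : R -> Omega -> R) : Prop :=
  [/\ M2 W Z, adapted W I, as_continuous I
    & exists S : nat -> seq step, (forall n, simple W (S n)) /\
      forall T : R, 0 < T ->
        (fun n => \int[P]_w \int[leb]_(s in `[0%R, T])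
           ((enorm (simple_val (S n) s w - Z s w) ^+ 2)%:E))%E @ \oo --> 0%E /\
        (fun n => \int[P]_w
           (((simple_int W (S n) T w - I T w) ^+ 2)%:E))%E @ \oo --> 0%E].

(** Reflected SDE.  For almost every path, [dK] is the Lebesgue-Stieltjes
    measure of a cumulative function which agrees with the path of [K] on
    [0, +oo[; by continuity of [K] nothing is lost by integrating over
    ]0, t]. *)
Definition reflected_sde W (G : set 'cV[R]_d) (phi : 'cV[R]_d -> R)
    (f : 'cV[R]_d -> 'cV[R]_d) (sigma : 'cV[R]_d -> 'M[R]_d) (x : 'cV[R]_d)
    (X : R -> Omega -> 'cV[R]_d) (K : R -> Omega -> R) : Prop :=
  [/\ adapted W X, adapted W K, as_continuous X, as_continuous K
    & exists I : R -> Omega -> 'cV[R]_d,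
      (forall i, ito_integral W (fun s w => row i (sigma (X s w)))
                               (fun t w => I t w i 0)) /\
      {ae P, forall w,
        [/\ (forall t : R, 0 <= t -> closure G (X t w)),
            K 0 w = 0,
            (forall s t : R, 0 <= s <= t -> K s w <= K t w)
          & exists k : cumulative R R,
            (forall t : R, 0 <= t -> k t = K t w) /\
            forall t : R, 0 <= t ->
              X t w = x + \col_i (\int[leb]_(s in `[0, t]) (f (X s w) i 0))
                        + I t w
                        + \col_i (\int[lebesgue_stieltjes_measure k]_(s in `]0, t])
                                    (grad phi (X s w) 0 i)) /\
              K t w = \int[lebesgue_stieltjes_measure k]_(s in `]0, t])
                        (\1_(boundary G) (X s w))]}].

Definition ergodic_bsde W (psi : 'cV[R]_d -> 'rV[R]_d -> R) (lam : R)
    (X : R -> Omega -> 'cV[R]_d) (Y : R -> Omega -> R) Z : Prop :=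
  exists2 I : R -> Omega -> R, ito_integral W Z I &
    {ae P, forall w, forall t T : R, 0 <= t <= T ->
      Y t w = Y T w + \int[leb]_(s in `[t, T]) (psi (X s w) (Z s w) - lam)
              - (I T w - I t w)}.

End processes.

(* Main.v *)
Require Import Defs.
From HB Require Import structures.
From mathcomp Require Import all_boot all_order all_algebra.
From mathcomp Require Import all_classical all_reals all_analysis.
From mathcomp Require Import measurable_realfun.
From mathcomp Require Import ring lra.

Set Implicit Arguments.
Unset Strict Implicit.
Unset Printing Implicit Defensive.

Import Order.TTheory GRing.Theory Num.Theory.
Import numFieldNormedType.Exports.

Local Open Scope classical_set_scope.
Local Open Scope ring_scope.

(** Let [v - chi] have a local maximum at [x0], write [p], [H] for the gradient and Hessian of [chi]
    there, and suppose that [F], the value at [x0] of [- Lop f sigma chi - psi + lam], is positive,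
    with [x0] in [G] or the derivative of [chi] along [grad phi] negative at [x0]. A contradiction
    is drawn from the reflected diffusion started at [x0] and stopped at a time [tau <= T] before it
    leaves a ball of small radius [r].

    The increment of [v] along the path is known from the backward equation. It is also bounded
    above by the second-order Taylor polynomial of [chi] in [X tau - x0], which is replaced by its
    martingale part [I]. Let [N] be the martingale part of [v(X)] minus [p . I]; it is the
    stochastic integral of [xi(X) - p sigma(X)]. Since [psi] is Lipschitz in [z], this yields
    pathwise [N <= 1/2 H I . I + eps |I|^2 + (a0 + 2 eps) tau + M R1], where [R1] is the time
    integral of [|xi(X) - p sigma(X)|]. The reflection has a favourable sign: it acts only on the
    boundary, where [p . grad phi <= - c]. In expectation, [E N = 0] and the covariance of [I] is
    close to [S E tau] with [S = sigma sigma^T] at [x0], so that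
    [0 <= (- F + small) E tau + M E R1].

    It remains to see that [E R1] is small compared with [T]. By Young's inequality it suffices to
    treat [R2], the time integral of [|xi(X) - p sigma(X)|^2], whose expectation is [E N^2] by the
    Ito isometry. A crude pathwise bound gives [|N| <= eta + M R1], hence [N^2 <= |N| (eta + M R1)];
    the term with [R1] is absorbed for small [T], and [E |N| = 2 E N^+] is [O(T) + M E R2] by the
    upper bound above. So [E R2] is at most a constant times [eta T], while [E tau >= T / 2], and a
    small [eta] contradicts [F > 0]. Only the linear part of [chi] is matched with a stochastic
    integral, so the argument rests on Taylor's formula and the isometry.

    The lemmas that carry this are [pathwise_upper] and [pathwise_bound] (one path), [endgame]
    (expectations), [stopped_isometry] (mean and isometry at a stopping time, through dyadic times
    and sums over grids), [ito_pair_version] (a continuous version starting at 0), [horizon_exists]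
    (the time [tau]) and [subsolution]. The supersolution half follows from [subsolution] by
    changing the signs of [v], [xi], [lam], [chi] and replacing [psi x z] by [- psi x (- z)]. *)

Notation igr mu f := ((mu).-integrable setT (EFin \o f)).
(** Serves both as expectation under [P] and as integral over the product of probability and time.
    An infinite integral gets the default value 0, hence the integrability premises in what
    follows. *)
Notation Exp mu f := (Rintegral mu setT f).

(** * Real integrals and square-integrable functions *)

Section real_integral.
Context d (T : measurableType d) (R : realType).
Variable mu : {measure set T -> \bar R}.
Implicit Types f g : T -> R.

Lemma igr_measurable f : igr mu f -> measurable_fun setT f.
Proof. by move/measurable_int/measurable_EFinP. Qed.

Lemma igrD f g : igr mu f -> igr mu g -> igr mu (fun x => f x + g x).
Proof. by move=> hf hg; have := integrableD measurableT hf hg. Qed.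

Lemma igrZ a f : igr mu f -> igr mu (fun x => a * f x).
Proof. by move=> hf; have := integrableZl measurableT a hf. Qed.

Lemma igrN f : igr mu f -> igr mu (fun x => - f x).
Proof. by move=> hf; have := integrableN hf. Qed.

Lemma igr_sum (I : Type) (s : seq I) (p : pred I) (F : I -> T -> R) :
  (forall i, igr mu (F i)) -> igr mu (fun x => \sum_(i <- s | p i) F i x).
Proof.
move=> h; elim: s => [|i s ih].
  apply: eq_integrable (integrable0 mu setT) => // x _ /=.
  by rewrite big_nil.
have -> : (fun x => \sum_(j <- i :: s | p j) F j x) =
   (fun x => (if p i then F i x else 0) + \sum_(j <- s | p j) F j x).
  by apply/funext => x; rewrite big_cons; case: (p i); rewrite ?add0r.
apply: igrD => //; case: (p i) => //.
exact: (integrable0 mu setT).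
Qed.

Lemma igr_le f g : measurable_fun setT f -> igr mu g ->
  (forall x, `|f x| <= g x) -> igr mu f.
Proof.
move=> mf hg fg; apply: le_integrable hg => //; first exact/measurable_EFinP.
move=> x _ /=; rewrite lee_fin (le_trans (fg x))// ler_norm //.
Qed.

Lemma ExpD f g : igr mu f -> igr mu g ->
  Exp mu (fun x => f x + g x) = Exp mu f + Exp mu g.
Proof. by move=> hf hg; rewrite RintegralD. Qed.

Lemma ExpZ a f : igr mu f -> Exp mu (fun x => a * f x) = a * Exp mu f.
Proof. by move=> hf; rewrite RintegralZl. Qed.

Lemma ExpN f : igr mu f -> Exp mu (fun x => - f x) = - Exp mu f.
Proof.
move=> hf; rewrite -mulN1r -ExpZ//; apply: eq_Rintegral => x _.
by rewrite mulN1r.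
Qed.

Lemma ExpB f g : igr mu f -> igr mu g ->
  Exp mu (fun x => f x - g x) = Exp mu f - Exp mu g.
Proof. by move=> hf hg; rewrite RintegralB. Qed.

Lemma Exp0 : Exp mu (fun=> 0 : R) = 0.
Proof. by rewrite /Rintegral integral0. Qed.

Lemma Exp_sum (I : Type) (s : seq I) (p : pred I) (F : I -> T -> R) :
  (forall i, igr mu (F i)) ->
  Exp mu (fun x => \sum_(i <- s | p i) F i x) = \sum_(i <- s | p i) Exp mu (F i).
Proof.
move=> h; elim: s => [|i s ih].
  by rewrite big_nil -[RHS]Exp0; apply: eq_Rintegral => x _; rewrite big_nil.
rewrite big_cons -ih; case: ifPn => pi; last first.
  by apply: eq_Rintegral => x _; rewrite big_cons (negbTE pi).
rewrite -ExpD//; last exact: igr_sum.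
by apply: eq_Rintegral => x _; rewrite big_cons pi.
Qed.

Lemma le_Exp f g : igr mu f -> igr mu g -> (forall x, f x <= g x) ->
  Exp mu f <= Exp mu g.
Proof. by move=> hf hg fg; apply: le_Rintegral. Qed.

Lemma EFin_Exp f : igr mu f -> (Exp mu f)%:E = (\int[mu]_x (f x)%:E)%E.
Proof. by move=> hf; rewrite fineK// (integrable_fin_num measurableT hf). Qed.

Lemma Exp_ge0 f : (forall x, 0 <= f x) -> 0 <= Exp mu f.
Proof. by move=> h; apply: Rintegral_ge0. Qed.

(** Junk value: [Exp mu f = 0] for nonnegative [f] of infinite integral. *)
Lemma igr_ge0P f : measurable_fun setT f -> (forall x, 0 <= f x) ->
  (\int[mu]_x (f x)%:E < +oo)%E -> igr mu f.
Proof.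
move=> mf f0 foo; apply/integrableP; split; first exact/measurable_EFinP.
by under eq_integral do rewrite /= ger0_norm//.
Qed.

(** Measurability of [f] is a separate clause because integrability of the square only makes
    [f ^+ 2] measurable. *)
Definition sqi f := measurable_fun setT f /\ igr mu (fun x => f x ^+ 2).

Lemma sqi_measurable f : sqi f -> measurable_fun setT f.
Proof. by case. Qed.

Lemma sqi_le f g : measurable_fun setT f -> sqi g ->
  (forall x, `|f x| <= `|g x|) -> sqi f.
Proof.
move=> mf [mg hg] fg; split => //; apply: igr_le hg _.
  exact: measurable_funX.
move=> x; rewrite normrX.
by rewrite -[leRHS]real_normK ?num_real// lerXn2r// ?nnegrE.
Qed.

Lemma sqiM_igr f g : sqi f -> sqi g -> igr mu (fun x => f x * g x).
Proof.
move=> [mf hf] [mg hg]; apply: igr_le (igrD hf hg) _.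
  exact: measurable_funM.
move=> x /=; rewrite normrM.
have := sqr_ge0 (`|f x| - `|g x|).
have := sqr_ge0 (f x); have := sqr_ge0 (g x).
by rewrite -(real_normK (num_real (f x))) -(real_normK (num_real (g x))); nra.
Qed.

Lemma sqiZ a f : sqi f -> sqi (fun x => a * f x).
Proof.
move=> [mf hf]; split; first exact: measurable_funM.
have -> : (fun x => (a * f x) ^+ 2) = (fun x => a ^+ 2 * f x ^+ 2).
  by apply/funext => x; rewrite exprMn.
exact: igrZ.
Qed.

Lemma sqiD f g : sqi f -> sqi g -> sqi (fun x => f x + g x).
Proof.
move=> hf hg; have [mf f2] := hf; have [mg g2] := hg.
split; first exact: measurable_funD.
have -> : (fun x => (f x + g x) ^+ 2) =
    (fun x => (f x ^+ 2 + 2 * (f x * g x)) + g x ^+ 2).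
  by apply/funext => x; rewrite sqrrD -mulr_natl.
by do 2 apply: igrD => //; apply/igrZ/sqiM_igr.
Qed.

Lemma sqiN f : sqi f -> sqi (fun x => - f x).
Proof.
move=> [mf hf]; split; first exact: measurableT_comp.
by have -> : (fun x => (- f x) ^+ 2) = (fun x => f x ^+ 2)
  by apply/funext => x; rewrite sqrrN.
Qed.

Lemma sqiB f g : sqi f -> sqi g -> sqi (fun x => f x - g x).
Proof. by move=> hf hg; apply: sqiD => //; apply: sqiN. Qed.

Lemma sqi0 : sqi (fun=> 0).
Proof.
split => //; rewrite expr0n /=; exact: (integrable0 mu setT).
Qed.

Lemma sqi_sum (I : Type) (s : seq I) (F : I -> T -> R) :
  (forall i, sqi (F i)) -> sqi (fun x => \sum_(i <- s) F i x).
Proof.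
move=> h; elim: s => [|i s ih].
  by have -> : (fun x => \sum_(i <- [::]) F i x) = (fun=> 0);
    [apply/funext => x; rewrite big_nil | exact: sqi0].
have -> : (fun x => \sum_(j <- i :: s) F j x) =
   (fun x => F i x + \sum_(j <- s) F j x).
  by apply/funext => x; rewrite big_cons.
exact: sqiD.
Qed.

Lemma sqi_bounded C f g : measurable_fun setT f -> (forall x, `|f x| <= C) ->
  sqi g -> sqi (fun x => f x * g x).
Proof.
move=> mf fC hg; apply: sqi_le (sqiZ C hg) _.
  by apply: measurable_funM => //; apply: sqi_measurable hg.
move=> x; rewrite !normrM ler_wpM2r//.
exact: le_trans (fC x) (ler_norm _).
Qed.

End real_integral.

Section finite_integral.
Context d (T : measurableType d) (R : realType) (P : probability T R).
Implicit Types f g : T -> R.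

Lemma igr_cst (c : R) : igr P (fun=> c).
Proof. exact: finite_measure_integrable_cst. Qed.

Lemma Exp_cst (c : R) : Exp P (fun=> c) = c.
Proof.
rewrite (Rintegral_cst P measurableT).
by rewrite [X in fine X](@probability_setT _ _ _ P) mulr1.
Qed.

Lemma igr_bounded C f : measurable_fun setT f -> (forall x, `|f x| <= C) -> igr P f.
Proof. by move=> mf fC; apply: igr_le (igr_cst C) _. Qed.

Lemma sqi_cst (c : R) : sqi P (fun=> c).
Proof. by split => //; exact: igr_cst. Qed.

Lemma sqi_igr f : sqi P f -> igr P f.
Proof.
move=> hf; have := sqiM_igr hf (sqi_cst 1).
by under [X in igr P X]eq_fun do rewrite mulr1.
Qed.

(** The product rule on rectangles identifies the law of the pair with the product of the two laws,
    by uniqueness of the product measure. Tonelli for absolute values gives integrability of the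
    product, and Fubini then factors the integral. *)
Lemma indep_ExpM f g : igr P f -> igr P g ->
  (forall A B, measurable A -> measurable B ->
    P (f @^-1` A `&` g @^-1` B) = P (f @^-1` A) * P (g @^-1` B))%E ->
  igr P (fun x => f x * g x) /\ Exp P (fun x => f x * g x) = Exp P f * Exp P g.
Proof.
move=> hf hg ind.
have mf := igr_measurable hf; have mg := igr_measurable hg.
pose fM : {mfun T >-> R} := HB.pack f (isMeasurableFun.Build _ _ _ _ _ mf).
pose gM : {mfun T >-> R} := HB.pack g (isMeasurableFun.Build _ _ _ _ _ mg).
have mh : measurable_fun setT (fun x => (f x, g x)) by exact: measurable_fun_pair.
pose h : {mfun T >-> (R * R)%type} := HB.pack (fun x => (f x, g x))
   (isMeasurableFun.Build _ _ _ _ _ mh).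
have E X : measurable X ->
    (distribution P fM \x distribution P gM)%E X = distribution P h X.
  move=> mX; by apply: product_measure_unique => // A B mA mB; exact: ind.
have mprod : measurable_fun setT (fun z : R * R => (z.1 * z.2)%:E).
  apply/measurable_EFinP; apply: measurable_funM; exact: measurable_fst || exact: measurable_snd.
have abs_f : (\int[P]_x `|f x|%:E < +oo)%E by move/integrableP : hf => [_].
have abs_g : (\int[P]_x `|g x|%:E < +oo)%E by move/integrableP : hg => [_].
have I : (distribution P fM \x distribution P gM)%E.-integrable setT
    (fun z : R * R => (z.1 * z.2)%:E).
  apply/(integrable12ltyP _ _ mprod) => /=.
  have -> : (\int[distribution P fM]_x \int[distribution P gM]_y
      `|(x * y)%:E| = \int[P]_x `|f x|%:E * \int[P]_x `|g x|%:E)%E.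
    have mn : measurable_fun setT (fun y : R => `|y|%:E).
      by apply/measurable_EFinP.
    have e1 x : (\int[distribution P gM]_y `|(x * y)%:E| =
        `|x|%:E * \int[P]_x `|g x|%:E)%E.
      rewrite -(ge0_integral_distribution gM (f := fun y => `|y|%:E)) //.
      rewrite -ge0_integralZl_EFin//.
      by apply: eq_integral => y _; rewrite abse_EFin normrM EFinM.
    under eq_integral do rewrite e1.
    rewrite ge0_integralZr//; last by apply: integral_ge0 => x _; rewrite lee_fin.
    by rewrite (ge0_integral_distribution fM (f := fun y => `|y|%:E)).
  apply: lte_mul_pinfty => //.
  - by apply: integral_ge0 => x _; rewrite lee_fin.
  - by rewrite ge0_fin_numE//; apply: integral_ge0 => x _; rewrite lee_fin.
have I' : (distribution P h).-integrable setT (fun z : R * R => (z.1 * z.2)%:E).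
  apply/integrableP; split => //.
  move/integrableP : I => [_]; congr (_ < _)%E.
  by apply: eq_measure_integral => A mA _; exact: E.
have igfg : igr P (fun x => f x * g x).
  apply/integrableP; split; first by apply/measurable_EFinP; exact: measurable_funM.
  move/integrableP : I' => [_]; rewrite (ge0_integral_distribution h)//.
  exact: measurableT_comp.
split => //.
have : (\int[P]_x (f x * g x)%:E = \int[P]_x (f x)%:E * \int[P]_x (g x)%:E)%E.
  rewrite -(integral_distribution (X := h) mprod)//.
  rewrite (eq_measure_integral (distribution P fM \x distribution P gM)%E); last first.
    by move=> A mA _; exact/esym/E.
  rewrite -integral12_prod_meas1//= /fubini_F/=.
  have mE : measurable_fun setT (fun y : R => y%:E) by exact/measurable_EFinP.
  have Ig : (distribution P gM).-integrable setT (fun y => y%:E).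
    exact: (@integrable_pushforward _ _ _ _ _ gM).
  have e1 x : (\int[distribution P gM]_y (x * y)%:E =
      x%:E * \int[P]_x (g x)%:E)%E.
    rewrite -(integral_distribution (X := gM) (f := fun y => y%:E))//.
    by rewrite -integralZl.
  under eq_integral do rewrite e1.
  rewrite -(EFin_Exp hg) integralZr//=; last first.
    by apply: (@integrable_pushforward _ _ _ _ _ fM).
  by rewrite (integral_distribution (X := fM) (f := fun y => y%:E)).
rewrite -!EFin_Exp// -EFinM => -[//].
Qed.

End finite_integral.

(** * First two moments of the centred Gaussian law *)

Section gaussian.
Variables (R : realType) (s : R).
Hypothesis s0 : 0 < s.
Notation mu := (@lebesgue_measure R).
Notation N := (normal_prob 0 s).
Notation pdf := (normal_pdf 0 s).

Let sN0 : s != 0. Proof. by rewrite gt_eqF. Qed.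

(** The density and the Radon-Nikodym derivative have the same integral on every measurable set, so
    they agree almost everywhere. *)
Lemma ge0_integral_normal_prob (f : R -> \bar R) : measurable_fun setT f ->
  (forall x, 0 <= f x)%E ->
  (\int[N]_x f x = \int[mu]_x (f x * (pdf x)%:E))%E.
Proof.
move=> mf f0.
have dom : N `<< mu by exact: normal_prob_dominates.
rewrite -(Radon_Nikodym_SigmaFinite.change_of_variables dom)//.
apply: ge0_ae_eq_integral => //.
- apply: emeasurable_funM => //.
  exact/measurable_int/(Radon_Nikodym_SigmaFinite.f_integrable dom).
- apply: emeasurable_funM => //; apply/measurable_EFinP; exact: measurable_normal_pdf.
- by move=> x _; rewrite mule_ge0// Radon_Nikodym_SigmaFinite.f_ge0.
- by move=> x _; rewrite mule_ge0// lee_fin normal_pdf_ge0.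
- apply: ae_eqe_mul2l.
  apply: integral_ae_eq => //=.
  + exact: Radon_Nikodym_SigmaFinite.f_integrable.
  + apply/measurable_EFinP; exact: measurable_normal_pdf.
  + by move=> A _ mA; rewrite -(Radon_Nikodym_SigmaFinite.f_integral dom).
Qed.

Lemma normal_pdf_sym x : pdf (- x) = pdf x.
Proof. by rewrite /normal_pdf (negbTE sN0) /normal_fun !subr0 sqrrN. Qed.

Let k := normal_peak s.
Let e (x : R) := expR (- x ^+ 2 / (s ^+ 2 *+ 2)).

Let pdfE x : pdf x = k * e x.
Proof. by rewrite /normal_pdf (negbTE sN0) /normal_fun subr0. Qed.

Let cpdf : continuous pdf.
Proof. exact: continuous_normal_pdf. Qed.

Let is_derive_pdf (x : R) : is_derive x 1 pdf (- (x / s ^+ 2) * pdf x).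
Proof.
have -> : pdf = (fun x => k * e x) by apply/funext => y; rewrite pdfE.
rewrite /e; apply: is_derive_eq.
by rewrite /GRing.scale /= mulr0 add0r; field.
Qed.

(** [F] is a primitive of [f] that vanishes at 0 and at infinity. Hence [f] has integral 0 over the
    half-line, which is the statement that the second moment of [x / s] there equals the mass of the
    density. *)
Let F (x : R) := x * pdf x.
Let f (x : R) := (1 - x / s * (x / s)) * pdf x.

Let is_derive_F (x : R) : is_derive x 1 F (f x).
Proof.
have h := is_derive_pdf x.
apply: is_derive_eq; rewrite /GRing.scale /= /f; field.
exact: sN0.
Qed.

Let cf : continuous f.
Proof.
move=> x; apply: cvgM; last exact: cpdf.
apply: cvgB; first exact: cvg_cst.
by apply: cvgM; apply: cvgMl; exact: cvg_id.
Qed.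

(** From [expR u >= 1 + u] at [u = x^2 / (2 s^2)] one gets [e x * x^2 <= 2 s^2], so [F x] is at most
    [2 s^2 k / x]. *)
Let cvgF : F x @[x --> +oo] --> 0.
Proof.
apply/cvgrPdist_le => /= eps eps0; near=> x.
have x0 : 0 < x by near: x; exact/nbhs_pinfty_gt/num_real.
have kge0 : 0 <= k by exact: normal_peak_ge0.
have hx : 2 * s ^+ 2 * k / eps <= x by near: x; exact/nbhs_pinfty_ge/num_real.
rewrite sub0r normrN /F ger0_norm; last by rewrite mulr_ge0 ?normal_pdf_ge0// ltW.
rewrite pdfE.
have e1 : e x * (x ^+ 2 / (s ^+ 2 *+ 2)) <= 1.
  have := expR_ge1Dx (x ^+ 2 / (s ^+ 2 *+ 2)) => h.
  rewrite /e mulNr expRN mulrC ler_pdivrMr ?expR_gt0// mul1r.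
  by apply: le_trans h; rewrite lerDr.
have s2 : 0 < s ^+ 2 by rewrite exprn_gt0.
have e2 : e x * x ^+ 2 <= 2 * s ^+ 2.
  by move: e1; rewrite mulrA ler_pdivrMr ?pmulrn_lgt0// mul1r (mulr_natl (s ^+ 2) 2).
have hx' : 2 * s ^+ 2 * k <= x * eps by rewrite -ler_pdivrMr.
rewrite -(ler_pM2r x0).
apply: le_trans (_ : k * (e x * x ^+ 2) <= _); first by rewrite le_eqVlt; apply/orP; left; apply/eqP; ring.
apply: le_trans (ler_wpM2l kge0 e2) _.
by rewrite mulrC [leRHS]mulrC.
Unshelve. all: by end_near. Qed.

Let measF : measurable_fun setT f.
Proof. exact: continuous_measurable_fun. Qed.

Let int0s : (\int[mu]_(x in `[0%R, s]) (f x)%:E = (F s)%:E)%E.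
Proof.
rewrite (@continuous_FTC2 _ f F)//.
- by rewrite /F mul0r sube0.
- by apply: continuous_subspaceT; exact: cf.
- split.
  + by move=> x _; have [] := is_derive_F x.
  + by apply: cvg_at_right_filter; apply: differentiable_continuous; apply/derivable1_diffP; have [] := is_derive_F 0.
  + by apply: cvg_at_left_filter; apply: differentiable_continuous; apply/derivable1_diffP; have [] := is_derive_F s.
- by move=> x _; rewrite derive1E; have := is_derive_F x => ?; rewrite derive_val.
Qed.

Let intsy : (\int[mu]_(x in `[s, +oo[) (- f x)%R%:E = (F s)%:E)%E.
Proof.
rewrite (@ge0_continuous_FTC2y _ (fun x => - f x) (fun x => - F x) s 0)//.
- by rewrite sub0e -EFinN opprK.
- move=> x sx; rewrite /f -mulNr mulr_ge0 ?normal_pdf_ge0// opprB subr_ge0.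
  by rewrite -expr2 exprn_ege1// ler_pdivlMr// mul1r.
- by apply: continuous_subspaceT => x; apply: cvgN; exact: cf.
- by rewrite -oppr0; apply: cvgN; exact: cvgF.
- by move=> x _; have [] := is_derive_F x => /derivableN.
- apply: cvgN; apply: cvg_at_right_filter; apply: differentiable_continuous; apply/derivable1_diffP; by have [] := is_derive_F s.
- by move=> x _; rewrite derive1E; have := is_derive_F x => ?; rewrite derive_val.
Qed.
(** [f] changes sign at [s], so the half-line is cut there. Each piece contributes [F s], once on
    either side, and only sums of nonnegative extended integrals are compared, never differences. *)
Let intf0y : (\int[mu]_(x in `[0%R, +oo[) ((x / s) ^+ 2 * pdf x)%:E =
  \int[mu]_(x in `[0%R, +oo[) (pdf x)%:E)%E.
Proof.
have mq : measurable_fun setT (fun x : R => ((x / s) ^+ 2 * pdf x)%:E).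
  apply/measurable_EFinP; apply: measurable_funM.
    by apply: measurable_funX; apply: measurable_funM.
  exact: measurable_normal_pdf.
have mp : measurable_fun setT (fun x : R => (pdf x)%:E).
  by apply/measurable_EFinP; exact: measurable_normal_pdf.
have mf : measurable_fun setT (fun x : R => (f x)%:E) by exact/measurable_EFinP.
have mfN : measurable_fun setT (fun x : R => (- f x)%:E).
  by apply/measurable_EFinP; exact: measurableT_comp.
have q0 x : 0 <= (x / s) ^+ 2 * pdf x by rewrite mulr_ge0 ?sqr_ge0 ?normal_pdf_ge0.
have p0 x : 0 <= pdf x by exact: normal_pdf_ge0.
have sp (g : R -> \bar R) : measurable_fun setT g -> (forall x, 0 <= g x)%E ->
   (\int[mu]_(x in `[0%R, +oo[) g x =
    \int[mu]_(x in `[0%R, s[) g x + \int[mu]_(x in `[s, +oo[) g x)%E.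
  move=> mg g0.
  have -> : `[0%R, +oo[%classic = `[0%R, s[ `|` `[s, +oo[.
    by rewrite -itv_bndbnd_setU// ?bnd_simp// ltW.
  rewrite ge0_integral_setU//.
  - exact: measurable_funTS.
  - apply/disj_set2P; rewrite -subset0 => x /=; rewrite !in_itv/= => -[/andP[_ xs]].
    by rewrite andbT leNgt xs.
rewrite (sp _ mq)// (sp _ mp)//.
rewrite (integral_itv_bndo_bndc (measurable_funTS mq)).
rewrite (integral_itv_bndo_bndc (measurable_funTS mp)).
have e1 : (\int[mu]_(x in `[0%R, s]) (pdf x)%:E = (F s)%:E +
    \int[mu]_(x in `[0%R, s]) ((x / s) ^+ 2 * pdf x)%:E)%E.
  rewrite -int0s -ge0_integralD//; first last.
  - exact: measurable_funTS.
  - by move=> x _; rewrite lee_fin.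
  - exact: measurable_funTS.
  - move=> x; rewrite /= in_itv/= => /andP[x0 xs]; rewrite lee_fin /f mulr_ge0//.
    rewrite subr_ge0 -expr2 exprn_ile1//.
      by rewrite divr_ge0// ltW.
    by rewrite ler_pdivrMr// mul1r.
  by apply: eq_integral => x _; rewrite -EFinD /f; congr EFin; ring.
have e2 : (\int[mu]_(x in `[s, +oo[) ((x / s) ^+ 2 * pdf x)%:E = (F s)%:E +
    \int[mu]_(x in `[s, +oo[) (pdf x)%:E)%E.
  rewrite -intsy -ge0_integralD//; first last.
  - exact: measurable_funTS.
  - by move=> x _; rewrite lee_fin.
  - exact: measurable_funTS.
  - move=> x; rewrite /= in_itv/= andbT => sx; rewrite lee_fin /f -mulNr mulr_ge0//.
    by rewrite opprB subr_ge0 -expr2 exprn_ege1// ler_pdivlMr// mul1r.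
  by apply: eq_integral => x _; rewrite -EFinD /f; congr EFin; ring.
by rewrite e1 e2 addeCA addeA.
Qed.

Lemma normal_prob_sqr : (\int[N]_x (x ^+ 2)%:E = (s ^+ 2)%:E)%E.
Proof.
rewrite ge0_integral_normal_prob; last 2 first.
- by apply/measurable_EFinP; exact: measurable_funX.
- by move=> x; rewrite lee_fin sqr_ge0.
transitivity (\int[mu]_x ((s ^+ 2)%:E * ((x / s) ^+ 2 * pdf x)%:E))%E.
  apply: eq_integral => x _; rewrite -!EFinM; congr EFin; field; exact: sN0.
rewrite ge0_integralZl_EFin ?sqr_ge0//; last 2 first.
- by move=> x _; rewrite lee_fin mulr_ge0 ?sqr_ge0 ?normal_pdf_ge0.
- apply/measurable_EFinP; apply: measurable_funM.
    by apply: measurable_funX; apply: measurable_funM.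
  exact: measurable_normal_pdf.
have h (g : R -> R) : (forall x, 0 <= g x) -> continuous g -> g =1 g \o -%R ->
    (\int[mu]_x (g x)%:E = 2%:E * \int[mu]_(x in `[0%R, +oo[) (g x)%:E)%E.
  by move=> g0 cg ge; rewrite ge0_symfun_integralT// set_itvcy.
rewrite h; last 3 first.
- by move=> x; rewrite mulr_ge0 ?sqr_ge0 ?normal_pdf_ge0.
- move=> x; apply: cvgM; last exact: cpdf.
  under eq_fun do rewrite expr2.
  by rewrite expr2; apply: cvgM; apply: cvgMl; exact: cvg_id.
- by move=> x /=; rewrite normal_pdf_sym mulNr sqrrN.
rewrite intf0y -h; last 3 first.
- by move=> x; exact: normal_pdf_ge0.
- exact: cpdf.
- by move=> x /=; rewrite normal_pdf_sym.
by rewrite integral_normal_pdf mule1.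
Qed.

Lemma normal_prob_sqi : sqi N (fun x => x).
Proof.
split => //; apply: igr_ge0P.
- exact: measurable_funX.
- by move=> x; exact: sqr_ge0.
- by rewrite normal_prob_sqr ltry.
Qed.

Lemma normal_prob_variance : Exp N (fun x => x ^+ 2) = s ^+ 2.
Proof. by rewrite /Rintegral normal_prob_sqr. Qed.

(** The density is even, so the positive and negative parts of the identity have the same integral,
    which is finite by the second moment. *)
Lemma normal_prob_mean : Exp N (fun x => x) = 0.
Proof.
have neg : (\int[N]_x (Num.max (- x) 0)%:E = \int[N]_x (Num.max x 0)%:E)%E.
  have mm1 : measurable_fun setT (fun x : R => Num.max x 0).
    exact: measurable_maxr.
  have mm2 : measurable_fun setT (fun x : R => Num.max (- x) 0).
    by apply: measurable_maxr => //; exact: measurableT_comp.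
  rewrite (ge0_integral_normal_prob (f := fun x => (Num.max x 0)%:E)); last 2 first.
  - exact/measurable_EFinP.
  - by move=> x; rewrite lee_fin le_max lexx orbT.
  rewrite (ge0_integral_normal_prob (f := fun x => (Num.max (- x) 0)%:E)); last 2 first.
  - exact/measurable_EFinP.
  - by move=> x; rewrite lee_fin le_max lexx orbT.
  have mprod (g : R -> R) : measurable_fun setT g ->
      measurable_fun setT (fun x => (g x)%:E * (pdf x)%:E)%E.
    move=> mg; apply: emeasurable_funM; apply/measurable_EFinP => //.
    exact: measurable_normal_pdf.
  transitivity (\int[mu]_(x in `]-oo, 0%R]) ((Num.max (- x) 0 * pdf x)%:E))%E.
    have -> : [set: R] = `]-oo, 0%R] `|` `]0%R, +oo[.
      by rewrite -itv_bndbnd_setU// -set_itvNyy.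
    rewrite ge0_integral_setU//; first last.
    - apply/disj_set2P; rewrite -subset0 => x /=; rewrite !in_itv/= andbT => -[x0].
      by rewrite ltNge x0.
    - by move=> x _; rewrite mule_ge0 ?lee_fin ?normal_pdf_ge0// le_max lexx orbT.
    - exact: measurable_funTS (mprod _ mm2).
    rewrite [X in (_ + X)%E]integral0_eq ?adde0//.
    move=> x /=; rewrite in_itv/= andbT => x0.
    by rewrite max_r ?mul0e// oppr_le0 ltW.
  transitivity (\int[mu]_(x in `[0%R, +oo[) ((Num.max x 0 * pdf x)%:E))%E.
    have := @ge0_integration_by_substitutionNy _ (fun x => Num.max (- x) 0 * pdf x) 0.
    rewrite oppr0 => ->.
    + by apply: eq_integral => x _; rewrite /= opprK normal_pdf_sym.
    + apply: continuous_subspaceT => x; apply: cvgM; last exact: cpdf.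
      by apply: continuous_max; [apply: cvgN; exact: cvg_id|exact: cvg_cst].
    + by move=> x _; rewrite mulr_ge0 ?normal_pdf_ge0// le_max lexx orbT.
  have -> : [set: R] = `]-oo, 0%R[ `|` `[0%R, +oo[.
    by rewrite -itv_bndbnd_setU// -set_itvNyy.
  rewrite [RHS]ge0_integral_setU//; first last.
  - apply/disj_set2P; rewrite -subset0 => x /=; rewrite !in_itv/= andbT => -[x0].
    by rewrite leNgt x0.
  - by move=> x _; rewrite mule_ge0 ?lee_fin ?normal_pdf_ge0// le_max lexx orbT.
  - exact: measurable_funTS (mprod _ mm1).
  rewrite [X in (X + _)%E]integral0_eq ?add0e//.
  move=> x /=; rewrite in_itv/= => x0.
  by rewrite max_r ?mul0e// ltW.
rewrite /Rintegral integralE.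
have -> : (EFin^\- = (fun x : R => (Num.max (- x) 0)%:E))%E.
  by apply/funext => x; rewrite funenegE -EFinN -EFin_max.
have -> : (EFin^\+ = (fun x : R => (Num.max x 0)%:E))%E.
  by apply/funext => x; rewrite funeposE -EFin_max.
rewrite neg subee//.
rewrite ge0_fin_numE; last first.
  by apply: integral_ge0 => x _; rewrite lee_fin le_max lexx orbT.
have : igr N (fun x => Num.max x 0).
  have /sqi_igr/integrable_funepos := normal_prob_sqi => /(_ measurableT).
  apply: eq_integrable => // x _.
  by rewrite funeposE/= -EFin_max.
move=> /(integrable_fin_num measurableT).
by rewrite fin_numElt => /andP[].
Qed.

End gaussian.

(** * The Euclidean norm *)

Section enorm_theory.
Context {R : realType}.

Lemma inner_ge0 m n (A : 'M[R]_(m, n)) : 0 <= inner A A.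
Proof. by apply: sumr_ge0 => i _; apply: sumr_ge0 => j _; rewrite -expr2 sqr_ge0. Qed.

Lemma enorm_ge0 m n (A : 'M[R]_(m, n)) : 0 <= enorm A.
Proof. exact: sqrtr_ge0. Qed.

Lemma enorm_sqr m n (A : 'M[R]_(m, n)) : enorm A ^+ 2 = inner A A.
Proof. by rewrite sqr_sqrtr// inner_ge0. Qed.

Lemma enorm_rowE n (z : 'rV[R]_n) : enorm z ^+ 2 = \sum_j z 0 j ^+ 2.
Proof.
by rewrite enorm_sqr /inner big_ord1; apply: eq_bigr => j _; rewrite expr2.
Qed.

Lemma enorm_colE n (z : 'cV[R]_n) : enorm z ^+ 2 = \sum_j z j 0 ^+ 2.
Proof.
by rewrite enorm_sqr /inner; apply: eq_bigr => j _; rewrite big_ord1 expr2.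
Qed.

Lemma coord_le_enorm m n (A : 'M[R]_(m, n)) i j : `|A i j| <= enorm A.
Proof.
rewrite -sqrtr_sqr ler_wsqrtr// /inner (bigD1 i)//= (bigD1 j)//= -expr2.
rewrite -addrA lerDl addr_ge0//.
  by apply: sumr_ge0 => k _; rewrite -expr2 sqr_ge0.
by apply: sumr_ge0 => k _; apply: sumr_ge0 => l _; rewrite -expr2 sqr_ge0.
Qed.

Lemma mx_norm_le_enorm m n (A : 'M[R]_(m, n)) : `|A| <= enorm A.
Proof.
rewrite [`|A|]mx_normrE; apply/bigmax_leP; split; first exact: enorm_ge0.
by move=> ij _; exact: coord_le_enorm.
Qed.

Lemma coord_le_mx_norm m n (A : 'M[R]_(m, n)) i j : `|A i j| <= `|A|.
Proof.
rewrite [`|A|]mx_normrE; apply/bigmax_geP; right => /=.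
by exists (i, j).
Qed.

Lemma enorm_le_mx_norm m n (A : 'M[R]_(m, n)) : enorm A <= (m * n)%:R * `|A|.
Proof.
have [->|A0] := eqVneq A 0.
  have -> : enorm (0 : 'M[R]_(m, n)) = 0.
    rewrite /enorm /inner; apply/eqP; rewrite sqrtr_eq0 big1// => i _.
    by rewrite big1// => j _; rewrite mxE mul0r.
  by rewrite mulr_ge0.
rewrite -(@ler_pXn2r _ 2)// ?nnegrE ?enorm_ge0 ?mulr_ge0//.
rewrite enorm_sqr /inner.
apply: (@le_trans _ _ (\sum_(i < m) \sum_(j < n) `|A| ^+ 2)).
  apply: ler_sum => i _; apply: ler_sum => j _.
  by rewrite -expr2 -real_normK ?num_real// lerXn2r ?nnegrE// coord_le_mx_norm.
rewrite !sumr_const !card_ord -mulrnA exprMn -[leLHS]mulr_natl (mulnC n).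
apply: ler_wpM2r; first exact: sqr_ge0.
rewrite expr2 ler_peMl//.
by move: A0; case: m A => [|m] A; [rewrite flatmx0 eqxx|];
  case: n A => [|n] A; rewrite ?thinmx0 ?eqxx// ler1n.
Qed.

Lemma inner_le m n (A B : 'M[R]_(m, n)) : inner A B <= (inner A A + inner B B) / 2.
Proof.
rewrite ler_pdivlMr// mulr_suml /inner -!big_split/=; apply: ler_sum => i _.
rewrite mulr_suml -!big_split/=; apply: ler_sum => j _.
by have := sqr_ge0 (A i j - B i j); nra.
Qed.

Lemma innerDl m n (A B C : 'M[R]_(m, n)) : inner (A + B) C = inner A C + inner B C.
Proof.
rewrite /inner -!big_split/=; apply: eq_bigr => i _.
by rewrite -!big_split/=; apply: eq_bigr => j _; rewrite mxE mulrDl.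
Qed.

Lemma innerC m n (A B : 'M[R]_(m, n)) : inner A B = inner B A.
Proof.
by rewrite /inner; apply: eq_bigr => i _; apply: eq_bigr => j _; rewrite mulrC.
Qed.

Lemma innerZl m n a (A B : 'M[R]_(m, n)) : inner (a *: A) B = a * inner A B.
Proof.
rewrite /inner mulr_sumr; apply: eq_bigr => i _; rewrite mulr_sumr.
by apply: eq_bigr => j _; rewrite mxE mulrA.
Qed.

Lemma enormN m n (A : 'M[R]_(m, n)) : enorm (- A) = enorm A.
Proof. by rewrite /enorm -scaleN1r innerZl innerC innerZl mulrA mulrNN mulr1 mul1r. Qed.

Lemma enormZ m n a (A : 'M[R]_(m, n)) : enorm (a *: A) = `|a| * enorm A.
Proof.
by rewrite /enorm innerZl innerC innerZl mulrA -expr2 sqrtrM ?sqr_ge0// sqrtr_sqr.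
Qed.

Lemma inner_row n (z u : 'rV[R]_n) : inner z u = \sum_j z 0 j * u 0 j.
Proof. by rewrite /inner big_ord1. Qed.

(** Young's inequality with a free parameter: taking [e] small afterwards turns convergence in [L^2]
    into convergence of second moments. *)
Lemma enorm_sqrD_le m n (A B : 'M[R]_(m, n)) (e : R) : 0 < e ->
  enorm (A + B) ^+ 2 <= (1 + e) * enorm A ^+ 2 + (1 + e^-1) * enorm B ^+ 2.
Proof.
move=> e0; rewrite !enorm_sqr innerDl ![inner _ (A + B)]innerC !innerDl.
rewrite (innerC B A).
have := inner_le (e *: A) B; rewrite innerZl [inner (e *: A) (e *: A)]innerZl.
rewrite (innerC A (e *: A)) innerZl => h.
have : 2 * inner A B <= e * inner A A + e^-1 * inner B B.
  have : e * (2 * inner A B) <= e * (e * inner A A + e^-1 * inner B B).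
    by rewrite mulrDr (mulrA e e^-1) divff ?gt_eqF// mul1r; nra.
  by rewrite ler_pM2l.
lra.
Qed.

Lemma enorm_sqrD_le2 m n (A B : 'M[R]_(m, n)) :
  enorm (A + B) ^+ 2 <= 2 * enorm A ^+ 2 + 2 * enorm B ^+ 2.
Proof. by have := enorm_sqrD_le A B ltr01; rewrite invr1. Qed.

End enorm_theory.

(** * Brownian increments and the filtration *)

Section brownian_increments.
Context {R : realType} {d : nat} {disp : measure_display}
  {Omega : measurableType disp} (P : probability Omega R).
Variable W : R -> Omega -> 'cV[R]_d.
Hypothesis hP : measure_is_complete P.
Hypothesis hW : brownian P W.

Definition filtration_gen (t : R) : set (set Omega) :=
  [set A | exists (s : R) (U : set 'cV[R]_d),
         [/\ 0 <= s <= t, open U & A = W s @^-1` U]] `|` P.-negligible.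

(** Measurability for the filtration at time [t], phrased through the type that carries the
    generated sigma-algebra, so that the closure properties of [measurable_fun] apply. *)
Definition measF (t : R) (h : Omega -> R) : Prop :=
  measurable_fun (setT : set (g_sigma_algebraType (filtration_gen t))) h.

(** The filtration contains all negligible sets; they are measurable because [P] is complete. *)
Lemma natural_filtration_measurable t A :
  natural_filtration P W t A -> measurable A.
Proof.
apply: smallest_sub; first exact: sigma_algebra_measurable.
have [mW _ _ _ _] := hW.
move=> B [[s [U [/andP[s0 _] oU ->]]]|]; first exact: mW.
exact: hP.
Qed.

Lemma natural_filtrationS s t : s <= t ->
  natural_filtration P W s `<=` natural_filtration P W t.
Proof.
move=> st; apply: sub_smallest2r => // A [[u [U [/andP[u0 us] oU ->]]]|]; last by right.
by left; exists u, U; rewrite u0 (le_trans us).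
Qed.

Lemma measF_measurable t h : measF t h -> measurable_fun setT h.
Proof.
move=> mh _ B mB; rewrite setTI; apply: (@natural_filtration_measurable t).
by have := mh measurableT B mB; rewrite setTI.
Qed.

Lemma measFS s t h : s <= t -> measF s h -> measF t h.
Proof.
move=> st mh _ B mB; apply: (natural_filtrationS st).
exact: mh.
Qed.

Lemma measF_open t h :
  (forall U : set R, open U -> natural_filtration P W t (h @^-1` U)) -> measF t h.
Proof.
move=> hU; apply: (measurability (@RGenOpens.G R)).
  exact: RGenOpens.measurableE.
move=> _ [U [a [b ->]] <-]; rewrite setTI; apply: hU.
exact: interval_open.
Qed.

Lemma natural_filtration_preimage t h B : measF t h -> measurable B ->
  natural_filtration P W t (h @^-1` B).
Proof. by move=> mh mB; have := mh measurableT B mB; rewrite setTI. Qed.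

Lemma measF_indic t A : natural_filtration P W t A -> measF t (\1_A : Omega -> R).
Proof. by move=> FA; exact: measurable_indic. Qed.

Lemma measF_coef t (c : Omega -> 'rV[R]_d) i :
  measurable_wrt (natural_filtration P W t) c -> measF t (fun w => c w 0 i).
Proof.
move=> mc; apply: measF_open => U oU.
apply: (mc [set z : 'rV[R]_d | U (z 0 i)]).
by apply: (open_comp _ oU) => z _; exact: coord_continuous.
Qed.

Definition bm_incr (a b : R) (i : 'I_d) (w : Omega) : R := W b w i 0 - W a w i 0.

Lemma measF_bm t i : 0 <= t -> measF t (fun w => W t w i 0).
Proof.
move=> t0; apply: measF_open => U oU; apply: sub_sigma_algebra; left.
exists t, [set z : 'cV[R]_d | U (z i 0)]; rewrite lexx t0; split => //.
by apply: (open_comp _ oU) => z _; exact: coord_continuous.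
Qed.

Lemma measF_bm_incr t a b i : 0 <= a -> 0 <= b -> a <= t -> b <= t ->
  measF t (bm_incr a b i).
Proof.
move=> a0 b0 at_ bt; apply: measurable_funB.
  exact: measFS bt (measF_bm _ _).
exact: measFS at_ (measF_bm _ _).
Qed.

Lemma continuous_borel (h : 'cV[R]_d -> R) : continuous h ->
  measurable_fun (setT : set (g_sigma_algebraType (@open 'cV[R]_d))) h.
Proof.
move=> ch; apply: (measurability (@RGenOpens.G R)).
  exact: RGenOpens.measurableE.
move=> _ [U [a [b ->]] <-]; rewrite setTI; apply: sub_sigma_algebra.
apply: open_comp; first by move=> z _; exact: ch.
exact: interval_open.
Qed.

Section increment.
Variables a b : R.
Hypothesis ab : 0 <= a < b.

Let a0 : 0 <= a. Proof. by case/andP: ab. Qed.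
Let altb : a < b. Proof. by case/andP: ab. Qed.
Let b0 : 0 <= b. Proof. exact: le_trans a0 (ltW altb). Qed.
Let sd := Num.sqrt (b - a).
Let sd0 : 0 < sd. Proof. by rewrite sqrtr_gt0 subr_gt0. Qed.

Lemma bm_incr_measurable i : measurable_fun setT (bm_incr a b i).
Proof. by apply: (@measF_measurable b); apply: measF_bm_incr => //; exact: ltW. Qed.

Lemma bm_incr_law2 i j B C : i != j -> measurable B -> measurable C ->
  P (bm_incr a b i @^-1` B `&` bm_incr a b j @^-1` C) =
  (normal_prob 0 sd B * normal_prob 0 sd C)%E.
Proof.
move=> ij mB mC; have [_ _ _ law _] := hW.
(* The law of an increment is given on boxes: the box has sides [B] and [C] in directions [i] and
   [j] and the whole line elsewhere, so the product collapses to two factors. *)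
pose BB k : set R := if k == i then B else if k == j then C else setT.
have -> : bm_incr a b i @^-1` B `&` bm_incr a b j @^-1` C =
    [set w | forall i, BB i (W b w i 0 - W a w i 0)].
  apply/seteqP; split => [w [Bw Cw] k|w h].
    by rewrite /BB; case: eqP => [->//|_]; case: eqP => [->|].
  split; first by have := h i; rewrite /BB eqxx.
  by have := h j; rewrite /BB eqxx eq_sym (negbTE ij).
rewrite law//; last by move=> k; rewrite /BB; case: ifP => // _; case: ifP.
rewrite (bigD1 i)//= (bigD1 j)//= ?(eq_sym j)// big1 ?mule1; last first.
  move=> k /andP[ki kj]; rewrite /BB (negbTE ki) (negbTE kj).
  exact: probability_setT.
by rewrite /BB !eqxx eq_sym (negbTE ij).
Qed.

Lemma bm_incr_law i B : measurable B ->
  P (bm_incr a b i @^-1` B) = normal_prob 0 sd B.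
Proof.
move=> mB; have [_ _ _ law _] := hW.
pose BB k : set R := if k == i then B else setT.
have -> : bm_incr a b i @^-1` B =
    [set w | forall i, BB i (W b w i 0 - W a w i 0)].
  apply/seteqP; split => [w Bw k|w h].
    by rewrite /BB; case: eqP => [->//|_].
  by have := h i; rewrite /BB eqxx.
rewrite law//; last by move=> k; rewrite /BB; case: ifP => // _.
rewrite (bigD1 i)//= big1 ?mule1; last first.
  by move=> k ki; rewrite /BB (negbTE ki); exact: probability_setT.
by rewrite /BB !eqxx.
Qed.

Lemma Exp_bm_incr_comp i (f : R -> R) : measurable_fun setT f ->
  igr (normal_prob 0 sd) f ->
  igr P (fun w => f (bm_incr a b i w)) /\
  Exp P (fun w => f (bm_incr a b i w)) = Exp (normal_prob 0 sd) f.
Proof.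
move=> mf hf.
have mD : measurable_fun setT (bm_incr a b i : Omega -> measurableTypeR R).
  by move=> ? B mB; exact: bm_incr_measurable.
pose D : {mfun Omega >-> measurableTypeR R} := HB.pack (bm_incr a b i)
  (isMeasurableFun.Build _ _ _ _ _ mD).
have E A : measurable A -> distribution P D A = normal_prob 0 sd A.
  exact: bm_incr_law.
have mfE : measurable_fun setT (fun y : measurableTypeR R => (f y)%:E) by exact/measurable_EFinP.
have ig : igr P (fun w => f (bm_incr a b i w)).
  apply/integrableP; split.
    by apply: (measurableT_comp mfE); exact: bm_incr_measurable.
  move/integrableP : hf => [_].
  have -> : (\int[normal_prob 0 sd]_x `|(f x)%:E| =
             \int[distribution P D]_x `|(f x)%:E|)%E.
    by apply: eq_measure_integral => A mA _; exact/esym/E.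
  by rewrite (ge0_integral_distribution D)//; exact: measurableT_comp.
split => //; rewrite /Rintegral.
have -> : (\int[normal_prob 0 sd]_x (f x)%:E = \int[distribution P D]_x (f x)%:E)%E.
  by apply: eq_measure_integral => A mA _; exact/esym/E.
by rewrite (integral_distribution (X := D)).
Qed.

Let mid : measurable_fun setT (fun x : R => x).
Proof. exact: measurable_id. Qed.

Let msqr : measurable_fun setT (fun x : R => x ^+ 2).
Proof. exact: measurable_funX. Qed.

Lemma sqi_bm_incr i : sqi P (bm_incr a b i).
Proof.
split; first exact: bm_incr_measurable.
have [_ h2] := normal_prob_sqi sd0.
by have [] := Exp_bm_incr_comp i msqr h2.
Qed.

Lemma Exp_bm_incr i : Exp P (bm_incr a b i) = 0.
Proof.
have h1 := sqi_igr (normal_prob_sqi sd0).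
by have [_ ->] := Exp_bm_incr_comp i mid h1; exact: normal_prob_mean.
Qed.

Lemma Exp_bm_incr_sqr i : Exp P (fun w => bm_incr a b i w ^+ 2) = b - a.
Proof.
have [_ h2] := normal_prob_sqi sd0.
have [_ ->] := Exp_bm_incr_comp i msqr h2.
by rewrite normal_prob_variance// sqr_sqrtr// subr_ge0 ltW.
Qed.

Lemma Exp_bm_incrM i j :
  Exp P (fun w => bm_incr a b i w * bm_incr a b j w) = (i == j)%:R * (b - a).
Proof.
have [<-|ij] := eqVneq i j.
  by rewrite mul1r -(Exp_bm_incr_sqr i); apply: eq_Rintegral => w _; rewrite expr2.
rewrite (indep_ExpM (sqi_igr (sqi_bm_incr i)) (sqi_igr (sqi_bm_incr j)) _).2.
  by rewrite !Exp_bm_incr !mul0r.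
by move=> A B mA mB; rewrite bm_incr_law2// !bm_incr_law.
Qed.

(** Independence of the increment from the past, for a function [f] of the
    increment. *)
Lemma bm_incr_indep xi (f : 'cV[R]_d -> R) :
  measF a xi -> igr P xi -> continuous f -> 
  igr P (fun w => f (W b w - W a w)) ->
  igr P (fun w => xi w * f (W b w - W a w)) /\
  Exp P (fun w => xi w * f (W b w - W a w)) =
    Exp P xi * Exp P (fun w => f (W b w - W a w)).
Proof.
move=> mxi hxi cf hf; apply: indep_ExpM => // A B mA mB.
have [_ _ _ _ ind] := hW.
apply: (ind _ _ ab (xi @^-1` A) (f @^-1` B)).
  exact: natural_filtration_preimage.
by have := continuous_borel cf measurableT mB; rewrite setTI.
Qed.

End increment.
End brownian_increments.

(** * The Ito isometry for simple integrands *)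

Section simple_isometry.
Context {R : realType} {d : nat} {disp : measure_display}
  {Omega : measurableType disp} (P : probability Omega R).
Variable W : R -> Omega -> 'cV[R]_d.
Hypothesis hP : measure_is_complete P.
Hypothesis hW : brownian P W.
Implicit Types (c : Omega -> 'rV[R]_d) (a b : R).

Notation D := (bm_incr W).

Lemma bm_incr_xx a i : D a a i = fun=> 0.
Proof. by apply/funext => w; rewrite /bm_incr subrr. Qed.

Lemma igr_mul_bm_incr a b xi i : 0 <= a <= b -> measF P W a xi -> igr P xi ->
  igr P (fun w => xi w * D a b i w) /\ Exp P (fun w => xi w * D a b i w) = 0.
Proof.
move=> /andP[a0]; rewrite le_eqVlt => /predU1P[->|ab] mxi hxi.
  rewrite bm_incr_xx; under eq_fun do rewrite mulr0.
  by split; [exact: igr_cst|rewrite Exp0].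
have ab' : 0 <= a < b by rewrite a0.
have hD := sqi_igr (sqi_bm_incr hP hW ab' i).
have cf : continuous (fun z : 'cV[R]_d => z i 0) by exact: coord_continuous.
have E : (fun w => (W b w - W a w) i 0) = D a b i.
  by apply/funext => w; rewrite !mxE.
have [] := bm_incr_indep hW ab' mxi hxi cf.
  by rewrite E.
rewrite E (Exp_bm_incr hP hW ab') mulr0.
have -> : (fun w => xi w * (W b w - W a w) i 0) = (fun w => xi w * D a b i w).
  by apply/funext => w; rewrite !mxE.
by [].
Qed.

Lemma igr_mul_bm_incr2 a b xi i j : 0 <= a <= b -> measF P W a xi -> igr P xi ->
  igr P (fun w => xi w * (D a b i w * D a b j w)) /\
  Exp P (fun w => xi w * (D a b i w * D a b j w)) = (i == j)%:R * (b - a) * Exp P xi.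
Proof.
move=> /andP[a0]; rewrite le_eqVlt => /predU1P[->|ab] mxi hxi.
  rewrite !bm_incr_xx; under eq_fun do rewrite !mulr0.
  by split; [exact: igr_cst|rewrite Exp0 subrr mulr0 mul0r].
have ab' : 0 <= a < b by rewrite a0.
have hD := sqiM_igr (sqi_bm_incr hP hW ab' i) (sqi_bm_incr hP hW ab' j).
have cf : continuous (fun z : 'cV[R]_d => z i 0 * z j 0).
  by move=> z; apply: (@continuousM _ _ (fun z : 'cV[R]_d => z i 0) (fun z => z j 0));
      exact: coord_continuous.
have E : (fun w => (W b w - W a w) i 0 * (W b w - W a w) j 0) =
    (fun w => D a b i w * D a b j w).
  by apply/funext => w; rewrite !mxE.
have [] := bm_incr_indep hW ab' mxi hxi cf.
  by rewrite E.
rewrite E (Exp_bm_incrM hP hW ab') mulrC.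
have -> : (fun w => xi w * ((W b w - W a w) i 0 * (W b w - W a w) j 0)) =
    (fun w => xi w * (D a b i w * D a b j w)).
  by apply/funext => w; rewrite !mxE.
by [].
Qed.

Lemma sqi_bm_incr_le a b i : 0 <= a <= b -> sqi P (D a b i).
Proof.
move=> /andP[a0]; rewrite le_eqVlt => /predU1P[->|ab].
  by rewrite bm_incr_xx; exact: sqi0.
by apply: (sqi_bm_incr hP hW); rewrite a0.
Qed.

Definition step_int c a b (w : Omega) : R := \sum_i c w 0 i * D a b i w.

Definition dot c c' (w : Omega) : R := \sum_i c w 0 i * c' w 0 i.

Definition admissible a c := (forall i, measF P W a (fun w => c w 0 i)) /\
  exists C : R, forall w i, `|c w 0 i| <= C.

Lemma admissibleS a b c : a <= b -> admissible a c -> admissible b c.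
Proof. by move=> ab [mc hc]; split => // i; apply: measFS ab (mc i). Qed.

Lemma step_int_measF c a b t : 0 <= a <= b -> b <= t -> admissible a c ->
  measF P W t (step_int c a b).
Proof.
move=> /andP[a0 ab] bt [mc _]; rewrite /step_int.
apply: measurable_sum => i; apply: measurable_funM.
  exact: measFS (le_trans ab bt) (mc i).
by apply: measF_bm_incr => //; [exact: le_trans ab|exact: le_trans bt].
Qed.

Lemma sqi_step_int c a b : 0 <= a <= b -> admissible a c -> sqi P (step_int c a b).
Proof.
move=> ab [mc [C hC]]; apply: sqi_sum => i.
apply: (sqi_bounded (C := C)) => //; last exact: sqi_bm_incr_le.
exact: (measF_measurable hP hW (mc i)).
Qed.

Lemma admissible_sqi a c i : admissible a c -> sqi P (fun w => c w 0 i).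
Proof.
move=> [mc [C hC]]; have := sqi_bounded (measF_measurable hP hW (mc i)) _ (sqi_cst P 1).
by move=> /(_ C (hC^~ i)); under eq_fun do rewrite mulr1.
Qed.

Lemma admissible_igrM a a' c c' i j : admissible a c -> admissible a' c' ->
  igr P (fun w => c w 0 i * c' w 0 j).
Proof. by move=> hc hc'; exact: sqiM_igr (admissible_sqi _ hc) (admissible_sqi _ hc'). Qed.

Lemma igr_dot a a' c c' : admissible a c -> admissible a' c' -> igr P (dot c c').
Proof. by move=> hc hc'; apply: igr_sum => i; exact: admissible_igrM hc hc'. Qed.

Lemma Exp_step_int c a b : 0 <= a <= b -> admissible a c ->
  Exp P (step_int c a b) = 0.
Proof.
move=> ab hc; have hi i : igr P (fun w => c w 0 i * D a b i w) /\
    Exp P (fun w => c w 0 i * D a b i w) = 0.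
  apply: igr_mul_bm_incr => //; first by case: hc.
  exact: sqi_igr (admissible_sqi _ hc).
rewrite /step_int Exp_sum; last by move=> i; case: (hi i).
by rewrite big1// => i _; case: (hi i).
Qed.

Lemma step_int_split c a m b w :
  step_int c a b w = step_int c a m w + step_int c m b w.
Proof.
rewrite /step_int -big_split/=; apply: eq_bigr => i _.
by rewrite /bm_incr; ring.
Qed.

Lemma step_int_xx c a w : step_int c a a w = 0.
Proof. by rewrite /step_int big1// => i _; rewrite /bm_incr subrr mulr0. Qed.

Lemma step_intM_igr c c' a b a' b' : 0 <= a <= b -> 0 <= a' <= b' ->
  admissible a c -> admissible a' c' ->
  igr P (fun w => step_int c a b w * step_int c' a' b' w).
Proof. by move=> *; apply: sqiM_igr; apply: sqi_step_int. Qed.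

(** The first step integral times the coefficient of the second is known at time [a'], and the
    increment from [a'] to [b'] is centred and independent of it. *)
Lemma Exp_step_int_disjoint c c' a b a' b' : 0 <= a <= b -> b <= a' <= b' ->
  admissible a c -> admissible a' c' ->
  Exp P (fun w => step_int c a b w * step_int c' a' b' w) = 0.
Proof.
move=> /andP[a0 ab] /andP[ba' ab'] hc hc'.
have a'0 : 0 <= a' by rewrite (le_trans a0)// (le_trans ab).
have [mc' [C' hC']] := hc'.
have hj j : igr P (fun w => (step_int c a b w * c' w 0 j) * D a' b' j w) /\
    Exp P (fun w => (step_int c a b w * c' w 0 j) * D a' b' j w) = 0.
  apply: igr_mul_bm_incr; first by rewrite a'0.
    have ab0 : 0 <= a <= b by rewrite a0.
    exact: measurable_funM (step_int_measF ab0 ba' hc) (mc' j).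
  by apply: sqiM_igr; [apply: sqi_step_int; rewrite ?a0|exact: admissible_sqi hc'].
transitivity (Exp P (fun w => \sum_j (step_int c a b w * c' w 0 j) * D a' b' j w)).
  apply: eq_Rintegral => w _; rewrite mulr_sumr; apply: eq_bigr => j _.
  by rewrite mulrA.
rewrite Exp_sum; last by move=> j; case: (hj j).
by rewrite big1// => j _; case: (hj j).
Qed.

(** Products of coefficients are known at time [a], and the increments in two directions have
    covariance [b - a] on the diagonal and 0 off it. *)
Lemma Exp_step_int_same c c' a b : 0 <= a <= b ->
  admissible a c -> admissible a c' ->
  Exp P (fun w => step_int c a b w * step_int c' a b w) =
    (b - a) * Exp P (dot c c').
Proof.
move=> ab hc hc'; have [mc _] := hc; have [mc' _] := hc'.
have h i j : igr P (fun w => (c w 0 i * c' w 0 j) * (D a b i w * D a b j w)) /\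
    Exp P (fun w => (c w 0 i * c' w 0 j) * (D a b i w * D a b j w)) =
    (i == j)%:R * (b - a) * Exp P (fun w => c w 0 i * c' w 0 j).
  apply: igr_mul_bm_incr2 => //; last exact: admissible_igrM hc hc'.
  exact: measurable_funM (mc i) (mc' j).
transitivity (Exp P (fun w => \sum_i \sum_j
    (c w 0 i * c' w 0 j) * (D a b i w * D a b j w))).
  apply: eq_Rintegral => w _; rewrite mulr_suml; apply: eq_bigr => i _.
  rewrite mulr_sumr; apply: eq_bigr => j _; ring.
rewrite Exp_sum; last by move=> i; apply: igr_sum => j; case: (h i j).
rewrite /dot Exp_sum; last by move=> i; exact: admissible_igrM hc hc'.
rewrite mulr_sumr; apply: eq_bigr => i _.
rewrite Exp_sum; last by move=> j; case: (h i j).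
rewrite (bigD1 i)//= (h i i).2 eqxx mul1r big1 ?addr0// => j ji.
by rewrite (h i j).2 eq_sym (negbTE ji) !mul0r.
Qed.

(** Length of the intersection of the two intervals. The steps of a simple process may overlap, so
    the orthogonality relation is needed for intervals in any position. *)
Definition overlap a b a' b' : R := Num.max 0 (Num.min b b' - Num.max a a').

Lemma overlapC a b a' b' : overlap a b a' b' = overlap a' b' a b.
Proof. by rewrite /overlap (minC b) (maxC a). Qed.

(** With the left endpoints ordered, the intervals are cut at [a'] and at the smaller right
    endpoint. Disjoint pieces are orthogonal, and only the product over the common piece
    survives. *)
Lemma Exp_step_intM c c' a b a' b' : 0 <= a <= b -> 0 <= a' <= b' ->
  admissible a c -> admissible a' c' ->
  Exp P (fun w => step_int c a b w * step_int c' a' b' w) =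
    overlap a b a' b' * Exp P (dot c c').
Proof.
wlog aa' : a b a' b' c c' / a <= a'.
  move=> wl ab ab' hc hc'; have [aa'|/ltW aa'] := leP a a'; first exact: wl.
  rewrite overlapC; under eq_Rintegral do rewrite mulrC.
  rewrite wl//; congr (_ * _); apply: eq_Rintegral => w _.
  by apply: eq_bigr => i _; rewrite mulrC.
move=> /andP[a0 ab] /andP[a'0 ab'] hc hc'.
rewrite /overlap (max_r aa').
have [ba'|/ltW a'b] := leP b a'.
  rewrite Exp_step_int_disjoint ?a0 ?ba'//.
  by rewrite max_l ?mul0r// subr_le0 ge_min ba'.
have hcS : admissible a' c by exact: admissibleS hc.
transitivity (Exp P (fun w => step_int c a' b w * step_int c' a' b' w)).
  transitivity (Exp P (fun w => step_int c a a' w * step_int c' a' b' w +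
      step_int c a' b w * step_int c' a' b' w)).
    by apply: eq_Rintegral => w _; rewrite -mulrDl -step_int_split.
  rewrite ExpD; [|by apply: step_intM_igr; rewrite ?a0 ?a'0|
                  by apply: step_intM_igr; rewrite ?a0 ?a'0].
  by rewrite Exp_step_int_disjoint ?a0 ?lexx ?add0r.
rewrite max_r; last by rewrite subr_ge0 le_min a'b.
have [bb'|/ltW bb'] := leP b b'.
- transitivity (Exp P (fun w => step_int c a' b w * step_int c' a' b w +
      step_int c a' b w * step_int c' b b' w)).
    by apply: eq_Rintegral => w _; rewrite -mulrDr -step_int_split.
  have hb : admissible b c' by exact: admissibleS hc'.
  have b0 : 0 <= b by exact: le_trans ab.
  rewrite ExpD; [|by apply: step_intM_igr; rewrite ?a0 ?a'0|
                  by apply: step_intM_igr; rewrite ?a0 ?a'0 ?b0].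
  rewrite [X in _ + X]Exp_step_int_disjoint ?a'0 ?lexx ?addr0//.
  by rewrite Exp_step_int_same ?a'0.
- transitivity (Exp P (fun w => step_int c a' b' w * step_int c' a' b' w +
      step_int c' a' b' w * step_int c b' b w)).
    by apply: eq_Rintegral => w _; rewrite [X in _ + X]mulrC -mulrDl -step_int_split.
  have hb : admissible b' c by exact: admissibleS hcS.
  have b0 : 0 <= b' by exact: le_trans ab'.
  rewrite ExpD; [|by apply: step_intM_igr; rewrite ?a0 ?a'0|
                  by apply: step_intM_igr; rewrite ?a0 ?a'0 ?b0].
  rewrite [X in _ + X]Exp_step_int_disjoint ?a'0 ?lexx ?addr0//.
  by rewrite Exp_step_int_same ?a'0.
Qed.

End simple_isometry.

Section product_with_time.
Context {R : realType} {disp : measure_display} {Omega : measurableType disp}.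
Variable P : probability Omega R.
Notation leb := (@lebesgue_measure R).

Definition PT : {measure set (Omega * measurableTypeR R) -> \bar R} := (P \x leb)%E.

Lemma Exp_PT_indic (h : Omega -> R) (a b : R) : igr P h ->
  igr PT (fun p => h p.1 * \1_(`]a, b]) p.2) /\
  Exp PT (fun p => h p.1 * \1_(`]a, b]) p.2) = Num.max 0 (b - a) * Exp P h.
Proof.
move=> hh; have mh := igr_measurable hh.
have m1 : measurable_fun setT (fun p : Omega * measurableTypeR R => \1_(`]a, b]) p.2 : R).
  by apply: (measurableT_comp (measurable_indic _) measurable_snd).
have mm : measurable_fun setT
    (fun p : Omega * measurableTypeR R => (h p.1 * \1_(`]a, b]) p.2)%:E).
  apply/measurable_EFinP; apply: measurable_funM => //.
  exact: (measurableT_comp mh measurable_fst).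
have leb_itv : (\int[leb]_s (\1_(`]a, b]) s)%:E = (Num.max 0 (b - a))%:E)%E.
  rewrite integral_indic//= setIT lebesgue_measure_itv/= lte_fin.
  have [ab|ba] := ltP a b; first by rewrite max_r ?subr_ge0 ?ltW// EFinN EFinB.
  by rewrite max_l// subr_le0.
have I : PT.-integrable setT
    (fun p : Omega * measurableTypeR R => (h p.1 * \1_(`]a, b]) p.2)%:E).
  apply/(integrable12ltyP _ _ mm) => /=.
  have e2 w : (\int[leb]_s `|h w * \1_(`]a, b]) s|%:E =
      `|h w|%:E * (Num.max 0 (b - a))%:E)%E.
    rewrite -leb_itv -ge0_integralZl_EFin//; last exact/measurable_EFinP.
    by apply: eq_integral => s _; rewrite normrM [X in (_ * X)%R]ger0_norm ?EFinM.
  under eq_integral do rewrite e2.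
  rewrite /= ge0_integralZr//; last 2 first.
  - by apply/measurable_EFinP; exact: measurableT_comp.
  - by rewrite lee_fin le_max lexx.
  apply: lte_mul_pinfty => //.
  - by apply: integral_ge0 => x _; rewrite lee_fin.
  - have := hh => /integrableP[_].
    by rewrite ge0_fin_numE//; apply: integral_ge0 => x _; rewrite lee_fin.
  - by rewrite ltry.
split; first exact: I.
rewrite /Rintegral -[X in fine X]integral12_prod_meas1//= /fubini_F/=.
have e1 w : (\int[leb]_s (h w * \1_(`]a, b]) s)%:E = (Num.max 0 (b - a))%:E * (h w)%:E)%E.
  rewrite muleC -leb_itv -integralZl//.
  by apply: integrable_indic_itv.
under eq_integral do rewrite e1.
by rewrite integralZl// -(EFin_Exp hh) -EFinM.
Qed.

End product_with_time.

Section family_isometry.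
Context {R : realType} {d : nat} {disp : measure_display}
  {Omega : measurableType disp} (P : probability Omega R).
Variable W : R -> Omega -> 'cV[R]_d.
Hypothesis hP : measure_is_complete P.
Hypothesis hW : brownian P W.

Variables (I : finType) (a b : I -> R) (c : I -> Omega -> 'rV[R]_d).
Hypothesis ab : forall i, 0 <= a i <= b i.
Hypothesis hc : forall i, admissible P W (a i) (c i).

Definition family_int (w : Omega) : R := \sum_i step_int W (c i) (a i) (b i) w.

Definition family_val (s : R) (w : Omega) : 'rV[R]_d :=
  \sum_i if a i < s <= b i then c i w else 0.

Lemma sqi_family_int : sqi P family_int.
Proof. by apply: sqi_sum => i; exact: sqi_step_int. Qed.

Lemma Exp_family_int : Exp P family_int = 0.
Proof.
rewrite /family_int Exp_sum; last by move=> i; exact/sqi_igr/sqi_step_int.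
by rewrite big1// => i _; exact: Exp_step_int.
Qed.

Lemma family_valE s w j :
  family_val s w 0 j = \sum_i c i w 0 j * \1_(`]a i, b i]) s.
Proof.
rewrite summxE; apply: eq_bigr => i _; rewrite indicE/= mem_setE in_itv/=.
by case: ifP; rewrite ?mulr1 ?mulr0 ?mxE.
Qed.

Lemma sqi_family_val j : sqi (PT P) (fun p => family_val p.2 p.1 0 j).
Proof.
have -> : (fun p : Omega * R => family_val p.2 p.1 0 j) =
    (fun p => \sum_i c i p.1 0 j * \1_(`]a i, b i]) p.2).
  by apply/funext => p; exact: family_valE.
apply: sqi_sum => i; have h := admissible_sqi hP hW j (hc i).
split.
  have [h1 _] := Exp_PT_indic (a i) (b i) (sqi_igr h).
  exact: igr_measurable h1.
have [h1 _] := Exp_PT_indic (a i) (b i) h.2.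
move: h1; congr (integrable _ _ _); apply/funext => p /=; congr EFin.
by rewrite exprMn indicE; case: (_ \in _); rewrite ?expr1n ?expr0n.
Qed.

(** Both sides expand into the same double sum: on the left through [overlap], on the right because
    the product of two interval indicators is the indicator of the intersection, whose length is
    that overlap. *)
Lemma family_isometry : Exp P (fun w => family_int w ^+ 2) =
  Exp (PT P) (fun p => enorm (family_val p.2 p.1) ^+ 2).
Proof.
have hi i k : igr P (dot (c i) (c k)) by exact: igr_dot (hc i) (hc k).
transitivity (\sum_i \sum_k overlap (a i) (b i) (a k) (b k) * Exp P (dot (c i) (c k))).
  transitivity (Exp P (fun w => \sum_i \sum_k
      step_int W (c i) (a i) (b i) w * step_int W (c k) (a k) (b k) w)).
    apply: eq_Rintegral => w _; rewrite expr2 /family_int mulr_suml.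
    by apply: eq_bigr => i _; rewrite mulr_sumr.
  rewrite Exp_sum; last first.
    by move=> i; apply: igr_sum => k; apply: (step_intM_igr hP hW).
  apply: eq_bigr => i _; rewrite Exp_sum; last first.
    by move=> k; apply: (step_intM_igr hP hW).
  by apply: eq_bigr => k _; rewrite (Exp_step_intM hP hW).
pose ma i k := Num.max (a i) (a k); pose mb i k := Num.min (b i) (b k).
transitivity (Exp (PT P) (fun p => \sum_i \sum_k
    dot (c i) (c k) p.1 * \1_(`]ma i k, mb i k]) p.2)).
  rewrite Exp_sum; last first.
    by move=> i; apply: igr_sum => k; case: (Exp_PT_indic (ma i k) (mb i k) (hi i k)).
  apply: eq_bigr => i _; rewrite Exp_sum; last first.
    by move=> k; case: (Exp_PT_indic (ma i k) (mb i k) (hi i k)).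
  apply: eq_bigr => k _.
  by have [_ ->] := Exp_PT_indic (ma i k) (mb i k) (hi i k).
apply: eq_Rintegral => -[w s] _ /=; rewrite enorm_rowE.
have e j : family_val s w 0 j ^+ 2 = \sum_i \sum_k
    c i w 0 j * \1_(`]a i, b i]) s * (c k w 0 j * \1_(`]a k, b k]) s).
  by rewrite family_valE expr2 mulr_suml; apply: eq_bigr => i _; rewrite mulr_sumr.
rewrite (eq_bigr _ (fun j _ => e j)).
rewrite [RHS]exchange_big/=; apply: eq_bigr => i _.
rewrite [RHS]exchange_big/=; apply: eq_bigr => k _.
rewrite mulr_suml; apply: eq_bigr => j _.
rewrite mulrACA; congr (_ * _); rewrite !indicE/= !mem_setE !in_itv/=.
rewrite /ma /mb gt_max le_min andbACA.
by rewrite -mulnb natrM.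
Qed.

End family_isometry.

(** * Limits in mean square *)

Section l2_limits.
Context d (T : measurableType d) (R : realType).
Variable mu : {measure set T -> \bar R}.

(** Convergence to 0 in [L^2(mu)]. Square-integrability of each term is part of it, since an
    infinite integral would otherwise count as 0. *)
Definition l2null (X : nat -> T -> R) :=
  (forall m, sqi mu (X m)) /\ Exp mu (fun x => X m x ^+ 2) @[m --> \oo] --> (0 : R).

Lemma squeeze0 (u v : nat -> R) : (forall m, 0 <= u m <= v m) ->
  v m @[m --> \oo] --> (0 : R) -> u m @[m --> \oo] --> (0 : R).
Proof.
move=> uv v0; apply: (squeeze_cvgr _ (cvg_cst 0) v0).
by apply: nearW => m; exact: uv.
Qed.

Lemma cvg0Ml (c : R) (u : nat -> R) :
  u m @[m --> \oo] --> (0 : R) -> c * u m @[m --> \oo] --> (0 : R).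
Proof. by move=> u0; rewrite -(mulr0 c); apply: cvgMr. Qed.

Lemma l2null_le (C : R) (X Y : nat -> T -> R) : (forall m, measurable_fun setT (Y m)) ->
  (forall m x, `|Y m x| <= C * `|X m x|) -> l2null X -> l2null Y.
Proof.
move=> mY YX [hX X0].
have hY m : sqi mu (Y m).
  apply: sqi_le (sqiZ C (hX m)) _ => // x; apply: (le_trans (YX m x)).
  by rewrite normrM ler_wpM2r// ler_norm.
split => //; apply: (@squeeze0 _ (fun m => C ^+ 2 * Exp mu (fun x => X m x ^+ 2))).
  move=> m; rewrite Exp_ge0 => [|x]; last exact: sqr_ge0.
  rewrite -ExpZ; last by case: (hX m).
  apply: le_Exp; [by case: (hY m)|by apply: igrZ; case: (hX m)|] => x.
  rewrite -(real_normK (num_real (Y m x))) -(real_normK (num_real (X m x))) -exprMn.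
  by rewrite lerXn2r// ?nnegrE// (le_trans _ (YX m x)).
by rewrite -(mulr0 (C ^+ 2)); apply: cvgMr.
Qed.

Lemma l2nullD (X Y : nat -> T -> R) : l2null X -> l2null Y ->
  l2null (fun m x => X m x + Y m x).
Proof.
move=> [hX X0] [hY Y0]; have hXY m := sqiD (hX m) (hY m); split => //.
apply: (@squeeze0 _ (fun m => 2 * Exp mu (fun x => X m x ^+ 2) +
    2 * Exp mu (fun x => Y m x ^+ 2))).
  move=> m; rewrite Exp_ge0 => [|x]; last exact: sqr_ge0.
  have [_ hX2] := hX m; have [_ hY2] := hY m.
  rewrite -!ExpZ// -ExpD; [|exact: igrZ|exact: igrZ].
  apply: le_Exp; [by case: (hXY m)|by apply: igrD; apply: igrZ|] => x /=.
  by have := sqr_ge0 (X m x - Y m x); nra.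
by rewrite -(addr0 0); apply: cvgD; rewrite -(mulr0 2); apply: cvgMr.
Qed.

Lemma l2null_sum (I : Type) (s : seq I) (X : I -> nat -> T -> R) :
  (forall i, l2null (X i)) -> l2null (fun m x => \sum_(i <- s) X i m x).
Proof.
move=> h; elim: s => [|i s ih].
  have -> : (fun m x => \sum_(i <- [::]) X i m x) = (fun _ _ => 0).
    by apply/funext => m; apply/funext => x; rewrite big_nil.
  split; first by move=> m; exact: sqi0.
  by rewrite expr0n /= Exp0; exact: cvg_cst.
have -> : (fun m x => \sum_(j <- i :: s) X j m x) =
   (fun m x => X i m x + \sum_(j <- s) X j m x).
  by apply/funext => m; apply/funext => x; rewrite big_cons.
exact: l2nullD.
Qed.

(** Think of [f m] and [h] as squares and [g m] as the square of the difference. The parameter is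
    fixed first, to make its contribution small, and only then [m] is taken large to kill the factor
    [1 + e^-1]. *)
Lemma Exp_cvg_sandwich (f g : nat -> T -> R) (h : T -> R) :
  (forall m, igr mu (f m)) -> (forall m, igr mu (g m)) -> igr mu h ->
  (forall (e : R) m x, 0 < e -> f m x <= (1 + e) * h x + (1 + e^-1) * g m x) ->
  (forall (e : R) m x, 0 < e -> h x <= (1 + e) * f m x + (1 + e^-1) * g m x) ->
  Exp mu (g m) @[m --> \oo] --> (0 : R) ->
  Exp mu (f m) @[m --> \oo] --> Exp mu h.
Proof.
move=> hf hg hh fh hf' g0.
set H := Exp mu h.
apply/cvgrPdist_le => /= e e0.
(* [K] dominates the limit and, once the upper half of the estimate is known, also [Exp mu (f m)];
   then [t] times either is at most [e / 2]. *)
pose K := `|H| + 1 + e; have K0 : 0 < K by rewrite /K addr_gt0// addr_gt0.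
pose t := e / (2 * K); have t0 : 0 < t by rewrite divr_gt0// mulr_gt0.
have tK : t * K = e / 2 by rewrite /t; field; rewrite gt_eqF.
pose D := 1 + t^-1; have D0 : 0 < D by rewrite addr_gt0// invr_gt0.
have eD : 0 < e / (4 * D) by rewrite divr_gt0// mulr_gt0.
move/cvgrPdist_le : g0 => /(_ _ eD); apply: filterS => m; rewrite sub0r normrN => gm.
have gm' : D * Exp mu (g m) <= e / 4.
  have -> : e / 4 = D * (e / (4 * D)) by field; rewrite gt_eqF.
  by rewrite ler_pM2l//; exact: le_trans (ler_norm _) gm.
have u1 : Exp mu (f m) <= (1 + t) * H + D * Exp mu (g m).
  rewrite -!ExpZ// -ExpD; [|exact: igrZ|exact: igrZ].
  by apply: le_Exp => //; [by apply: igrD; exact: igrZ|move=> x; exact: fh].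
have u2 : H <= (1 + t) * Exp mu (f m) + D * Exp mu (g m).
  rewrite -!ExpZ// -ExpD; [|exact: igrZ|exact: igrZ].
  by apply: le_Exp => //; [by apply: igrD; exact: igrZ|move=> x; exact: hf'].
have tH : t * `|H| <= e / 2.
  by rewrite -tK ler_pM2l// /K -addrA lerDl addr_ge0// ltW.
have nH : H <= `|H| := ler_norm _.
have t' : 0 <= t := ltW t0.
have v1 : Exp mu (f m) - H <= e by nra.
rewrite ler_norml; apply/andP; split; first by lra.
have v2 : t * Exp mu (f m) <= e / 2.
  rewrite -tK ler_pM2l// /K; lra.
nra.
Qed.

End l2_limits.

Lemma Exp_sqr_le d (T : measurableType d) (R : realType) (P : probability T R) X :
  sqi P X -> Exp P X ^+ 2 <= Exp P (fun x => X x ^+ 2).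
Proof.
move=> hX; set m := Exp P X.
have h1 := sqi_igr hX; have [_ h2] := hX.
have : 0 <= Exp P (fun x => (X x - m) ^+ 2) by apply: Exp_ge0 => x; exact: sqr_ge0.
have -> : (fun x => (X x - m) ^+ 2) = (fun x => X x ^+ 2 + ((- 2 * m) * X x + m ^+ 2)).
  by apply/funext => x; ring.
rewrite ExpD//; last by apply: igrD; [exact: igrZ|exact: igr_cst].
rewrite ExpD; [|exact: igrZ|exact: igr_cst].
rewrite ExpZ// Exp_cst -/m; nra.
Qed.

Lemma sqr_sandwich (R : realType) (x y e : R) : 0 < e ->
  x ^+ 2 <= (1 + e) * y ^+ 2 + (1 + e^-1) * (x - y) ^+ 2.
Proof.
move=> e0; have h := sqr_ge0 (e * y - (x - y)); rewrite -subr_ge0.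
have -> : (1 + e) * y ^+ 2 + (1 + e^-1) * (x - y) ^+ 2 - x ^+ 2 =
   e^-1 * (e * y - (x - y)) ^+ 2 by field; rewrite gt_eqF.
by rewrite mulr_ge0// invr_ge0 ltW.
Qed.

(** The squared mean is at most the second moment, so centring survives the limit; second moments
    converge by [Exp_cvg_sandwich]. *)
Lemma l2null_limit d (T : measurableType d) (R : realType) (P : probability T R)
    (X : nat -> T -> R) (Y : T -> R) :
  l2null P (fun m w => X m w - Y w) -> sqi P Y -> (forall m, sqi P (X m)) ->
  (forall m, Exp P (X m) = 0) ->
  Exp P Y = 0 /\
  Exp P (fun w => X m w ^+ 2) @[m --> \oo] --> Exp P (fun w => Y w ^+ 2).
Proof.
move=> X0 hY hX EX; split.
  apply/eqP; rewrite -sqrf_eq0; apply/eqP.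
  have le0 m : Exp P Y ^+ 2 <= Exp P (fun w => (X m w - Y w) ^+ 2).
    apply: le_trans (Exp_sqr_le (X0.1 m)).
    rewrite ExpB; [|exact/sqi_igr/hX|exact/sqi_igr].
    by rewrite [X in _ <= (X - _) ^+ 2]EX sub0r sqrrN.
  apply/le_anti; rewrite sqr_ge0 andbT.
  apply: (ler_cvg_to (cvg_cst _) X0.2).
  by apply: nearW => m; exact: le0.
apply: (Exp_cvg_sandwich (g := fun m w => (X m w - Y w) ^+ 2)).
- by move=> m; case: (hX m).
- by move=> m; case: (X0.1 m).
- by case: hY.
- by move=> e m x e0; exact: sqr_sandwich.
- move=> e m x e0; have -> : (X m x - Y x) ^+ 2 = (Y x - X m x) ^+ 2 by ring.
  exact: sqr_sandwich.
- exact: X0.2.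
Qed.

(** * Sums over a time grid with adapted weights *)

Section grid.
Context {R : realType} {d : nat} {disp : measure_display}
  {Omega : measurableType disp} (P : probability Omega R).
Variable W : R -> Omega -> 'cV[R]_d.
Hypothesis hP : measure_is_complete P.
Hypothesis hW : brownian P W.
Variables (n : nat) (t : nat -> R) (A : nat -> set Omega).
Hypothesis t0 : 0 <= t 0%N.
Hypothesis tn : {homo t : i j / (i <= j)%N >-> i <= j}.
Hypothesis At : forall k, natural_filtration P W (t k) (A k).

(** When [A k] is the event that the [k]-th grid point lies before a grid-valued stopping time, the
    sum telescopes to the increment of [N] up to that time. [grid_weight] is the matching factor on
    the integrand, there the indicator of the time interval. *)
Definition grid_sum (N : R -> Omega -> R) (w : Omega) : R :=
  \sum_(k < n) \1_(A k) w * (N (t k.+1) w - N (t k) w).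

Definition grid_weight (s : R) (w : Omega) : R :=
  \sum_(k < n) \1_(A k) w * \1_(`]t k, t k.+1]) s.

Section simple.
Variable S : seq (@step R d disp Omega).
Hypothesis hS : simple P W S.

Let e0 : @step R d disp Omega := Step 0 0 (fun=> 0).
Let e (i : 'I_(size S)) := nth e0 S i.
Let I := ('I_(size S) * 'I_n)%type.
(** Indices are pairs of a step and a grid cell, and the interval is their intersection. The outer
    maximum in [b] makes it degenerate, and not reversed, when they are disjoint. *)
Let a (i : I) := Num.max (lo (e i.1)) (t i.2).
Let b (i : I) := Num.max (a i) (Num.min (hi (e i.1)) (t i.2.+1)).
Let c (i : I) (w : Omega) := \1_(A i.2) w *: coef (e i.1) w.

Let tk k : 0 <= t k. Proof. exact: le_trans (tn (leq0n k)). Qed.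

Let he (i : 'I_(size S)) : [/\ 0 <= lo (e i), lo (e i) <= hi (e i) &
  admissible P W (lo (e i)) (coef (e i))].
Proof.
have [/andP[h1 h2] h3 [C hC]] := hS (ltn_ord i); split => //.
split; first by move=> j; exact: measF_coef.
by exists C => w j; exact: le_trans (coord_le_enorm _ _ _) (hC w).
Qed.

Let hab i : 0 <= a i <= b i.
Proof. by apply/andP; split; [rewrite /a le_max tk orbT|rewrite /b le_max lexx]. Qed.

Let hc i : admissible P W (a i) (c i).
Proof.
have [_ _ [mc [C hC]]] := he i.1; split.
  move=> j; have -> : (fun w => c i w 0 j) =
     (fun w => \1_(A i.2) w * coef (e i.1) w 0 j).
    by apply/funext => w; rewrite mxE.
  apply: measurable_funM.
    by apply: (measFS (s := t i.2)); [rewrite /a le_max lexx orbT|exact: measF_indic].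
  by apply: (measFS (s := lo (e i.1))); [rewrite /a le_max lexx|exact: mc].
exists C => w j; rewrite mxE normrM indicE; case: (_ \in _).
  by rewrite normr1 mul1r.
by rewrite normr0 mul0r; exact: le_trans (hC w j).
Qed.

Lemma step_int_mulmx (x : Omega -> 'rV[R]_d) u v w :
  (x w *m (W v w - W u w)) 0 0 = step_int W x u v w.
Proof.
rewrite mxE; apply: eq_bigr => j _; by rewrite !mxE.
Qed.

(** The increment over the intersection of a step with a cell equals the increment of the stopped
    step integral over the cell, which is the form that [simple_int] takes. *)
Let increment_clip (f : R -> R) l r u v : l <= r -> u <= v ->
  f (Num.max (Num.max l u) (Num.min r v)) - f (Num.max l u) =
  (f (Num.min r v) - f (Num.min l v)) - (f (Num.min r u) - f (Num.min l u)).
Proof.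
move=> lr uv.
have [lu|/ltW ul] := leP l u.
  rewrite (min_l (le_trans lu uv)).
  have [ru|/ltW ur] := leP r u.
    by rewrite (min_l (le_trans ru uv)) (max_l ru) !subrr.
  rewrite max_r; last by rewrite le_min ur.
  by ring.
have [lv|/ltW vl] := leP l v.
  rewrite (min_r (le_trans ul lr)) max_r; last by rewrite le_min lr.
  by ring.
by rewrite (min_r (le_trans ul lr)) (min_r (le_trans vl lr)) (max_l vl) !subrr.
Qed.

Let gridE w : grid_sum (simple_int W S) w = family_int W a b c w.
Proof.
rewrite /grid_sum /family_int -(pair_bigA _ (fun (i : 'I_(size S)) (k : 'I_n) =>
  step_int W (c (i, k)) (a (i, k)) (b (i, k)) w)) /= exchange_big/=.
apply: eq_bigr => k _.
rewrite /simple_int !(big_nth e0) !big_mkord -sumrB mulr_sumr.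
apply: eq_bigr => i _; rewrite !mxE -sumrB mulr_sumr; apply: eq_bigr => j _.
rewrite !mxE /bm_incr /a /b /= -/(e i).
have [_ lh _] := he i.
rewrite (increment_clip (fun s => W s w j 0) lh (tn (leqnSn k))).
by rewrite -mulrBr -mulrA.
Qed.

Let weightE s w : grid_weight s w *: simple_val S s w = family_val a b c s w.
Proof.
rewrite /grid_weight /family_val -(pair_bigA _ (fun (i : 'I_(size S)) (k : 'I_n) =>
  if a (i, k) < s <= b (i, k) then c (i, k) w else 0)) /= exchange_big/=.
rewrite scaler_suml; apply: eq_bigr => k _.
rewrite /simple_val (big_nth e0) big_mkord scaler_sumr.
apply: eq_bigr => i _; rewrite [X in (_ * X) *: _]indicE mem_setE in_itv /= /a /b /c /= -/(e i).
have -> : (Num.max (lo (e i)) (t k) < s <=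
    Num.max (Num.max (lo (e i)) (t k)) (Num.min (hi (e i)) (t k.+1))) =
    (t k < s <= t k.+1) && (lo (e i) < s <= hi (e i)).
  rewrite gt_max !le_max le_min.
  by apply/idP/idP; case: (ltP (lo (e i)) s); case: (ltP (t k) s); 
     case: (leP s (hi (e i))); case: (leP s (t k.+1)) => //=; lra.
by case: (t k < s <= _) => /=; rewrite ?mulr1 ?mulr0 ?scale0r//; case: ifP; rewrite ?scaler0.
Qed.

Lemma sqi_simple_grid_sum : sqi P (grid_sum (simple_int W S)).
Proof.
have -> : grid_sum (simple_int W S) = family_int W a b c by apply/funext.
exact: sqi_family_int.
Qed.

Lemma Exp_simple_grid_sum : Exp P (grid_sum (simple_int W S)) = 0.
Proof.
have -> : grid_sum (simple_int W S) = family_int W a b c by apply/funext.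
exact: Exp_family_int.
Qed.

Lemma sqi_simple_grid_val j :
  sqi (PT P) (fun p => (grid_weight p.2 p.1 *: simple_val S p.2 p.1) 0 j).
Proof.
have -> : (fun p : Omega * R => (grid_weight p.2 p.1 *: simple_val S p.2 p.1) 0 j) =
   (fun p => family_val a b c p.2 p.1 0 j) by apply/funext => p; rewrite weightE.
exact: (sqi_family_val (P := P) (W := W)).
Qed.

Lemma simple_grid_isometry : Exp P (fun w => grid_sum (simple_int W S) w ^+ 2) =
  Exp (PT P) (fun p => enorm (grid_weight p.2 p.1 *: simple_val S p.2 p.1) ^+ 2).
Proof.
transitivity (Exp P (fun w => family_int W a b c w ^+ 2)).
  by apply: eq_Rintegral => w _; rewrite gridE.
rewrite (family_isometry hP hW hab hc).
by apply: eq_Rintegral => p _; rewrite weightE.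
Qed.

End simple.
End grid.

(** * Pairs of an integrand and its stochastic integral *)

Section ito_pairs.
Context {R : realType} {d : nat} {disp : measure_display}
  {Omega : measurableType disp} (P : probability Omega R).
Variable W : R -> Omega -> 'cV[R]_d.
Hypothesis hP : measure_is_complete P.
Hypothesis hW : brownian P W.
Implicit Types (Z : R -> Omega -> 'rV[R]_d) (N : R -> Omega -> R).

(** What is kept of [N] being the stochastic integral of [Z], with second moments taken against the
    product measure. Time 0 is included in the approximation, where simple integrals vanish, so
    [N 0] is almost surely 0. Path continuity is carried separately. *)
Record ito_pair Z N : Prop := ItoPair {
  ito_measurable : forall t, 0 <= t -> measurable_fun setT (N t) ;
  ito_sqi : forall T j, sqi (PT P) (fun p => \1_(`]0, T]) p.2 * Z p.2 p.1 0 j) ;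
  ito_approx : exists S : nat -> seq (@step R d disp Omega),
    (forall m, simple P W (S m)) /\ forall T, 0 <= T ->
    (Exp (PT P) (fun p => \1_(`]0, T]) p.2 *
        enorm (simple_val (S m) p.2 p.1 - Z p.2 p.1) ^+ 2)
      @[m --> \oo] --> (0 : R)) /\
    l2null P (fun m w => simple_int W (S m) T w - N T w) }.

Lemma igr_enorm_sqr d' (T : measurableType d') (mu : {measure set T -> \bar R})
    (f : T -> 'rV[R]_d) :
  (forall j, sqi mu (fun x => f x 0 j)) -> igr mu (fun x => enorm (f x) ^+ 2).
Proof.
move=> h; under eq_fun do rewrite enorm_rowE.
by apply: igr_sum => j; case: (h j).
Qed.

Lemma sqi_simple_val S T j : 0 <= T -> simple P W S ->
  sqi (PT P) (fun p => \1_(`]0, T]) p.2 * simple_val S p.2 p.1 0 j).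
Proof.
move=> T0 hS; pose t (k : nat) := if k is 0%N then 0 else T.
have At k : natural_filtration P W (t k) setT.
  exact: (@measurableT _ (g_sigma_algebraType (filtration_gen P W _))).
have := sqi_simple_grid_val hP hW 1%N At hS j.
congr (sqi _ _); apply/funext => p.
by rewrite /grid_weight big_ord1 indicT mul1r mxE.
Qed.

Lemma igr_simple_sub S Z T : 0 <= T -> simple P W S ->
  (forall j, sqi (PT P) (fun p => \1_(`]0, T]) p.2 * Z p.2 p.1 0 j)) ->
  igr (PT P) (fun p => \1_(`]0, T]) p.2 *
    enorm (simple_val S p.2 p.1 - Z p.2 p.1) ^+ 2).
Proof.
move=> T0 hS hZ.
have hs j : sqi (PT P) (fun p => \1_(`]0, T]) p.2 *
    (simple_val S p.2 p.1 - Z p.2 p.1) 0 j).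
  under eq_fun do rewrite mxE [X in _ + X]mxE mulrBr.
  by apply: sqiB; [exact: sqi_simple_val|exact: hZ].
under eq_fun do rewrite enorm_rowE mulr_sumr.
apply: igr_sum => j; have [_] := hs j.
congr (integrable _ _ _); apply/funext => p /=; congr EFin.
by rewrite exprMn indicE; case: (_ \in _); rewrite ?expr1n ?expr0n.
Qed.

Section grid_limit.
Variables (n : nat) (t : nat -> R) (A : nat -> set Omega).
Hypothesis t0 : 0 <= t 0%N.
Hypothesis tn : {homo t : i j / (i <= j)%N >-> i <= j}.
Hypothesis At : forall k, natural_filtration P W (t k) (A k).
Variables (Z : R -> Omega -> 'rV[R]_d) (N : R -> Omega -> R).
Hypothesis hZN : ito_pair Z N.

Let tk k : 0 <= t k. Proof. exact: le_trans (tn (leq0n k)). Qed.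

Notation gs := (grid_sum n t A).
Notation gw := (grid_weight n t A).

Lemma grid_weight_bound s w : 0 <= gw s w <= n%:R * \1_(`]0, t n]) s.
Proof.
apply/andP; split; first by apply: sumr_ge0 => k _; rewrite mulr_ge0.
rewrite mulr_natl -[leRHS]/(_ *+ n) -{3}(card_ord n) -sumr_const.
apply: ler_sum => k _; rewrite !indicE !mem_setE !in_itv/=.
case: (_ \in _); rewrite ?mul0r ?mul1r//.
rewrite ler_nat; case: (ltP (t k) s) => //= ks; case: (leP s (t k.+1)) => //= sk.
rewrite (le_lt_trans (tk k) ks)/= (le_trans sk (tn _))//.
Qed.

Lemma grid_weight_indic s w : gw s w * \1_(`]0, t n]) s = gw s w.
Proof.
have := grid_weight_bound s w; rewrite indicE; case: (_ \in _); rewrite ?mulr1//.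
by rewrite !mulr0 => /le_anti.
Qed.

Lemma measurable_grid_weight :
  measurable_fun setT (fun p : Omega * measurableTypeR R => gw p.2 p.1).
Proof.
apply: measurable_sum => k; apply: measurable_funM.
  have mA := natural_filtration_measurable hP hW (@At k).
  have m1 : measurable_fun setT (\1_(A k) : Omega -> R) by exact: measurable_indic.
  exact: (measurableT_comp m1 measurable_fst).
by apply: (measurableT_comp (measurable_indic _) measurable_snd).
Qed.

Lemma sqi_grid_val j : sqi (PT P) (fun p => (gw p.2 p.1 *: Z p.2 p.1) 0 j).
Proof.
have E : (fun p : Omega * R => (gw p.2 p.1 *: Z p.2 p.1) 0 j) =
   (fun p => gw p.2 p.1 * (\1_(`]0, t n]) p.2 * Z p.2 p.1 0 j)).
  by apply/funext => p; rewrite mulrA grid_weight_indic mxE.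
rewrite E; apply: (sqi_bounded (C := n%:R)).
- exact: measurable_grid_weight.
- move=> p; have /andP[h1 h2] := grid_weight_bound p.2 p.1.
  rewrite ger0_norm// (le_trans h2)// indicE; case: (_ \in _); rewrite ?mulr1 ?mulr0//.
- exact: ito_sqi hZN _ j.
Qed.

Let measurable_grid_sum : measurable_fun setT (gs N).
Proof.
apply: measurable_sum => k; apply: measurable_funM.
  exact/measurable_indic/(natural_filtration_measurable hP hW (@At k)).
by apply: measurable_funB; apply: (ito_measurable hZN).
Qed.

(** The isometry holds for the simple approximations and passes to the limit on both sides: the grid
    sum is a finite combination of values of [N] with indicator coefficients, and the weight on the
    integrand is at most [n] and supported in []0, t n]]. *)
Let mainE (S : nat -> seq (@step R d disp Omega)) (hS : forall m, simple P W (S m)) :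
  (forall T, 0 <= T ->
    (Exp (PT P) (fun p => \1_(`]0, T]) p.2 *
        enorm (simple_val (S m) p.2 p.1 - Z p.2 p.1) ^+ 2)
      @[m --> \oo] --> (0 : R)) /\
    l2null P (fun m w => simple_int W (S m) T w - N T w)) ->
  [/\ sqi P (gs N), Exp P (gs N) = 0 & Exp P (fun w => gs N w ^+ 2) =
    Exp (PT P) (fun p => enorm (gw p.2 p.1 *: Z p.2 p.1) ^+ 2)].
Proof.
move=> lim.
pose GS m := gs (simple_int W (S m)).
have hGS m : sqi P (GS m) by exact: sqi_simple_grid_sum.
have X0 : l2null P (fun m w => GS m w - gs N w).
  have -> : (fun m w => GS m w - gs N w) = (fun m w => \sum_(k < n)
    \1_(A k) w * ((simple_int W (S m) (t k.+1) w - N (t k.+1) w) +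
                  - 1 * (simple_int W (S m) (t k) w - N (t k) w))).
    apply/funext => m; apply/funext => w; rewrite /GS /grid_sum -sumrB.
    by apply: eq_bigr => k _; ring.
  apply: l2null_sum => k.
  have L1 := (lim _ (tk k)).2; have L2 := (lim _ (tk k.+1)).2.
  have L3 : l2null P (fun m w => - 1 * (simple_int W (S m) (t k) w - N (t k) w)).
    apply: (l2null_le (C := 1) _ _ L1) => [m|m w]; last by rewrite normrM normrN1.
    by apply: measurable_funM => //; case: (L1.1 m).
  have L := l2nullD L2 L3.
  apply: (l2null_le (C := 1) _ _ L) => [m|m w].
    apply: measurable_funM; last by case: (L.1 m).
    exact/measurable_indic/(natural_filtration_measurable hP hW (@At k)).
  rewrite normrM ler_wpM2r// indicE; case: (_ \in _); rewrite ?normr1 ?normr0//.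
have hN : sqi P (gs N).
  have -> : gs N = (fun w => GS 0%N w - (GS 0%N w - gs N w)).
    by apply/funext => w; ring.
  by apply: sqiB => //; exact: (X0.1 0%N).
have EGS m : Exp P (GS m) = 0 by exact: Exp_simple_grid_sum.
have [EN N2] := l2null_limit X0 hN hGS EGS.
split => //.
pose V m (p : Omega * R) := gw p.2 p.1 *: simple_val (S m) p.2 p.1.
pose V' (p : Omega * R) := gw p.2 p.1 *: Z p.2 p.1.
have hV m j : sqi (PT P) (fun p => V m p 0 j).
  exact: (sqi_simple_grid_val hP hW n At (hS m) j).
have hV' j : sqi (PT P) (fun p => V' p 0 j) by exact: sqi_grid_val.
have hD m j : sqi (PT P) (fun p => (V m p - V' p) 0 j).
  have -> : (fun p => (V m p - V' p) 0 j) = (fun p => V m p 0 j - V' p 0 j).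
    by apply/funext => p; rewrite [LHS]mxE [X in _ + X]mxE.
  by apply: sqiB; [exact: hV|exact: hV'].
have Z2 : Exp (PT P) (fun p => enorm (V m p) ^+ 2) @[m --> \oo] -->
    Exp (PT P) (fun p => enorm (V' p) ^+ 2).
  apply: (Exp_cvg_sandwich (mu := PT P) (f := fun m p => enorm (V m p) ^+ 2)
    (h := fun p => enorm (V' p) ^+ 2) (g := fun m p => enorm (V m p - V' p) ^+ 2)).
  - by move=> m; apply: igr_enorm_sqr.
  - by move=> m; apply: igr_enorm_sqr.
  - exact: igr_enorm_sqr.
  - move=> e m p e0; have := enorm_sqrD_le (V' p) (V m p - V' p) e0.
    by rewrite addrC subrK.
  - move=> e m p e0; have := enorm_sqrD_le (V m p) (V' p - V m p) e0.
    by rewrite addrC subrK -(enormN (V' p - V m p)) opprB.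
  - have [lim0 _] := lim _ (tk n).
    apply: (squeeze0 (v := fun m => n%:R ^+ 2 * Exp (PT P) (fun p => \1_(`]0, t n]) p.2 *
        enorm (simple_val (S m) p.2 p.1 - Z p.2 p.1) ^+ 2))); last first.
      exact: cvg0Ml lim0.
    move=> m; rewrite Exp_ge0 => [|p]; last exact: sqr_ge0.
    have hg := igr_simple_sub (tk n) (hS m) (fun j => ito_sqi hZN (t n) j).
    rewrite -ExpZ//; apply: le_Exp; [exact: igr_enorm_sqr|exact: igrZ|].
    move=> p; rewrite /V /V' -scalerBr enormZ exprMn [leRHS]mulrA.
 apply: ler_wpM2r; first exact: sqr_ge0.
    rewrite real_normK ?num_real//.
    have /andP[h1 h2] := grid_weight_bound p.2 p.1.
    apply: (@le_trans _ _ ((n%:R * \1_(`]0, t n]) p.2) ^+ 2)).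
      by rewrite lerXn2r ?nnegrE// mulr_ge0.
    by rewrite exprMn indicE; case: (_ \in _); rewrite ?expr1n ?expr0n.
have EV m : Exp P (fun w => GS m w ^+ 2) = Exp (PT P) (fun p => enorm (V m p) ^+ 2).
  exact: simple_grid_isometry.
have N2' : Exp P (fun w => GS m w ^+ 2) @[m --> \oo] -->
    Exp (PT P) (fun p => enorm (V' p) ^+ 2).
  by apply: cvg_trans Z2; apply: near_eq_cvg; apply: nearW => m; rewrite EV.
by rewrite -(cvg_lim _ N2)// -(cvg_lim _ N2').
Qed.

Lemma grid_isometry : [/\ sqi P (gs N), Exp P (gs N) = 0 &
  Exp P (fun w => gs N w ^+ 2) =
    Exp (PT P) (fun p => enorm (gw p.2 p.1 *: Z p.2 p.1) ^+ 2)].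
Proof. by have [S [hS lim]] := ito_approx hZN; exact: mainE hS lim. Qed.

End grid_limit.
End ito_pairs.

Section ito_pair_theory.
Context {R : realType} {d : nat} {disp : measure_display}
  {Omega : measurableType disp} (P : probability Omega R).
Variable W : R -> Omega -> 'cV[R]_d.
Hypothesis hP : measure_is_complete P.
Hypothesis hW : brownian P W.
Implicit Types (Z : R -> Omega -> 'rV[R]_d) (N : R -> Omega -> R).

Lemma measurable_wrtZ t a (f : Omega -> 'rV[R]_d) :
  measurable_wrt (natural_filtration P W t) f ->
  measurable_wrt (natural_filtration P W t) (fun w => a *: f w).
Proof.
move=> mf U oU; apply: (mf ((fun z => a *: z) @^-1` U)).
by apply: (open_comp _ oU) => z _; exact: scaler_continuous.
Qed.

Lemma ito_pairD a Z1 Z2 N1 N2 : ito_pair P W Z1 N1 -> ito_pair P W Z2 N2 ->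
  ito_pair P W (fun s w => a *: Z1 s w + Z2 s w) (fun t w => a * N1 t w + N2 t w).
Proof.
move=> h1 h2; split.
- move=> t t0; apply: measurable_funD; last exact: ito_measurable h2 t t0.
  by apply: measurable_funM => //; exact: ito_measurable h1 t t0.
- move=> T j.
  have -> : (fun p : Omega * measurableTypeR R =>
      \1_(`]0, T]) p.2 * (a *: Z1 p.2 p.1 + Z2 p.2 p.1) 0 j) =
    (fun p => a * (\1_(`]0, T]) p.2 * Z1 p.2 p.1 0 j) + \1_(`]0, T]) p.2 * Z2 p.2 p.1 0 j).
    by apply/funext => p; rewrite !mxE; ring.
  by apply: sqiD; [apply: sqiZ; exact: ito_sqi h1 T j|exact: ito_sqi h2 T j].
have [S1 [hS1 lim1]] := ito_approx h1; have [S2 [hS2 lim2]] := ito_approx h2.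
pose sc (e : @step R d disp Omega) := Step (lo e) (hi e) (fun w => a *: coef e w).
(* Simple processes are lists of steps that may overlap, so a linear combination is obtained by
   rescaling coefficients and concatenating. *)
pose S m := map sc (S1 m) ++ S2 m.
have valE m s w : simple_val (S m) s w = a *: simple_val (S1 m) s w + simple_val (S2 m) s w.
  rewrite /simple_val big_cat/= big_map scaler_sumr; congr (_ + _).
  by apply: eq_bigr => e _ /=; case: ifP; rewrite ?scaler0.
have intE m t w : simple_int W (S m) t w = a * simple_int W (S1 m) t w + simple_int W (S2 m) t w.
  rewrite /simple_int big_cat/= big_map mulr_sumr; congr (_ + _).
  by apply: eq_bigr => e _ /=; rewrite -scalemxAl mxE.
have hS m : simple P W (S m).
  move=> k; rewrite size_cat size_map => kS.
  rewrite nth_cat size_map; case: ltnP => km; last first.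
    by apply: hS2; rewrite ltn_subLR.
  rewrite (nth_map (Step 0 0 (fun=> 0)))// /sc/=.
  have [H1 H2 [C HC]] := hS1 m k km; split => //.
    exact: measurable_wrtZ.
  by exists (`|a| * C) => w; rewrite enormZ ler_wpM2l.
exists S; split => // T T0; have [a1 b1] := lim1 T T0; have [a2 b2] := lim2 T T0.
split.
  have I1 m := igr_simple_sub hP hW T0 (hS1 m) (fun j => ito_sqi h1 T j).
  have I2 m := igr_simple_sub hP hW T0 (hS2 m) (fun j => ito_sqi h2 T j).
  have I m : igr (PT P) (fun p => \1_(`]0, T]) p.2 *
      enorm (simple_val (S m) p.2 p.1 - (a *: Z1 p.2 p.1 + Z2 p.2 p.1)) ^+ 2).
    apply: (igr_simple_sub hP hW T0 (hS m) (Z := fun s w => a *: Z1 s w + Z2 s w)) => j.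
    have -> : (fun p : Omega * measurableTypeR R =>
      \1_(`]0, T]) p.2 * (a *: Z1 p.2 p.1 + Z2 p.2 p.1) 0 j) =
      (fun p => a * (\1_(`]0, T]) p.2 * Z1 p.2 p.1 0 j) + \1_(`]0, T]) p.2 * Z2 p.2 p.1 0 j).
      by apply/funext => p; rewrite !mxE; ring.
    by apply: sqiD; [apply: sqiZ; exact: ito_sqi h1 T j|exact: ito_sqi h2 T j].
  apply: (squeeze0 (v := fun m =>
     2 * a ^+ 2 * Exp (PT P) (fun p => \1_(`]0, T]) p.2 *
        enorm (simple_val (S1 m) p.2 p.1 - Z1 p.2 p.1) ^+ 2) +
     2 * Exp (PT P) (fun p => \1_(`]0, T]) p.2 *
        enorm (simple_val (S2 m) p.2 p.1 - Z2 p.2 p.1) ^+ 2))); last first.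
    have := cvgD (cvg0Ml (2 * a ^+ 2) a1) (cvg0Ml 2 a2); rewrite addr0; exact.
  move=> m; rewrite Exp_ge0 => [|p]; last by rewrite mulr_ge0// sqr_ge0.
  rewrite -!ExpZ// -ExpD; [|exact: igrZ|exact: igrZ].
  apply: le_Exp; [exact: I|by apply: igrD; exact: igrZ|] => p /=.
  rewrite valE; set i := \1_ _ _.
  have -> : a *: simple_val (S1 m) p.2 p.1 + simple_val (S2 m) p.2 p.1 -
      (a *: Z1 p.2 p.1 + Z2 p.2 p.1) =
      a *: (simple_val (S1 m) p.2 p.1 - Z1 p.2 p.1) + (simple_val (S2 m) p.2 p.1 - Z2 p.2 p.1).
    by rewrite scalerBr opprD addrACA.
  have i0 : 0 <= i by [].
  apply: le_trans (ler_wpM2l i0 (enorm_sqrD_le2 _ _)) _.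
  rewrite enormZ exprMn real_normK ?num_real//; lra.
have -> : (fun m w => simple_int W (S m) T w - (a * N1 T w + N2 T w)) =
  (fun m w => a * (simple_int W (S1 m) T w - N1 T w) + (simple_int W (S2 m) T w - N2 T w)).
  by apply/funext => m; apply/funext => w; rewrite intE; ring.
apply: l2nullD => //; apply: (l2null_le (C := `|a|) _ _ b1) => [m|m w].
  by apply: measurable_funM => //; case: (b1.1 m).
by rewrite normrM.
Qed.

End ito_pair_theory.

(** * From [ito_integral] to pairs with continuous paths *)

Section ito_integral_pair.
Context {R : realType} {d : nat} {disp : measure_display}
  {Omega : measurableType disp} (P : probability Omega R).
Variable W : R -> Omega -> 'cV[R]_d.
Hypothesis hP : measure_is_complete P.
Hypothesis hW : brownian P W.
Implicit Types (Z : R -> Omega -> 'rV[R]_d) (N : R -> Omega -> R).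
Notation leb := (@lebesgue_measure R).

Lemma integral_PT (f : R -> Omega -> R) T : (forall s w, 0 <= f s w) ->
  measurable_fun setT
    (fun p : Omega * measurableTypeR R => \1_(`]0, T]) p.2 * f p.2 p.1) ->
  (\int[PT P]_p (\1_(`]0%R, T]) p.2 * f p.2 p.1)%:E =
   \int[P]_w \int[leb]_(s in `[0%R, T]) (f s w)%:E)%E.
Proof.
move=> f0 mf.
have mfE : measurable_fun setT
    (fun p : Omega * measurableTypeR R => (\1_(`]0, T]) p.2 * f p.2 p.1)%:E).
  exact/measurable_EFinP.
rewrite /PT fubini_tonelli1//=; last first.
  by move=> p; rewrite lee_fin mulr_ge0.
apply: eq_integral => w _; rewrite /fubini_F/=.
rewrite -integral_itv_obnd_cbnd; last first.
  have m1 : measurable_fun setT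
     (fun s : measurableTypeR R => (\1_(`]0, T]) s * f s w)%:E).
    exact: (measurableT_comp mfE (measurable_pair1 w)).
  apply: (eq_measurable_fun (fun s : measurableTypeR R => (\1_(`]0, T]) s * f s w)%:E)).
    by move=> s sD; rewrite indicE sD mul1r.
  exact: measurable_funTS m1.
rewrite [RHS]integral_mkcond; apply: eq_integral => s _.
by rewrite patchE indicE; case: (_ \in _); rewrite ?mul1r ?mul0r.
Qed.

(** Progressive measurability refers to the sigma-algebra generated by rectangles with one side in
    the filtration; after exchanging the coordinates these are measurable in the product space. *)
Lemma progressive_measurable Z T j : progressive P W Z ->
  measurable_fun setT
    (fun p : Omega * measurableTypeR R => \1_(`]0, T]) p.2 * Z p.2 p.1 0 j).
Proof.
move=> hZ; have [T0|T0] := leP 0 T; last first.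
  have -> : (fun p : Omega * measurableTypeR R => \1_(`]0, T]) p.2 * Z p.2 p.1 0 j) =
      (fun=> 0); last exact: measurable_cst.
  apply/funext => p; rewrite indicE mem_setE in_itv/=.
  case: ltP => //= [p0|]; rewrite ?mul0r//.
  by rewrite leNgt (lt_trans T0 p0) mul0r.
pose D : set (Omega * measurableTypeR R) := setT `*` `]0, T].
have mD : measurable D by apply: measurableX.
have -> : (fun p : Omega * measurableTypeR R => \1_(`]0, T]) p.2 * Z p.2 p.1 0 j) =
   (fun p => Z p.2 p.1 0 j) \_ D.
  apply/funext => p; rewrite patchE indicE; have -> : (p \in D) = (p.2 \in `]0, T]%classic).
    by apply/idP/idP => /set_mem h; apply/mem_set; [case: h|split].
  by case: (_ \in _); rewrite ?mul1r ?mul0r.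
apply/(measurable_restrictT _ mD).
apply: (measurability (@RGenOpens.G R)); first exact: RGenOpens.measurableE.
move=> _ [U [a [b ->]] <-].
set U' : set 'rV[R]_d := [set z | `]a, b[%classic (z 0 j)].
have oU : open U'.
  apply: (open_comp (f := fun z : 'rV[R]_d => z 0 j)).
    by move=> z _; exact: coord_continuous.
  exact: interval_open.
have := hZ T T0 U' oU.
set G := [set D | _]; set E := [set p | _] => hE.
have mE : measurable ((fun p : Omega * measurableTypeR R => (p.2, p.1)) @^-1` E).
  pose C : set (set (R * Omega)) := [set B |
    measurable ((fun p : Omega * measurableTypeR R => (p.2, p.1)) @^-1` B)].
  apply: (@smallest_sub _ (sigma_algebra setT) G C _ _ E hE).
    split; rewrite /C /=.
    - by rewrite preimage_set0; exact: measurable0.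
    - move=> B mB; rewrite setTD preimage_setC; exact: measurableC.
    - move=> F mF; rewrite preimage_bigcup; exact: bigcupT_measurable.
  move=> _ [A [B [mA FB ->]]]; rewrite /C /=.
  have -> : (fun p : Omega * measurableTypeR R => (p.2, p.1)) @^-1` (A `*` B) = B `*` A.
    by apply/seteqP; split => p [].
  by apply: measurableX => //; exact: natural_filtration_measurable FB.
rewrite (_ : _ `&` _ = D `&` ((fun p : Omega * measurableTypeR R => (p.2, p.1)) @^-1` E)).
  exact: measurableI.
apply/seteqP; split => -[w s] /= [[_]]; rewrite /E /= in_itv/= => /andP[s0 sT].
  by move=> UZ; split; [split => //; rewrite /= in_itv/= s0|rewrite (ltW s0) sT].
by move=> [_ UZ]; split => //; split => //; rewrite /= in_itv/= s0.
Qed.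

Lemma integrable_sqi_coord Z T : M2 P W Z ->
  forall j, sqi (PT P) (fun p => \1_(`]0, T]) p.2 * Z p.2 p.1 0 j).
Proof.
move=> [pZ fZ] j.
have mZ k := progressive_measurable T k pZ.
have [T0|T0] := ltP 0 T; last first.
  have -> : (fun p : Omega * measurableTypeR R => \1_(`]0, T]) p.2 * Z p.2 p.1 0 j) =
      (fun=> 0); last exact: sqi0.
  apply/funext => p; rewrite indicE mem_setE in_itv/=.
  case: ltP => //= [p0|]; rewrite ?mul0r//.
  by rewrite leNgt (le_lt_trans T0 p0) mul0r.
have mE : measurable_fun setT
    (fun p : Omega * measurableTypeR R => \1_(`]0, T]) p.2 * enorm (Z p.2 p.1) ^+ 2).
  have -> : (fun p : Omega * measurableTypeR R => \1_(`]0, T]) p.2 * enorm (Z p.2 p.1) ^+ 2) =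
     (fun p => \sum_k (\1_(`]0, T]) p.2 * Z p.2 p.1 0 k) ^+ 2).
    apply/funext => p; rewrite enorm_rowE mulr_sumr; apply: eq_bigr => k _.
    by rewrite exprMn indicE; case: (_ \in _); rewrite ?expr1n ?expr0n.
  by apply: measurable_sum => k; apply: measurable_funX; exact: mZ.
have := fZ T T0; rewrite -integral_PT//; last by move=> *; exact: sqr_ge0.
move=> lty; have hi := igr_ge0P mE _ lty; split; first exact: mZ.
apply: igr_le (hi _) _; first by apply: measurable_funX; exact: mZ.
  by move=> p; rewrite mulr_ge0// sqr_ge0.
move=> p; rewrite ger0_norm ?sqr_ge0// exprMn enorm_rowE (bigD1 j)//= mulrDr.
have -> : (\1_(`]0, T]) p.2 : R) ^+ 2 = \1_(`]0, T]) p.2.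
  by rewrite indicE; case: (_ \in _); rewrite ?expr1n ?expr0n.
by rewrite lerDl mulr_ge0// sumr_ge0// => k _; exact: sqr_ge0.
Qed.

Lemma cvg_fine0 (u : nat -> \bar R) (v : nat -> R) :
  (forall m, u m = (v m)%:E) -> u @ \oo --> 0%E -> v @ \oo --> (0 : R).
Proof.
move=> uv u0; suff -> : v = fine \o u by exact: fine_cvg.
by apply/funext => m /=; rewrite uv.
Qed.

Lemma igr_ae0 (f : Omega -> R) : measurable_fun setT f -> {ae P, forall w, f w = 0} ->
  igr P f /\ Exp P f = 0.
Proof.
move=> mf f0; have mfE : measurable_fun setT (EFin \o f) by exact/measurable_EFinP.
have f0' : ae_eq P setT (EFin \o f) (cst 0%E).
  by apply: filterS f0 => w /= -> _.
have hf : igr P f.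
  apply/integrableP; split => //.
  rewrite (@ge0_ae_eq_integral _ _ _ P setT _ (cst 0%E))//.
  - by rewrite integral0.
  - exact: measurableT_comp.
  - by apply: filterS f0 => w /= -> _; rewrite normr0.
split => //; rewrite /Rintegral (@ae_eq_integral _ _ _ P setT (cst 0%E))//.
by rewrite integral0.
Qed.

(** Fatou's lemma for the squares; the bound on the second moment of the limit also yields its
    square-integrability. *)
Lemma sqi_fatou (X : nat -> Omega -> R) (Y : Omega -> R) c :
  (forall m, sqi P (X m)) -> (forall w, X m w @[m --> \oo] --> Y w) ->
  (forall m, Exp P (fun w => X m w ^+ 2) <= c) ->
  sqi P Y /\ Exp P (fun w => Y w ^+ 2) <= c.
Proof.
move=> hX XY Xc.
have mY : measurable_fun setT Y.
  apply: (measurable_fun_cvg (h := X)) => [m|w _]; first by case: (hX m).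
  exact: XY.
have F := fatou P measurableT (f := fun m w => (X m w ^+ 2)%:E).
have le : (\int[P]_w (Y w ^+ 2)%:E <= c%:E)%E.
  have -> : (\int[P]_w (Y w ^+ 2)%:E =
     \int[P]_w limn_einf (fun m => (X m w ^+ 2)%:E))%E.
    apply: eq_integral => w _; apply/esym; apply: (cvg_limn_einf_sup _).1.
    apply: cvg_EFin; first exact: nearW.
    by rewrite expr2; under eq_fun do rewrite /= expr2; exact: cvgM.
  apply: le_trans (F _ _) _.
  - by move=> m; apply/measurable_EFinP/measurable_funX; case: (hX m).
  - by move=> m w _; rewrite lee_fin sqr_ge0.
  rewrite limn_einf_lim; apply: lime_le; first exact: is_cvg_einfs.
  apply: nearW => m; rewrite /einfs.
  apply: (@le_trans _ _ (\int[P]_w (X m w ^+ 2)%:E)%E).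
    by apply: ereal_inf_lbound; exists m => /=.
  by rewrite -EFin_Exp ?lee_fin//; case: (hX m).
have hY : sqi P Y.
  split => //; apply: igr_ge0P; first exact: measurable_funX.
    by move=> w; exact: sqr_ge0.
  exact: le_lt_trans le (ltry _).
by split => //; rewrite -lee_fin EFin_Exp//; case: hY.
Qed.

End ito_integral_pair.

Lemma Exp_dominated d (T : measurableType d) (R : realType)
    (mu : {measure set T -> \bar R}) (f : nat -> T -> R) (h g : T -> R) :
  (forall m, measurable_fun setT (f m)) -> igr mu g ->
  (forall m x, `|f m x| <= g x) ->
  (forall x, f m x @[m --> \oo] --> h x) ->
  igr mu h /\ Exp mu (f m) @[m --> \oo] --> Exp mu h.
Proof.
move=> mf hg fg fh.
have mh : measurable_fun setT h.
  by apply: (measurable_fun_cvg (h := f)) => // x _; exact: fh.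
have [|||||H1 _ H3] := @dominated_convergence _ _ _ mu setT measurableT
   (fun m x => (f m x)%:E) (fun x => (h x)%:E) (fun x => (g x)%:E).
- by move=> m; exact/measurable_EFinP.
- exact/measurable_EFinP.
- by apply: aeW => x _; apply: cvg_EFin; [exact: nearW|exact: fh].
- exact: hg.
- by apply: aeW => x m _; rewrite lee_fin fg.
split => //; apply: fine_cvg.
by rewrite EFin_Exp.
Qed.

Lemma path_within (R : realType) (T : topologicalType) (f : R -> T) (a : R) :
  {within `[0, +oo[, continuous f} -> 0 <= a ->
  f s @[s --> within `[0, +oo[ (nbhs a)] --> f a.
Proof.
by move=> /subspace_continuousP cf a0; apply: cf; rewrite /= in_itv/= a0.
Qed.

Lemma path_cvg (R : realType) (T : topologicalType) (f : R -> T) (u : nat -> R) (a : R) :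
  {within `[0, +oo[, continuous f} -> 0 <= a -> (forall k, 0 <= u k) ->
  u k @[k --> \oo] --> a -> f (u k) @[k --> \oo] --> f a.
Proof.
move=> cf a0 u0 ua; apply: (cvg_comp _ _ _ (path_within cf a0)) => U.
rewrite /within /= => nU; have := ua _ nU; rewrite /nbhs/=; apply: filterS => k /=.
by apply; rewrite in_itv/= u0.
Qed.

Section versions.
Context {R : realType} {d : nat} {disp : measure_display}
  {Omega : measurableType disp} (P : probability Omega R).
Variable W : R -> Omega -> 'cV[R]_d.
Hypothesis hP : measure_is_complete P.
Hypothesis hW : brownian P W.
Implicit Types (Z : R -> Omega -> 'rV[R]_d) (N : R -> Omega -> R).
Notation leb := (@lebesgue_measure R).

Lemma adapted_measurable N t : 0 <= t -> adapted P W N -> measurable_fun setT (N t).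
Proof.
move=> t0 aN; apply: (measF_measurable hP hW (t := t)); apply: measF_open.
exact: aN.
Qed.

Lemma simple_int0 S w : simple P W S -> simple_int W S 0 w = 0.
Proof.
move=> hS; rewrite /simple_int (big_nth (Step 0 0 (fun=> 0))) big_mkord.
apply: big1 => i _; have [/andP[l0 lh] _ _] := hS i (ltn_ord i).
by rewrite (min_r l0) (min_r (le_trans l0 lh)) subrr mulmx0 mxE.
Qed.

(** [ito_integral] gives mean-square approximation at positive times only. Setting the process to 0
    at times [t <= 0] supplies the statement at time 0, and setting it to 0 on a null set [M]
    changes no second moment. *)
Lemma ito_integral_pair Z I (M : set Omega) : ito_integral P W Z I ->
  measurable M -> P M = 0%E ->
  ito_pair P W Z (fun t w => if (t <= 0) || (w \in M) then 0 else I t w).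
Proof.
move=> [hZ aI cI [S [hS lim]]] mM M0.
have sqZ := integrable_sqi_coord hP hW _ hZ.
have E0 t : (fun w => if (t <= 0) || (w \in M) then 0 else I t w) =
    (fun w => (if t <= 0 then 0 else I t w) * \1_(~` M) w).
  apply/funext => w; rewrite indicE in_setC; case: (t <= 0) => /=; first by rewrite mul0r.
  by case: (w \in M); rewrite ?mulr0 ?mulr1.
have mI t : 0 <= t -> measurable_fun setT (I t) by move=> t0; exact: adapted_measurable.
have mN t : 0 <= t -> measurable_fun setT (fun w => if (t <= 0) || (w \in M) then 0 else I t w).
  move=> t0; have m1 : measurable_fun setT (fun w => if t <= 0 then 0 else I t w).
    by case: (t <= 0); [exact: measurable_cst|exact: mI].
  have m2 : measurable_fun setT (\1_(~` M) : Omega -> R) by apply: measurable_indic; exact: measurableC.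
  by rewrite [X in measurable_fun _ X](E0 t); exact: measurable_funM m1 m2.
split => //.
exists S; split => // T T0.
split.
  have [T0'|T0'] := ltP 0 T; last first.
    have -> : (fun m => Exp (PT P) (fun p => \1_(`]0, T]) p.2 *
        enorm (simple_val (S m) p.2 p.1 - Z p.2 p.1) ^+ 2)) = fun=> 0; last exact: cvg_cst.
    apply/funext => m; rewrite -[RHS](Exp0 (PT P)); apply: eq_Rintegral => p _.
    rewrite indicE mem_setE in_itv/=; case: ltP => /= [p0|]; rewrite ?mul0r//.
    by rewrite leNgt (le_lt_trans T0' p0) mul0r.
  have hi m := igr_simple_sub hP hW T0 (hS m) (sqZ T).
  have [+ _] := lim T T0'; apply: cvg_fine0 => m.
  rewrite (EFin_Exp (hi m)) (@integral_PT _ _ _ P (fun s w => enorm (simple_val (S m) s w - Z s w) ^+ 2))//.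
    by move=> *; exact: sqr_ge0.
  exact: igr_measurable (hi m).
have -> : (fun m w => simple_int W (S m) T w - (if (T <= 0) || (w \in M) then 0 else I T w)) =
  (fun m w => (simple_int W (S m) T w - (if T <= 0 then 0 else I T w)) +
    (if T <= 0 then 0 else I T w) * \1_M w).
  apply/funext => m; apply/funext => w; rewrite indicE; case: (T <= 0) => /=.
    by rewrite mul0r addr0.
  by case: (w \in M); rewrite ?mulr0 ?mulr1 ?addr0// subr0 subrK.
have mt : measurable_fun setT (fun w => (if T <= 0 then 0 else I T w) * \1_M w).
  by apply: measurable_funM; [case: (T <= 0) => //; exact: mI|exact: measurable_indic].
apply: l2nullD; last first.
  have [hz hz'] : igr P (fun w => ((if T <= 0 then 0 else I T w) * \1_M w) ^+ 2) /\
     Exp P (fun w => ((if T <= 0 then 0 else I T w) * \1_M w) ^+ 2) = 0.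
    apply: igr_ae0; first exact: measurable_funX.
    exists M; split => // w /= h; apply: contrapT => Mw; apply: h.
    by rewrite indicE memNset// mulr0 expr0n.
  by split; [move=> _; split|rewrite hz'; exact: cvg_cst].
have [T0'|T0'] := ltP 0 T; last first.
  have -> : (fun m w => simple_int W (S m) T w - 0) = fun _ _ => 0.
    apply/funext => m; apply/funext => w.
    have -> : T = 0 by apply/le_anti; rewrite T0' T0.
    by rewrite simple_int0// subr0.
  split; first by move=> m; exact: sqi0.
  by rewrite expr0n /= Exp0; exact: cvg_cst.
rewrite /=.
have [_ L] := lim T T0'.
have mS m : sqi P (simple_int W (S m) T).
  pose t (k : nat) := if k is 0%N then 0 else T.
  have At k : natural_filtration P W (t k) setT.
    exact: (@measurableT _ (g_sigma_algebraType (filtration_gen P W _))).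
  have tn : {homo t : i j / (i <= j)%N >-> i <= j}.
    by case=> [|i] [|j].
  have := sqi_simple_grid_sum hP hW 1%N (lexx 0 : 0 <= t 0%N) tn At (hS m).
  congr (sqi _ _); apply/funext => w.
  by rewrite /grid_sum big_ord1 indicT mul1r simple_int0// subr0.
have mD m : measurable_fun setT (fun w => simple_int W (S m) T w - I T w).
  by apply: measurable_funB; [case: (mS m)|exact: mI].
(* Convergence to 0 in the extended reals makes some second moment finite; together with the simple
   integral this gives square-integrability of [I T], and then all second moments are finite. *)
have [m0 hm0] : exists m0, sqi P (fun w => simple_int W (S m0) T w - I T w).
  have /fine_cvgP[+ _] := L; move/filter_ex => [m fm]; exists m; split => //.
  apply: igr_ge0P; first exact: measurable_funX.
    by move=> w; exact: sqr_ge0.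
  by rewrite ltey_eq fm.
have hI : sqi P (I T).
  have -> : I T = (fun w => simple_int W (S m0) T w - (simple_int W (S m0) T w - I T w)).
    by apply/funext => w; ring.
  exact: sqiB.
have hD m : sqi P (fun w => simple_int W (S m) T w - I T w) by exact: sqiB.
split => //; apply: (cvg_fine0 _ L) => m.
by rewrite EFin_Exp//; case: (hD m).
Qed.

Lemma ito_pair_isometry0 Z N T : ito_pair P W Z N -> 0 < T -> (forall w, N 0 w = 0) ->
  sqi P (N T) /\ 
  Exp P (fun w => N T w ^+ 2) = Exp (PT P) (fun p => \1_(`]0, T]) p.2 * enorm (Z p.2 p.1) ^+ 2).
Proof.
move=> hZ T0 N0; pose t (k : nat) := if k is 0%N then 0 else T.
have At k : natural_filtration P W (t k) setT.
  exact: (@measurableT _ (g_sigma_algebraType (filtration_gen P W _))).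
have tn : {homo t : i j / (i <= j)%N >-> i <= j}.
  by case=> [|i] [|j] //= _; exact: ltW.
have [] := grid_isometry hP hW 1%N (lexx 0 : 0 <= t 0%N) tn At hZ.
have -> : grid_sum 1 t (fun=> setT) N = N T.
  by apply/funext => w; rewrite /grid_sum big_ord1 indicT mul1r N0 subr0.
move=> h _ ->; split => //; apply: eq_Rintegral => p _.
rewrite /grid_weight big_ord1 indicT mul1r enormZ exprMn real_normK ?num_real//=.
by rewrite indicE; case: (_ \in _); rewrite ?expr1n ?expr0n.
Qed.

(** What has to be proved is that [I 0] vanishes almost surely. By continuity it is the limit of the
    values at times [u k], whose second moments are, by the isometry, integrals of [|Z|^2] over []0,
    u k]] and tend to 0; Fatou concludes. Paths in the exceptional set are then replaced by 0. *)
Lemma ito_pair_version Z I : ito_integral P W Z I -> exists N,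
  [/\ ito_pair P W Z N, (forall w, {within `[0, +oo[, continuous (fun t => N t w)}),
      (forall w, N 0 w = 0) & {ae P, forall w, forall t, 0 <= t -> N t w = I t w}].
Proof.
move=> hI; have [hZ aI [M1 [mM1 M10 cM1]] _] := hI.
pose N1 t w := if (t <= 0) || (w \in M1) then 0 else I t w.
have h1 : ito_pair P W Z N1 by exact: ito_integral_pair.
have cI w : w \notin M1 -> {within `[0, +oo[, continuous (fun t => I t w)}.
  by move=> wM; apply: contrapT => h; move/negP: wM; apply; rewrite inE; exact: cM1.
(* [Y] is the value at time 0 off the set of discontinuous paths; there it is the limit of
   [N1 (u k)], and on that set both are 0. *)
pose Y w := I 0 w * \1_(~` M1) w.
have mY : measurable_fun setT Y.
  apply: measurable_funM; first exact: adapted_measurable.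
  by apply: measurable_indic; exact: measurableC.
pose u (k : nat) : R := k.+1%:R^-1.
have u0 k : 0 < u k by rewrite invr_gt0.
have iso k := ito_pair_isometry0 h1 (u0 k).
have N10 w : N1 0 w = 0 by rewrite /N1 lexx.
have NY w : N1 (u k) w @[k --> \oo] --> Y w.
  rewrite /N1 /Y indicE in_setC.
  have E k : (u k <= 0) = false by apply/negbTE; rewrite -ltNge.
  under eq_fun do rewrite E /=.
  case: (boolP (w \in M1)) => wM /=; first by rewrite mulr0; exact: cvg_cst.
  rewrite mulr1.
  have cw := cI w wM.
  apply: (path_cvg (cI w wM)) => // [k|]; first exact: ltW.
  exact: cvg_harmonic.
have igT T : igr (PT P) (fun p => \1_(`]0, T]) p.2 * enorm (Z p.2 p.1) ^+ 2).
  under eq_fun do rewrite enorm_rowE mulr_sumr.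
  apply: igr_sum => j; have [_] := ito_sqi h1 T j.
  congr (integrable _ _ _); apply/funext => p /=; congr EFin.
  by rewrite exprMn indicE; case: (_ \in _); rewrite ?expr1n ?expr0n.
have Z0 : Exp (PT P) (fun p => \1_(`]0, u k]) p.2 * enorm (Z p.2 p.1) ^+ 2)
    @[k --> \oo] --> (0 : R).
  have [||||_ H] := @Exp_dominated _ _ _ (PT P)
    (fun k p => \1_(`]0, u k]) p.2 * enorm (Z p.2 p.1) ^+ 2) (fun=> 0)
    (fun p => \1_(`]0, 1]) p.2 * enorm (Z p.2 p.1) ^+ 2); last by move: H; rewrite Exp0.
  - by move=> m; exact: igr_measurable (igT _).
  - exact: igT.
  - move=> m p; rewrite ger0_norm; last by apply: mulr_ge0; rewrite ?sqr_ge0.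
    apply: ler_wpM2r; first exact: sqr_ge0.
    rewrite !indicE ler_nat !mem_setE !in_itv/=.
    case: ltP => //= p0; case: leP => //= pu.
    by rewrite (le_trans pu)// invf_le1// ler1n.
  - move=> p; have [p0|p0] := ltP 0 p.2; last first.
      rewrite [X in X @ _](_ : _ = fun=> 0); first exact: cvg_cst.
      by apply/funext => k; rewrite indicE mem_setE in_itv/= ltNge p0 mul0r.
    apply: (@cvg_near_cst _ _ _ _ _ _) => //.
    have : \forall k \near \oo, u k < p.2.
      have /cvgrPdist_lt/(_ _ p0) := @cvg_harmonic R.
      by apply: filterS => k; rewrite sub0r normrN gtr0_norm.
    apply: filterS => k ku.
    by rewrite indicE mem_setE in_itv/= [p.2 <= _]leNgt ku andbF mul0r.
have Y2 k : sqi P Y /\ Exp P (fun w => Y w ^+ 2) <=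
    Exp (PT P) (fun p => \1_(`]0, u k]) p.2 * enorm (Z p.2 p.1) ^+ 2).
  apply: (sqi_fatou (X := fun m => N1 (u (m + k)%N))).
  - by move=> m; case: (iso (m + k)%N N10).
  - by move=> w; have := NY w; rewrite -(cvg_shiftn k).
  - move=> m; have [_ ->] := iso (m + k)%N N10; apply: le_Exp; [exact: igT|exact: igT|].
    move=> p; apply: ler_wpM2r; first exact: sqr_ge0.
    rewrite !indicE ler_nat !mem_setE !in_itv/=.
    case: ltP => //= p0; case: leP => //= pu.
    by rewrite (le_trans pu)// lef_pV2 ?posrE// ler_nat ltnS leq_addl.
have EY : Exp P (fun w => Y w ^+ 2) = 0.
  apply/le_anti; rewrite Exp_ge0 => [|w]; last exact: sqr_ge0.
  rewrite andbT; apply: (ler_cvg_to (cvg_cst _) Z0).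
  by apply: nearW => k; have [_] := Y2 k.
have [M2' [mM2 M20 YM2]] : {ae P, forall w, Y w = 0}.
  have hY : igr P (fun w => Y w ^+ 2) by case: (Y2 0%N) => -[].
  have /(ae_eq_integral_abs P measurableT) : (\int[P]_w `|(Y w ^+ 2)%:E| = 0)%E.
    under eq_integral do rewrite /= ger0_norm ?sqr_ge0//.
    by rewrite -EFin_Exp// EY.
  move=> h; have {h} : ae_eq P setT (fun w => (Y w ^+ 2)%:E) (cst 0%E).
    by apply: h; apply/measurable_EFinP/measurable_funX.
  by apply: filterS => w /(_ Logic.I) [] /eqP; rewrite sqrf_eq0 => /eqP.
pose M := M1 `|` M2'.
have mM : measurable M by exact: measurableU.
have M0 : P M = 0%E.
  apply/le_anti; rewrite measure_ge0 andbT (le_trans (measureU2 _ mM1 mM2))//.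
  by rewrite [X in (X + _)%E]M10 [X in (_ + X)%E]M20 adde0.
have I0 w : w \notin M -> I 0 w = 0.
  move=> wM; have : Y w = 0.
    apply: contrapT => h; move/negP: wM; apply; rewrite inE; right; exact: YM2.
  rewrite /Y indicE mem_set ?mulr1//= => wM1.
  by move/negP: wM; apply; rewrite inE; left.
pose N t w := if (t <= 0) || (w \in M) then 0 else I t w.
have NI w : w \notin M -> forall t, 0 <= t -> N t w = I t w.
  move=> wM t t0; rewrite /N (negbTE wM) orbF; case: leP => // t0'.
  by rewrite -(I0 w wM); congr (I _ w); apply/le_anti; rewrite t0 t0'.
exists N; split.
- exact: ito_integral_pair.
- move=> w; have [wM|wM] := boolP (w \in M).
    have -> : (fun t => N t w) = fun=> 0 by apply/funext => t; rewrite /N wM orbT.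
    by apply: continuous_subspaceT => t; exact: cvg_cst.
  have wM1 : w \notin M1.
    by apply: contra wM; rewrite !inE => ?; left.
  apply: (subspace_eq_continuous _ (cI w wM1)) => t.
  by rewrite inE /= in_itv/= andbT => t0; exact/esym/NI.
- by move=> w; rewrite /N lexx.
- exists M; split => // w /= h; apply: contrapT => wM; apply: h => t t0; apply: NI => //.
  by apply/negP; rewrite inE.
Qed.

End versions.

(** * Stochastic integrals at stopping times *)

Section telescope.
Variables (R : realType) (h : R).
Hypothesis h0 : 0 < h.

(** The weights are the events that a grid point lies before the time [j h]; they stop the
    telescoping sum at index [j]. *)
Lemma sum_lt_telescope (f : R -> R) (M j : nat) : (j <= M)%N ->
  \sum_(k < M) (k%:R * h < j%:R * h)%R%:R * (f (k.+1%:R * h) - f (k%:R * h)) =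
  f (j%:R * h) - f 0.
Proof.
move=> jM.
transitivity (\sum_(k < M | (k < j)%N) (f (k.+1%:R * h) - f (k%:R * h))).
  rewrite [RHS]big_mkcond/=; apply: eq_bigr => k _.
  by rewrite ltr_pM2r// ltr_nat; case: ltnP; rewrite ?mul1r ?mul0r.
rewrite -(big_ord_widen M (fun k => f (k.+1%:R * h) - f (k%:R * h)) jM).
by rewrite -(big_mkord xpredT (fun k => f (k.+1%:R * h) - f (k%:R * h)))
  (telescope_sumr (fun k => f (k%:R * h)))// mul0r.
Qed.

Lemma sum_lt_indic (M j : nat) (s : R) : (j <= M)%N ->
  \sum_(k < M) (k%:R * h < j%:R * h)%R%:R * \1_(`]k%:R * h, k.+1%:R * h]) s =
  \1_(`]0, j%:R * h]) s :> R.
Proof.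
move=> jM.
transitivity (\sum_(k < M | (k < j)%N) (\1_(`]k%:R * h, k.+1%:R * h]) s : R)).
  rewrite [RHS]big_mkcond/=; apply: eq_bigr => k _.
  by rewrite ltr_pM2r// ltr_nat; case: ltnP; rewrite ?mul1r ?mul0r.
rewrite -(big_ord_widen M (fun k => \1_(`]k%:R * h, k.+1%:R * h]) s : R) jM).
elim: j {jM} => [|j ih].
  by rewrite big_ord0 mul0r set_itvoc0 indic0.
rewrite big_ord_recr/= ih !indicE !mem_setE !in_itv/= -natrD.
have j0 : 0 <= j%:R * h by rewrite mulr_ge0// ltW.
have jj : j%:R * h <= j.+1%:R * h by rewrite ler_pM2r// ler_nat.
congr (_%:R).
case: (ltP 0 s) => s0; case: (leP s (j%:R * h)) => sj;
  case: (leP s (j.+1%:R * h)) => sj1 //=; exfalso; lra.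
Qed.

End telescope.

Section stopping.
Context {R : realType} {d : nat} {disp : measure_display}
  {Omega : measurableType disp} (P : probability Omega R).
Variable W : R -> Omega -> 'cV[R]_d.
Hypothesis hP : measure_is_complete P.
Hypothesis hW : brownian P W.
Variables (T : R) (tau_ : nat -> Omega -> R) (tau : Omega -> R).
Hypothesis T0 : 0 < T.
Let h m := T / (2 ^ m)%:R.
(** Values of level [n] lie in every finer grid, so that [tau_ n] and [tau_ m] can be compared on
    the finer of the two grids. *)
Hypothesis tau_grid : forall n m w, (n <= m)%N ->
  exists2 j, (j <= 2 ^ m)%N & tau_ n w = j%:R * h m.
Hypothesis tau_stop : forall n s, 0 <= s ->
  natural_filtration P W s [set w | s < tau_ n w].
Hypothesis tau_noninc : forall n m w, (n <= m)%N -> tau_ m w <= tau_ n w.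
Hypothesis tau_cvg : forall w, tau_ n w @[n --> \oo] --> tau w.

Let h0 m : 0 < h m.
Proof. by rewrite divr_gt0// ltr0n expn_gt0. Qed.

Let t m (k : nat) := k%:R * h m.

Let t00 m : 0 <= t m 0%N. Proof. by rewrite /t mul0r. Qed.

Let tn m : {homo t m : i j / (i <= j)%N >-> i <= j}.
Proof. by move=> i j ij; rewrite /t ler_pM2r// ler_nat. Qed.

Let t0 m k : 0 <= t m k. Proof. exact: le_trans (tn m (leq0n k)). Qed.

Let tau0 n w : 0 <= tau_ n w.
Proof. by have [j _ ->] := tau_grid w (leqnn n); exact: t0. Qed.

Let tauT n w : tau_ n w <= T.
Proof.
have [j jM ->] := tau_grid w (leqnn n).
rewrite /h mulrA ler_pdivrMr ?ltr0n ?expn_gt0// mulrC ler_pM2l// ler_nat//.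
Qed.

Lemma stopping_le n w : tau w <= tau_ n w.
Proof.
apply: (cvgr_to_le (tau_cvg (w := w))).
by near=> m; apply: tau_noninc; near: m; exact: nbhs_infty_ge.
Unshelve. all: by end_near. Qed.

Lemma stopping_ge0 w : 0 <= tau w.
Proof. by apply: (cvgr_to_ge (tau_cvg (w := w))); apply: nearW => n; exact: tau0. Qed.

Lemma measurable_tau_ n : measurable_fun setT (tau_ n).
Proof.
apply: (measurability (@RGenOInfty.G R)); first exact: RGenOInfty.measurableE.
move=> _ [_ [s ->] <-]; rewrite setTI.
have [s0|s0] := leP 0 s.
  apply: (natural_filtration_measurable hP hW (t := s)).
  have := tau_stop n s0; congr (natural_filtration _ _ _ _).
  by apply/seteqP; split => w /=; rewrite in_itv/= andbT.
have -> : tau_ n @^-1` `]s, +oo[ = setT.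
  by apply/seteqP; split => w //= _; rewrite in_itv/= andbT (lt_le_trans s0).
exact: measurableT.
Qed.

Lemma measurable_stopping : measurable_fun setT tau.
Proof.
apply: (measurable_fun_cvg (h := tau_)) => [m|w _]; first exact: measurable_tau_.
exact: tau_cvg.
Qed.

Lemma measurable_indic_stop (a b : Omega -> R) : measurable_fun setT a ->
  measurable_fun setT b -> measurable_fun setT
   (fun p : Omega * measurableTypeR R => \1_(`]a p.1, b p.1]) p.2 : R).
Proof.
move=> ma mb.
have E : (fun p : Omega * measurableTypeR R => \1_(`]a p.1, b p.1]) p.2 : R) =
    \1_([set p : Omega * measurableTypeR R | a p.1 < p.2] `&` [set p | p.2 <= b p.1]).
  apply/funext => p; rewrite !indicE; congr (_%:R); congr nat_of_bool.
  apply/idP/idP => [/set_mem|/set_mem[]] /=; rewrite ?in_itv/=.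
    by move=> /andP[h1 h2]; apply/mem_set.
  by move=> h1 h2; apply/mem_set; rewrite /= in_itv/= h1.
have m2 : measurable_fun setT (fun p : Omega * measurableTypeR R => p.2).
  exact: measurable_snd.
rewrite E; apply: measurable_indic; apply: measurableI.
- have m1 := measurable_fun_ltr (measurableT_comp ma measurable_fst) m2.
  by rewrite -[X in measurable X]setTI; exact: (m1 measurableT [set true]).
- have m1 := measurable_fun_ler m2 (measurableT_comp mb measurable_fst).
  by rewrite -[X in measurable X]setTI; exact: (m1 measurableT [set true]).
Qed.

Variables (Z : R -> Omega -> 'rV[R]_d) (N : R -> Omega -> R).
Hypothesis hZN : ito_pair P W Z N.
Hypothesis cN : forall w, {within `[0, +oo[, continuous (fun t => N t w)}.
Hypothesis N0 : forall w, N 0 w = 0.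

Let D n w := N (tau_ n w) w.
Let q (p : Omega * measurableTypeR R) := enorm (Z p.2 p.1) ^+ 2.

Let igq : igr (PT P) (fun p => \1_(`]0, T]) p.2 * q p).
Proof.
rewrite /q; under eq_fun do rewrite enorm_rowE mulr_sumr.
apply: igr_sum => j; have [_] := ito_sqi hZN T j.
congr (integrable _ _ _); apply/funext => p /=; congr EFin.
by rewrite exprMn indicE; case: (_ \in _); rewrite ?expr1n ?expr0n.
Qed.

Let igrab (a b : Omega -> R) : measurable_fun setT a -> measurable_fun setT b ->
  (forall w, 0 <= a w) -> (forall w, b w <= T) ->
  igr (PT P) (fun p => \1_(`]a p.1, b p.1]) p.2 * q p).
Proof.
move=> ma mb a0 bT.
have E : (fun p => \1_(`]a p.1, b p.1]) p.2 * q p) =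
  (fun p => \1_(`]a p.1, b p.1]) p.2 * (\1_(`]0, T]) p.2 * q p)).
  apply/funext => p; rewrite mulrA; congr (_ * _).
  rewrite !indicE !mem_setE !in_itv/=; case: (ltP (a p.1) p.2) => //= ap; rewrite ?mul0r//.
  case: (leP p.2 (b p.1)) => //= pb; rewrite ?mul0r//.
  by rewrite (le_lt_trans (a0 _) ap) (le_trans pb (bT _)) mul1r.
rewrite E; apply: (igr_le _ igq).
  apply: measurable_funM; first exact: measurable_indic_stop.
  exact: igr_measurable igq.
move=> p; have q0 : 0 <= \1_(`]0, T]) p.2 * q p.
  by apply: mulr_ge0 => //; exact: sqr_ge0.
rewrite normrM [X in _ * X]ger0_norm//.
apply: ler_piMl => //; rewrite indicE; case: (_ \in _) => /=;
 by rewrite ?normr1 ?normr0.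
Qed.

(** The weights are the events that a grid point lies before [b] but not before [a]. They belong to
    the filtration at that grid point, so [grid_isometry] applies to the increment of [N] between
    the two times. *)
Let stop_sum m (a b : Omega -> R) : 
  (forall w, exists2 j, (j <= 2 ^ m)%N & a w = j%:R * h m) ->
  (forall w, exists2 j, (j <= 2 ^ m)%N & b w = j%:R * h m) ->
  (forall w, a w <= b w) ->
  (forall s, 0 <= s -> natural_filtration P W s [set w | s < a w]) ->
  (forall s, 0 <= s -> natural_filtration P W s [set w | s < b w]) ->
  [/\ sqi P (fun w => N (b w) w - N (a w) w),
      Exp P (fun w => N (b w) w - N (a w) w) = 0 &
      Exp P (fun w => (N (b w) w - N (a w) w) ^+ 2) =
      Exp (PT P) (fun p => \1_(`]a p.1, b p.1]) p.2 * q p)].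
Proof.
move=> ga gb ab sa sb.
pose A k := [set w | t m k < b w] `\` [set w | t m k < a w].
have At k : natural_filtration P W (t m k) (A k).
  apply: (@measurableD _ (g_sigma_algebraType (filtration_gen P W (t m k)))).
    exact: sb.
  exact: sa.
have AE k w : \1_(A k) w = (t m k < b w)%R%:R - (t m k < a w)%R%:R :> R.
  have E (f : Omega -> R) : (w \in [set w | t m k < f w]) = (t m k < f w).
    by apply/idP/idP => [/set_mem|lt]; last exact: mem_set.
  rewrite indicE /A in_setD !E.
  case: (ltP (t m k) (a w)) => ta; first by rewrite (lt_le_trans ta (ab w)) subrr andbF.
  by rewrite andbT subr0.
have [] := grid_isometry hP hW (2 ^ m) (t00 m) (tn m) At hZN.
have -> : grid_sum (2 ^ m) (t m) A N = (fun w => N (b w) w - N (a w) w).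
  apply/funext => w; rewrite /grid_sum; under eq_bigr do rewrite AE mulrBl.
  rewrite sumrB; have [i iM ->] := ga w; have [j jM ->] := gb w.
  rewrite (sum_lt_telescope (h0 m) (fun t => N t w) jM).
  rewrite (sum_lt_telescope (h0 m) (fun t => N t w) iM).
  by rewrite opprB addrA subrK.
move=> H1 H2 ->; split => //; apply: eq_Rintegral => p _.
have -> : grid_weight (2 ^ m) (t m) A p.2 p.1 = \1_(`]a p.1, b p.1]) p.2.
  rewrite /grid_weight; under eq_bigr do rewrite AE mulrBl.
  rewrite sumrB; have := ab p.1; have [i iM ->] := ga p.1; have [j jM ->] := gb p.1.
  move=> ij; rewrite !(sum_lt_indic (h0 m)) // !indicE !mem_setE !in_itv/=.
  have i0 : 0 <= i%:R * h m by exact: t0.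
  case: (ltP 0 p.2) => /= p0; last by rewrite ltNge (le_trans p0)//= subrr.
  case: (ltP (i%:R * h m) p.2) => /= pi; first by rewrite subr0.
  by rewrite (le_trans pi ij) subrr.
rewrite enormZ exprMn real_normK ?num_real//.
by rewrite indicE; case: (_ \in _); rewrite ?expr1n ?expr0n.
Qed.

Let hD n : [/\ sqi P (D n), Exp P (D n) = 0 &
  Exp P (fun w => D n w ^+ 2) = Exp (PT P) (fun p => \1_(`]0, tau_ n p.1]) p.2 * q p)].
Proof.
have g0 (w : Omega) : exists2 j, (j <= 2 ^ n)%N & (0 : R) = j%:R * h n.
  by exists 0%N => //; rewrite mul0r.
have s0 s : 0 <= s -> natural_filtration P W s [set w : Omega | s < 0].
  move=> s0; rewrite (_ : mkset _ = set0).
    exact: (@measurable0 _ (g_sigma_algebraType (filtration_gen P W s))).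
  by apply/seteqP; split => w //=; rewrite ltNge s0.
have := stop_sum g0 (fun w => tau_grid w (leqnn n)) (tau0 n) s0 (tau_stop n).
have -> : (fun w => N (tau_ n w) w - N 0 w) = D n.
  by apply/funext => w; rewrite N0 subr0.
move=> [H1 H2 H3]; split => //; rewrite -H3.
by apply: eq_Rintegral => w _; rewrite N0 subr0.
Qed.

(** The second moment of [D n - D (m + n)] is the integral of [|Z|^2] over []tau_ (m + n), tau_ n]],
    which is at most [e n]. Fatou in [m] bounds the mean-square distance from [D n] to [N] at [tau]
    by [e n], and [e n] tends to 0 by dominated convergence. *)
Let e n := Exp (PT P) (fun p => \1_(`]tau p.1, tau_ n p.1]) p.2 * q p).

Let hDD n : sqi P (fun w => D n w - N (tau w) w) /\
  Exp P (fun w => (D n w - N (tau w) w) ^+ 2) <= e n.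
Proof.
apply: (sqi_fatou (X := fun m w => D n w - D (m + n)%N w)).
- by move=> m; apply: sqiB; [case: (hD n)|case: (hD (m + n)%N)].
- move=> w; apply: cvgB; first exact: cvg_cst.
  apply: (path_cvg (u := fun m => tau_ (m + n)%N w) (@cN w)); [exact: stopping_ge0|by move=> k; exact: tau0|].
  by have := @tau_cvg w; rewrite -(cvg_shiftn n).
- move=> m.
  have [_ _ ->] := stop_sum (fun w => tau_grid w (leqnn (m + n)%N))
     (fun w => tau_grid w (leq_addl m n)) (fun w => tau_noninc w (leq_addl m n))
     (tau_stop (m + n)%N) (tau_stop n).
  apply: le_Exp.
  + by apply: igrab => //; exact: measurable_tau_.
  + by apply: igrab => //; [exact: measurable_stopping|exact: measurable_tau_|exact: stopping_ge0].
  + move=> p; apply: ler_wpM2r; first exact: sqr_ge0.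
    rewrite !indicE ler_nat !mem_setE !in_itv/=.
    case: (ltP (tau_ (m + n)%N p.1) p.2) => //= tp; case: (leP p.2 (tau_ n p.1)) => //= pt.
    by rewrite (le_lt_trans (stopping_le _ _) tp).
Qed.

Let indic_cvg (a : nat -> R) (l s : R) : (forall n, l <= a n) -> a n @[n --> \oo] --> l ->
  \1_(`]0, a n]) s @[n --> \oo] --> (\1_(`]0, l]) s : R).
Proof.
move=> la al; have [sl|ls] := leP s l.
  rewrite [X in X @ _](_ : _ = fun=> \1_(`]0, l]) s); first exact: cvg_cst.
  by apply/funext => n; rewrite !indicE !mem_setE !in_itv/= sl (le_trans sl).
apply: cvg_near_cst; apply: filterS (cvgr_lt _ al _ ls) => n an.
by rewrite !indicE !mem_setE !in_itv/= !leNgt an ls.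
Qed.

Let igr_tau_ n : igr (PT P) (fun p => \1_(`]0, tau_ n p.1]) p.2 * q p).
Proof. by apply: (igrab (a := fun=> 0)) => //; exact: measurable_tau_. Qed.

Let igr_tau : igr (PT P) (fun p => \1_(`]0, tau p.1]) p.2 * q p).
Proof.
apply: (igrab (a := fun=> 0)) => //; first exact: measurable_stopping.
by move=> w; apply: le_trans (stopping_le 0%N w) _.
Qed.

Let cvg_sq : Exp (PT P) (fun p => \1_(`]0, tau_ n p.1]) p.2 * q p) @[n --> \oo] -->
  Exp (PT P) (fun p => \1_(`]0, tau p.1]) p.2 * q p).
Proof.
have [||||_ H] := @Exp_dominated _ _ _ (PT P)
  (fun n p => \1_(`]0, tau_ n p.1]) p.2 * q p) (fun p => \1_(`]0, tau p.1]) p.2 * q p)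
  (fun p => \1_(`]0, T]) p.2 * q p); last exact: H.
- by move=> m; exact: igr_measurable (igr_tau_ m).
- exact: igq.
- move=> m p; rewrite ger0_norm; last by apply: mulr_ge0 => //; exact: sqr_ge0.
  apply: ler_wpM2r; first exact: sqr_ge0.
  rewrite !indicE ler_nat !mem_setE !in_itv/=.
  by case: ltP => //= p0; case: leP => //= pu; rewrite (le_trans pu).
- move=> p; apply: cvgM; last exact: cvg_cst.
  by apply: indic_cvg => [n|]; [exact: stopping_le|exact: tau_cvg].
Qed.

Let e0 : e n @[n --> \oo] --> (0 : R).
Proof.
have E n : e n = Exp (PT P) (fun p => \1_(`]0, tau_ n p.1]) p.2 * q p) -
     Exp (PT P) (fun p => \1_(`]0, tau p.1]) p.2 * q p).
  rewrite -ExpB//; apply: eq_Rintegral => p _; rewrite -mulrBl; congr (_ * _).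
  rewrite !indicE !mem_setE !in_itv/=.
  have h1 := stopping_le n p.1; have h2 := stopping_ge0 p.1.
  case: (ltP (tau p.1) p.2) => /= tp; first by rewrite (le_lt_trans h2 tp) subr0.
  by rewrite (le_trans tp h1) subrr.
under eq_fun do rewrite E.
set L := Exp (PT P) (fun p => \1_(`]0, tau p.1]) p.2 * q p).
by have := cvgB cvg_sq (cvg_cst L); rewrite subrr; apply.
Qed.

(** [N] at [tau] is the mean-square limit of its values at the grid-valued times [tau_ n], for which
    the mean and the isometry are known. *)
Lemma stopped_isometry : [/\ sqi P (fun w => N (tau w) w),
  Exp P (fun w => N (tau w) w) = 0 &
  Exp P (fun w => N (tau w) w ^+ 2) =
    Exp (PT P) (fun p => \1_(`]0, tau p.1]) p.2 * enorm (Z p.2 p.1) ^+ 2)].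
Proof.
have X0 : l2null P (fun n w => D n w - N (tau w) w).
  split; first by move=> n; case: (hDD n).
  apply: (squeeze0 _ e0) => n; rewrite Exp_ge0 => [|w]; last exact: sqr_ge0.
  by case: (hDD n).
have hN : sqi P (fun w => N (tau w) w).
  have -> : (fun w => N (tau w) w) = (fun w => D 0%N w - (D 0%N w - N (tau w) w)).
    by apply/funext => w; ring.
  by apply: sqiB; [case: (hD 0%N)|case: (hDD 0%N)].
have [mean sq] := l2null_limit X0 hN (fun n => let: And3 h1 _ _ := hD n in h1)
  (fun n => let: And3 _ h1 _ := hD n in h1).
split => //.
have sq' : Exp P (fun w => D n w ^+ 2) @[n --> \oo] -->
    Exp (PT P) (fun p => \1_(`]0, tau p.1]) p.2 * q p).
  by apply: cvg_trans cvg_sq; apply: near_eq_cvg; apply: nearW => n; case: (hD n).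
by rewrite -(cvg_lim _ sq)// -(cvg_lim _ sq').
Qed.

End stopping.

Section stopping_time.
Context {R : realType} {d : nat} {disp : measure_display}
  {Omega : measurableType disp} (P : probability Omega R).
Variable W : R -> Omega -> 'cV[R]_d.
Hypothesis hP : measure_is_complete P.
Hypothesis hW : brownian P W.
Variables (T : R) (ok : R -> set Omega).
Hypothesis T0 : 0 < T.
Hypothesis okF : forall s, 0 <= s -> natural_filtration P W s (ok s).

Let h m := T / (2 ^ m)%:R.

Let h0 m : 0 < h m.
Proof. by rewrite divr_gt0// ltr0n expn_gt0. Qed.

Let hT m : (2 ^ m)%:R * h m = T.
Proof. by rewrite /h mulrC divfK// pnatr_eq0 -lt0n expn_gt0. Qed.

Let hS m k : h m = (2 ^ k)%:R * h (m + k)%N.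
Proof.
rewrite /h expnD natrM; field.
by rewrite !pnatr_eq0 -!lt0n !expn_gt0.
Qed.

(** First index of the level [n] grid of [[0, T[] at which [ok] fails. If there is none, [find]
    returns the length [2 ^ n], and [tau_ n w] is [T]. *)
Let J n w := find (fun j => w \notin ok (j%:R * h n)) (iota 0 (2 ^ n)).
Let tau_ n w := (J n w)%:R * h n.

Let JM n w : (J n w <= 2 ^ n)%N.
Proof. by rewrite -[leqRHS](size_iota 0) find_size. Qed.

(** The event that [tau_ n] exceeds [s] is described by finitely many events known at time [s]. The
    stopping property and the monotonicity in [n] both follow from this description. *)
Let tau_ltP n w s : 0 <= s -> (s < tau_ n w) <->
  s < T /\ forall j, (j < 2 ^ n)%N -> j%:R * h n <= s -> w \in ok (j%:R * h n).
Proof.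
move=> s0; split.
  move=> st; split.
    by apply: lt_le_trans st _; rewrite -(hT n) ler_pM2r// ler_nat.
  move=> j jM js; have jJ : (j < J n w)%N.
    by rewrite -(ltr_nat R) -(ltr_pM2r (h0 n)); exact: le_lt_trans st.
  have := before_find 0%N jJ; rewrite nth_iota// add0n => /negbT; by rewrite negbK.
move=> [sT hj]; rewrite ltNge; apply/negP => ts.
have JM' : (J n w < 2 ^ n)%N.
  rewrite -(ltr_nat R) -(ltr_pM2r (h0 n)) hT; exact: le_lt_trans sT.
have has_ : has (fun j => w \notin ok (j%:R * h n)) (iota 0 (2 ^ n)).
  by rewrite has_find size_iota.
have := nth_find 0%N has_; rewrite nth_iota// add0n.
by rewrite hj.
Qed.

Let tau_grid n m w : (n <= m)%N ->
  exists2 j, (j <= 2 ^ m)%N & tau_ n w = j%:R * h m.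
Proof.
move=> nm; exists (J n w * 2 ^ (m - n))%N.
  by rewrite -{2}(subnKC nm) expnD leq_mul2r JM orbT.
by rewrite /tau_ (hS n (m - n)) subnKC// natrM mulrA.
Qed.

Let tau_stop n s : 0 <= s -> natural_filtration P W s [set w | s < tau_ n w].
Proof.
move=> s0; have [sT|Ts] := ltP s T; last first.
  rewrite (_ : mkset _ = set0).
    exact: (@measurable0 _ (g_sigma_algebraType (filtration_gen P W s))).
  by apply/seteqP; split => w //= /(tau_ltP _ _ s0)[]; rewrite ltNge Ts.
have -> : [set w | s < tau_ n w] =
    \bigcap_(j in [set j | (j < 2 ^ n)%N /\ j%:R * h n <= s]) ok (j%:R * h n).
  apply/seteqP; split => w.
    by move=> /(tau_ltP _ _ s0)[_ H] j [jM js]; apply/set_mem/H.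
  move=> H; apply/(tau_ltP _ _ s0); split => // j jM js; apply/mem_set; exact: H.
apply: (@bigcap_measurableType _ (g_sigma_algebraType (filtration_gen P W s))).
move=> j [jM js]; apply: (natural_filtrationS js); apply: okF.
by rewrite mulr_ge0// ltW.
Qed.

Let tau_noninc n m w : (n <= m)%N -> tau_ m w <= tau_ n w.
Proof.
move=> nm; rewrite leNgt; apply/negP => lt.
have t0 : 0 <= tau_ n w by rewrite mulr_ge0// ltW.
have /(tau_ltP _ _ t0)[tT H] := lt.
suff : tau_ n w < tau_ n w by rewrite ltxx.
apply/(tau_ltP _ _ t0); split => // j jM js.
have E : j%:R * h n = (j * 2 ^ (m - n))%:R * h m.
  by rewrite (hS n (m - n)) subnKC// natrM mulrA.
rewrite E; apply: H; last by rewrite -E.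
by rewrite -{2}(subnKC nm) expnD ltn_mul2r jM expn_gt0.
Qed.

Let tau w := limn (tau_ ^~ w).

Let tau_cvg w : tau_ n w @[n --> \oo] --> tau w.
Proof.
apply: nonincreasing_is_cvgn; first by move=> n m; exact: tau_noninc.
by exists 0 => _ [n _ <-]; rewrite mulr_ge0// ltW.
Qed.

Let tau_le n w : tau w <= tau_ n w.
Proof. exact: (stopping_le tau_noninc tau_cvg). Qed.

Let tau_leT w : tau w <= T.
Proof.
by apply: le_trans (tau_le 0 w) _; rewrite -(hT 0) ler_pM2r// ler_nat.
Qed.

Let tau_ge0 w : 0 <= tau w.
Proof. by apply: (stopping_ge0 T0 tau_grid tau_cvg). Qed.

Let h_cvg : h m @[m --> \oo] --> (0 : R).
Proof.
have -> : h = fun m => T * (2^-1) ^+ m.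
  by apply/funext => m; rewrite /h natrX exprVn.
apply: cvg0Ml; apply: cvg_expr.
by rewrite ger0_norm ?invr_ge0// invf_lt1// ltr1n.
Qed.

(** The level [m] grid points just below [s] lie before every [tau_ m], so [ok] holds there; they
    tend to [s], and the closedness premise passes to the limit. *)
Let ok_before w s :
  (forall u a, (forall k : nat, 0 <= u k /\ ok (u k) w) -> u k @[k --> \oo] --> a -> ok a w) ->
  0 <= s < tau w -> ok s w.
Proof.
move=> cl /andP[s0 st].
pose j m := Num.truncn (s / h m).
have sh m : 0 <= s / h m by rewrite divr_ge0// ltW.
have jle m : (j m)%:R * h m <= s by rewrite -ler_pdivlMr// truncn_le.
have jgt m : s - h m <= (j m)%:R * h m.
  have /truncn_itv/andP[_ /ltW] := sh m.
  by rewrite ler_pdivrMr// -natr1 mulrDl mul1r -lerBlDr.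
apply: (cl (fun m => (j m)%:R * h m)).
  move=> m; split; first by rewrite mulr_ge0// ltW.
  have [sT H] := (tau_ltP m w s0).1 (lt_le_trans st (tau_le m w)).
  apply/set_mem/H => //.
  by rewrite -(ltr_nat R) -(ltr_pM2r (h0 m)) hT; exact: le_lt_trans sT.
apply: (@squeeze_cvgr _ _ _ _ (fun m => s - h m) (fun=> s)).
- by apply: nearW => m; rewrite jgt jle.
- by have := cvgB (cvg_cst s) h_cvg; rewrite subr0; apply.
- exact: cvg_cst.
Qed.

(** [tau] is the limit of the dyadic exit times. For a path along which [ok] is closed under limits
    of times and holds at 0, it holds up to and including [tau]; for a path that stays in [ok] on
    [[0, T]], no exit occurs. *)
Lemma stopping_time : exists tau : Omega -> R,
  [/\ measurable_fun setT tau, (forall w, 0 <= tau w <= T),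
    (forall w, (forall u a, (forall k : nat, 0 <= u k /\ ok (u k) w) ->
       u k @[k --> \oo] --> a -> ok a w) ->
     ok 0 w -> forall s, 0 <= s <= tau w -> ok s w),
    (forall w, (forall s, 0 <= s <= T -> ok s w) -> tau w = T)
  & forall Z N, ito_pair P W Z N ->
     (forall w, {within `[0, +oo[, continuous (fun t => N t w)}) ->
     (forall w, N 0 w = 0) ->
    [/\ sqi P (fun w => N (tau w) w),
      Exp P (fun w => N (tau w) w) = 0 &
      Exp P (fun w => N (tau w) w ^+ 2) =
        Exp (PT P) (fun p => \1_(`]0, tau p.1]) p.2 * enorm (Z p.2 p.1) ^+ 2)]].
Proof.
exists tau; split.
- exact: (measurable_stopping hP hW T0 tau_grid tau_stop tau_cvg).
- by move=> w; rewrite tau_ge0 tau_leT.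
- move=> w cl ok0 s /andP[s0]; rewrite le_eqVlt => /predU1P[->|st]; last first.
    by apply: ok_before => //; rewrite s0.
  have := tau_ge0 w; rewrite le_eqVlt => /predU1P[<-//|t0].
  pose u (k : nat) := tau w - tau w * k.+1%:R^-1.
  apply: (cl u).
    move=> k; have k1 : k.+1%:R^-1 <= 1 :> R by rewrite invf_le1// ler1n.
    have u0 : 0 <= u k by rewrite subr_ge0 ler_piMr// ltW.
    split => //; apply: ok_before => //; rewrite u0 /=.
    by rewrite ltrBlDr ltrDl mulr_gt0.
  have := cvgB (cvg_cst (tau w)) (cvg0Ml (tau w) (@cvg_harmonic R)).
  by rewrite subr0; apply.
- move=> w H; apply/le_anti; rewrite tau_leT /=.
  apply: (cvgr_to_ge (@tau_cvg w)); apply: nearW => n.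
  rewrite leNgt; apply/negP => lt.
  have t0 : 0 <= tau_ n w by rewrite mulr_ge0// ltW.
  suff : tau_ n w < tau_ n w by rewrite ltxx.
  apply/(tau_ltP _ _ t0); split => // j jM js; apply/mem_set/H.
  rewrite mulr_ge0 ?(ltW (h0 n))//= -(hT n) ler_pM2r// ler_nat.
  exact: ltnW.
- move=> Z N hZN cN N0.
  exact: (stopped_isometry hP hW T0 tau_grid tau_stop tau_noninc tau_cvg hZN cN N0).
Qed.

End stopping_time.

(** * Differential calculus with partial derivatives *)

Lemma convex_norm_lt (R : realDomainType) (x y c r t : R) : 0 <= t <= 1 ->
  `|x - c| < r -> `|y - c| < r -> `|x + t * (y - x) - c| < r.
Proof.
move=> /andP[t0 t1] xr yr; have -> : x + t * (y - x) - c = (1 - t) * (x - c) + t * (y - c).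
  by ring.
apply: le_lt_trans (ler_normD _ _) _; rewrite !normrM (ger0_norm t0).
rewrite (ger0_norm (_ : 0 <= 1 - t)); last by rewrite subr_ge0.
have m : Num.max `|x - c| `|y - c| < r by rewrite gt_max xr.
apply: le_lt_trans m; have h1 : `|x - c| <= Num.max `|x - c| `|y - c| by rewrite le_max lexx.
have h2 : `|y - c| <= Num.max `|x - c| `|y - c| by rewrite le_max lexx orbT.
nra.
Qed.

Section calculus_theory.
Context {R : realType} {d : nat}.
Implicit Types (u : 'cV[R]_d -> R) (x y z : 'cV[R]_d).

Notation e i := (delta_mx i 0 : 'cV[R]_d).

Lemma is_derive_partial u i z (s : R) : derivable u (z + s *: e i) (e i) ->
  is_derive s 1 (fun s : R => u (z + s *: e i)) (partial i u (z + s *: e i)).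
Proof.
move=> hd.
have E : (fun h : R => h^-1 *: (((fun s : R => u (z + s *: e i)) \o shift s) (h *: 1) - u (z + s *: e i))) =
   (fun h : R => h^-1 *: ((u \o shift (z + s *: e i)) (h *: e i) - u (z + s *: e i))).
  apply/funext => h; congr (_ *: (_ - _)); rewrite /= /shift; congr u.
  by rewrite scalerDl [h%:A]mulr1 addrCA addrC -addrA addrCA.
split; first by rewrite /derivable E.
by rewrite /derive E.
Qed.

(** [is_C1] speaks of partial derivatives only. One passes from [x] to [y] changing one coordinate
    at a time, through the points [zz k], and applies the mean value theorem in each direction; the
    balls are those of the sup norm, so all intermediate points stay inside. *)
Lemma C1_increment u x0 (eps : R) : is_C1 u -> 0 < eps ->
  exists2 r : R, 0 < r & forall x y, `|x - x0| < r -> `|y - x0| < r ->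
    `|u y - u x - \sum_i partial i u x0 * (y - x) i 0| <= eps * `|y - x|.
Proof.
move=> hu eps0.
pose eps' := eps / d.+1%:R.
have eps'0 : 0 < eps' by rewrite divr_gt0.
have hh i : \forall z \near x0, `|partial i u x0 - partial i u z| <= eps'.
  by have [_ ci] := hu i; have /cvgrPdist_le/(_ _ eps'0) := ci x0.
have : nbhs x0 [set z | forall i, `|partial i u x0 - partial i u z| <= eps'].
  exact: (@filter_forall _ 'I_d (fun i => [set z | `|partial i u x0 - partial i u z| <= eps'])
     (nbhs x0) _ hh).
move=> /nbhs_ballP[r /= r0 hr]; exists r => // x y xr yr.
pose zz (k : nat) : 'cV[R]_d := \col_i (if (i < k)%N then y i 0 else x i 0).
have z0 : zz 0%N = x by apply/colP => i; rewrite mxE.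
have zd : zz d = y by apply/colP => i; rewrite mxE ltn_ord.
have zS (k : 'I_d) : zz k.+1 = zz k + (y - x) k 0 *: e k.
  apply/colP => i; rewrite !mxE eqxx andbT ltnS leq_eqVlt.
  have [->|ik] := eqVneq i k; first by rewrite eqxx ltnn mulr1 addrC subrK.
  have -> : (i == k :> nat) = false by apply/negbTE.
  by rewrite mulr0 addr0.
have rb z : `|z - x0| < r -> forall i, `|partial i u x0 - partial i u z| <= eps'.
  by move=> zr; apply: hr; rewrite -ball_normE /ball_ /= distrC.
have zr (k : 'I_d) (t : R) : 0 <= t <= 1 ->
    `|zz k + (t * (y - x) k 0) *: e k - x0| < r.
  move=> /andP[t0 t1]; rewrite [`|_|]mx_normrE.
  apply/bigmax_ltP; split => // -[i j] _ /=; rewrite ord1 {j} !mxE eqxx andbT.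
  have cx := le_lt_trans (coord_le_mx_norm (x - x0) i 0) xr.
  have cy := le_lt_trans (coord_le_mx_norm (y - x0) i 0) yr.
  move: cx cy; rewrite !mxE => cx cy.
  have [eik|ik] := eqVneq i k; last by rewrite mulr0 addr0; case: ifP.
  by rewrite -eik ltnn mulr1; apply: convex_norm_lt; rewrite ?t0.
pose g (k : 'I_d) (t : R) := u (zz k + (t * (y - x) k 0) *: e k) -
  t * ((y - x) k 0 * partial k u x0).
have dg (k : 'I_d) (t : R) : is_derive t 1 (g k)
   ((y - x) k 0 * (partial k u (zz k + (t * (y - x) k 0) *: e k) - partial k u x0)).
  have [hd _] := hu k.
  have h1 := is_derive_partial (hd (zz k + (t * (y - x) k 0) *: e k)).
  have h2 : is_derive t 1 (fun t : R => t * (y - x) k 0) ((y - x) k 0).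
    by apply: is_derive_eq; rewrite /GRing.scale /= mulr0 add0r mulr1.
  have h3 := @is_derive1_comp _ (fun s : R => u (zz k + s *: e k))
    (fun t : R => t * (y - x) k 0) _ _ _ h1 h2.
  apply: is_derive_eq.
  rewrite /GRing.scale /=; ring.
have gk (k : 'I_d) : `|g k 1 - g k 0| <= eps' * `|y - x|.
  have [t /andP[t0 t1] ->] : exists2 t, 0 <= t <= 1 & g k 1 - g k 0 =
     ((y - x) k 0 * (partial k u (zz k + (t * (y - x) k 0) *: e k) - partial k u x0)) * (1 - 0).
    have cg : {within `[0, 1], continuous (g k)}.
      apply: continuous_subspaceT => t; apply: differentiable_continuous.
      by apply/derivable1_diffP; have [] := dg k t.
    have [t] := @MVT_segment _ (g k) _ 0 1 ler01 (fun t _ => dg k t) cg.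
    by rewrite in_itv/= => tI ->; exists t.
  rewrite subr0 mulr1 normrM mulrC ler_pM//; last exact: coord_le_mx_norm.
  by rewrite distrC; apply: rb; apply: zr; rewrite t0.
have -> : u y - u x - \sum_i partial i u x0 * (y - x) i 0 = \sum_i (g i 1 - g i 0).
  rewrite -[in u y]zd -[in u x]z0.
  rewrite -(telescope_sumr (fun k => u (zz k)))// big_mkord -sumrB.
  apply: eq_bigr => k _; rewrite /g !mul1r !mul0r scale0r addr0 subr0 zS.
  by ring.
apply: le_trans (ler_norm_sum _ _ _) _.
apply: (@le_trans _ _ (\sum_(i < d) eps' * `|y - x|)); first exact: ler_sum.
rewrite sumr_const card_ord -mulr_natl mulrA ler_wpM2r//.
by rewrite /eps' mulrCA ler_piMr ?(ltW eps0)// ler_pdivrMr// mul1r ler_nat.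
Qed.

Lemma C1_differential u x0 (eps : R) : is_C1 u -> 0 < eps ->
  exists2 r : R, 0 < r & forall x, `|x - x0| < r ->
    `|u x - u x0 - \sum_i partial i u x0 * (x - x0) i 0| <= eps * `|x - x0|.
Proof.
move=> hu e0; have [r r0 H] := C1_increment x0 hu e0; exists r => // x xr.
by apply: H => //; rewrite subrr normr0.
Qed.

Lemma C1_continuous u : is_C1 u -> continuous u.
Proof.
move=> hu x0; apply: (@cvgrPdist_le _ _ _ (nbhs x0) (nbhs_filter x0) u (u x0)).2 => /= eps eps0.
have [r r0 H] := C1_differential x0 hu ltr01.
pose K := 1 + \sum_i `|partial i u x0|.
have K0 : 0 < K by rewrite /K ltr_pwDl// sumr_ge0.
have d0 : 0 < Num.min r (eps / K) by rewrite lt_min r0 divr_gt0.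
near=> x.
have xr : `|x - x0| < Num.min r (eps / K).
  rewrite distrC; near: x; apply/nbhs_ballP.
  by exists (Num.min r (eps / K)) => //= z; rewrite -ball_normE.
move: xr; rewrite lt_min => /andP[xr xe].
rewrite distrC; have := H x xr; rewrite mul1r.
set S := \sum_i _ => h.
have hS : `|S| <= (\sum_i `|partial i u x0|) * `|x - x0|.
  apply: le_trans (ler_norm_sum _ _ _) _; rewrite mulr_suml; apply: ler_sum => i _.
  by rewrite normrM ler_wpM2l// coord_le_mx_norm.
have h2 : `|u x - u x0| <= K * `|x - x0|.
  have := ler_normD (u x - u x0 - S) S; rewrite subrK => /le_trans; apply.
  by rewrite /K mulrDl mul1r lerD.
apply: le_trans h2 _; rewrite mulrC -ler_pdivlMr//; exact: ltW.
Unshelve. all: by end_near. Qed.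

Lemma is_derive_line u x0 (h : 'cV[R]_d) (s : R) : is_C1 u ->
  is_derive s 1 (fun s : R => u (x0 + s *: h)) (\sum_i partial i u (x0 + s *: h) * h i 0).
Proof.
move=> hu; set D := \sum_i _.
suff L : (fun t : R => t^-1 *: (((fun s : R => u (x0 + s *: h)) \o shift s) (t *: 1) -
    u (x0 + s *: h))) @ 0^' --> D.
  split; first by apply/cvg_ex; exists D.
  exact/cvg_lim.
apply/cvgrPdist_le => /= eps eps0.
pose eps' := eps / (1 + `|h|).
have n0 : 0 < 1 + `|h| by rewrite ltr_pwDl.
have eps'0 : 0 < eps' by rewrite divr_gt0.
have [r r0 H] := C1_differential (x0 + s *: h) hu eps'0.
have d0 : 0 < r / (1 + `|h|) by rewrite divr_gt0.
near=> t.
have t0 : t != 0 by near: t; exact: nbhs_dnbhs_neq.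
have tr : `|t| < r / (1 + `|h|).
  by near: t; apply: dnbhs0_lt.
have Et : x0 + (t + s) *: h - (x0 + s *: h) = t *: h.
  by rewrite scalerDl opprD addrACA subrr add0r addrK.
have hb : `|t| * `|h| <= `|t| * (1 + `|h|) by rewrite ler_wpM2l// lerDr.
have := H (x0 + (t + s) *: h); rewrite Et normrZ => /(_ _).
have xr : `|t| * `|h| < r.
  by apply: le_lt_trans hb _; rewrite -ltr_pdivlMr.
move=> /(_ xr) HH.
rewrite distrC /= /shift [t%:A]mulr1.
have -> : t^-1 *: (u (x0 + (t + s) *: h) - u (x0 + s *: h)) - D =
   t^-1 * (u (x0 + (t + s) *: h) - u (x0 + s *: h) -
     \sum_i partial i u (x0 + s *: h) * (t *: h) i 0).
  rewrite mulrBr; congr (_ - _); rewrite /D mulr_sumr; apply: eq_bigr => i _.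
  by rewrite mxE; field.
rewrite normrM normfV ler_pdivrMl ?normr_gt0//.
apply: le_trans HH _.
rewrite mulrCA; apply: ler_wpM2l => //.
by rewrite /eps' -mulrA ler_piMr ?(ltW eps0)// mulrC ler_pdivrMr// mul1r lerDr.
Unshelve. all: by end_near. Qed.

(** Along the segment, [g] is [u] minus the first- and second-order Taylor terms. The mean value
    theorem for [g] leaves a combination of first-order remainders of the partial derivatives, each
    controlled by [C1_differential]. *)
Lemma C2_taylor u x0 (eps : R) : is_C2 u -> 0 < eps ->
  exists2 r : R, 0 < r & forall h, `|h| < r ->
  `|u (x0 + h) - u x0 - \sum_i partial i u x0 * h i 0 -
    2^-1 * \sum_i \sum_j hess u x0 i j * h i 0 * h j 0| <= eps * `|h| ^+ 2.
Proof.
move=> [hu hu2] eps0.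
pose eps' := eps / d.+1%:R.
have eps'0 : 0 < eps' by rewrite divr_gt0.
have hi i : \forall x \near x0, `|partial i u x - partial i u x0 -
   \sum_j partial j (partial i u) x0 * (x - x0) j 0| <= eps' * `|x - x0|.
  have [r r0 H] := C1_differential x0 (hu2 i) eps'0.
  apply/nbhs_ballP; exists r => //= x; rewrite -ball_normE /ball_ /= distrC => xr.
  exact: H.
have : nbhs x0 [set x | forall i, `|partial i u x - partial i u x0 -
   \sum_j partial j (partial i u) x0 * (x - x0) j 0| <= eps' * `|x - x0|].
  exact: (@filter_forall _ 'I_d (fun i => [set x | `|partial i u x - partial i u x0 -
   \sum_j partial j (partial i u) x0 * (x - x0) j 0| <= eps' * `|x - x0|]) (nbhs x0) _ hi).
move=> /nbhs_ballP[r /= r0 hr]; exists r => // h hr'.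
set Q := \sum_i \sum_j _.
pose p := \sum_i partial i u x0 * h i 0.
pose g (s : R) := u (x0 + s *: h) - s * p - s ^+ 2 * (2^-1 * Q).
have dg (s : R) : is_derive s 1 g (\sum_i partial i u (x0 + s *: h) * h i 0 - p - s * Q).
  have h1 := is_derive_line x0 h s hu.
  apply: is_derive_eq; rewrite /GRing.scale /=; by field.
have cg : {within `[0, 1], continuous g}.
  apply: continuous_subspaceT => t; apply: differentiable_continuous.
  by apply/derivable1_diffP; have [] := dg t.
have [s] := @MVT_segment _ g _ 0 1 ler01 (fun t _ => dg t) cg.
rewrite in_itv/= => /andP[s0 s1]; rewrite subr0 mulr1 => E.
have -> : u (x0 + h) - u x0 - p - 2^-1 * Q = g 1 - g 0.
  rewrite /g !scale1r scale0r addr0 expr1n expr0n /= !mul0r !mul1r !subr0; ring.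
rewrite {}E.
have -> : \sum_i partial i u (x0 + s *: h) * h i 0 - p - s * Q =
  \sum_i (partial i u (x0 + s *: h) - partial i u x0 -
   \sum_j partial j (partial i u) x0 * (s *: h) j 0) * h i 0.
  rewrite /p /Q mulr_sumr -!sumrB; apply: eq_bigr => i _.
  rewrite !mulrBl; congr (_ - _ - _); rewrite mulr_sumr mulr_suml; apply: eq_bigr => j _.
  by rewrite !mxE; ring.
have sh : `|s *: h| <= `|h| by rewrite normrZ ger0_norm// ler_piMl.
have hb : ball x0 r (x0 + s *: h).
  rewrite -ball_normE /ball_ /= opprD addNKr normrN; exact: le_lt_trans sh hr'.
have hx := hr _ hb.
apply: le_trans (ler_norm_sum _ _ _) _.
apply: (@le_trans _ _ (\sum_(i < d) eps' * `|h| ^+ 2)).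
  apply: ler_sum => i _; rewrite normrM expr2 mulrA ler_pM//; last exact: coord_le_mx_norm.
  have Esh : x0 + s *: h - x0 = s *: h by rewrite addrAC subrr add0r.
  have := hx i; rewrite Esh => /le_trans; apply.
  by rewrite ler_wpM2l// ltW.
rewrite sumr_const card_ord -mulr_natl mulrA ler_wpM2r ?sqr_ge0//.
by rewrite /eps' mulrCA ler_piMr ?(ltW eps0)// ler_pdivrMr// mul1r ler_nat.
Qed.

End calculus_theory.

(** * Measurability along a path *)

(** Paths are continuous on [[0, +oo[] only; freezing them at their initial value for negative times
    makes them continuous on the whole line. *)
Lemma path_extend (R : realType) (T : topologicalType) (f : R -> T) :
  {within `[0, +oo[, continuous f} -> continuous (fun s : R => f (Num.max 0 s)).
Proof.
move=> cf s; have s0 : (0 : R) <= Num.max 0 s by rewrite le_max lexx.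
apply: (cvg_comp _ _ _ (path_within cf s0)) => U; rewrite /within /= => nU.
have cm : (fun s : R => Num.max 0 s : R) @ s --> Num.max 0 s.
  by apply: continuous_max; [exact: cvg_cst|exact: cvg_id].
apply: (@filterS _ (nbhs s) (nbhs_filter s) _ _ _ (cm _ nU)) => t /=.
by apply; rewrite in_itv/= le_max lexx.
Qed.

Section path_measurability.
Context {R : realType} {d : nat}.
Variables (X : R -> 'cV[R]_d) (xi : 'cV[R]_d -> 'rV[R]_d).
Variables (psi : 'cV[R]_d -> 'rV[R]_d -> R) (M : R).
Hypothesis cX : continuous X.
Hypothesis mxi : measurable_wrt (borel 'cV[R]_d) xi.
Hypothesis cpsi : forall z, continuous (fun x => psi x z).
Hypothesis lpsi : forall x z z', `|psi x z - psi x z'| <= M * enorm (z - z').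

Lemma lipschitz_continuous_row (g : 'rV[R]_d -> R) :
  (forall z z', `|g z - g z'| <= M * enorm (z - z')) -> continuous g.
Proof.
move=> lg z; apply: (@cvgrPdist_le _ _ _ (nbhs z) (nbhs_filter z) g (g z)).2 => /= eps eps0.
pose K := (`|M| * (1 * d)%:R + 1).
have K0 : 0 < K by rewrite ltr_wpDl// mulr_ge0.
apply/nbhs_ballP; exists (eps / K) => /=; first by rewrite divr_gt0.
move=> y; rewrite -ball_normE /ball_ /= => zy.
apply: le_trans (lg z y) _; apply: (@le_trans _ _ (`|M| * enorm (z - y))).
  by rewrite ler_wpM2r ?enorm_ge0// ler_norm.
apply: (@le_trans _ _ (K * `|z - y|)); last by rewrite mulrC -ler_pdivlMr// ltW.
apply: le_trans (ler_wpM2l (normr_ge0 M) (enorm_le_mx_norm _)) _.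
by rewrite mulrA ler_wpM2r// lerDl.
Qed.

Lemma measurable_path_borel B : borel 'cV[R]_d B ->
  measurable (X @^-1` B : set (measurableTypeR R)).
Proof.
apply: (@smallest_sub _ (sigma_algebra setT) _
  [set B | measurable (X @^-1` B : set (measurableTypeR R))]).
  split => /=.
  - by rewrite preimage_set0; exact: measurable0.
  - by move=> A mA; rewrite setTD preimage_setC; exact: measurableC.
  - by move=> F mF; rewrite preimage_bigcup; exact: bigcupT_measurable.
move=> U oU /=; apply: open_measurable.
by apply: open_comp => // s _; exact: cX.
Qed.

Lemma measurable_psi_xi x :
  measurable_fun setT (fun s : measurableTypeR R => psi x (xi (X s))).
Proof.
apply: (measurability (@RGenOpens.G R)); first exact: RGenOpens.measurableE.
move=> _ [U [a [b ->]] <-]; rewrite setTI.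
apply: (measurable_path_borel (B := xi @^-1` (psi x @^-1` `]a, b[))).
apply: mxi; apply: open_comp; last exact: interval_open.
move=> z _; apply: lipschitz_continuous_row; exact: lpsi.
Qed.

(** A Caratheodory argument: [psi] is continuous in [x] and in [z] separately. With the first
    argument frozen at the grid time [q n s], the function is measurable on each cell, and it
    converges pointwise by continuity in [x]. *)
Lemma measurable_psi_path :
  measurable_fun (`[0, +oo[ : set (measurableTypeR R)) (fun s => psi (X s) (xi (X s))).
Proof.
pose h (n : nat) : R := (n.+1%:R)^-1.
have h0 n : 0 < h n by rewrite invr_gt0.
pose q n (s : R) := (Num.truncn (s / h n))%:R * h n.
have qP n (s : R) : 0 <= s -> s - h n <= q n s <= s.
  move=> s0; have sh : 0 <= s / h n by rewrite divr_ge0// ltW.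
  have /truncn_itv/andP[h1 /ltW h2] := sh.
  rewrite /q; move: h1 h2; rewrite ler_pdivlMr// => ->; rewrite andbT.
  by rewrite ler_pdivrMr// -natr1 mulrDl mul1r -lerBlDr.
apply: (measurable_fun_cvg (h := fun n s => psi (X (q n s)) (xi (X s)))); last first.
  move=> s; rewrite /= in_itv/= andbT => s0.
  have qs : q n s @[n --> \oo] --> s.
    apply: (@squeeze_cvgr _ _ _ _ (fun n => s - h n) (fun=> s)).
    - by apply: nearW => m; exact: qP.
    - by have := cvgB (cvg_cst s) (@cvg_harmonic R); rewrite subr0; apply.
    - exact: cvg_cst.
  have Xq : X (q n s) @[n --> \oo] --> X s by apply: (cvg_comp _ _ qs); exact: cX.
  by apply: (cvg_comp _ _ Xq (cpsi (z := xi (X s)) (x := X s))).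
move=> n _ B mB.
have -> : `[0, +oo[ `&` (fun s => psi (X (q n s)) (xi (X s))) @^-1` B =
  \bigcup_k (`[k%:R * h n, k.+1%:R * h n[ `&`
     (setT `&` (fun s => psi (X (k%:R * h n)) (xi (X s))) @^-1` B)).
  apply/seteqP; split => s /=.
    rewrite in_itv/= andbT => -[s0 Bs]; exists (Num.truncn (s / h n)) => //.
    split; last by split.
    have sh : 0 <= s / h n by rewrite divr_ge0// ltW.
    have := truncn_itv sh; rewrite /= in_itv/= => /andP[h1 h2].
    by rewrite -ler_pdivlMr// h1 -ltr_pdivrMr.
  move=> [k _ [+ [_ Bs]]]; rewrite /= !in_itv/= andbT => /andP[h1 h2].
  have s0 : 0 <= s by apply: le_trans h1; rewrite mulr_ge0// ltW.
  split => //; rewrite /q; have -> : Num.truncn (s / h n) = k => //.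
  by apply: truncn_def; rewrite ler_pdivlMr// h1 ltr_pdivrMr.
apply: bigcupT_measurable => k; apply: measurableI => //.
exact: (measurable_psi_xi (X (k%:R * h n)) measurableT mB).
Qed.

End path_measurability.

(** * Lebesgue and Stieltjes integrals along a path *)

Section time_integrals.
Context {R : realType}.
Notation leb := (@lebesgue_measure R).
Variable tau : R.
Hypothesis tau0 : 0 <= tau.
Notation D := (`[0, tau]%classic : set (measurableTypeR R)).

Lemma lebesgue_itv0 : leb (`[0, tau] : set R) = tau%:E.
Proof.
rewrite lebesgue_measure_itv/= lte_fin; case: ltP => t0; first by rewrite oppr0 adde0.
by congr EFin; apply/le_anti; rewrite tau0 t0.
Qed.

Lemma integrable_itv_cst (c : R) : leb.-integrable D (EFin \o fun=> c).
Proof.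
apply/integrableP; split; first exact: measurable_cst.
rewrite /= integral_cst//= lebesgue_itv0 -EFinM; exact: ltry.
Qed.

Lemma Rintegral_itv_cst (c : R) : \int[leb]_(s in D) c = c * tau.
Proof. by rewrite Rintegral_cst// [X in fine X]lebesgue_itv0. Qed.

Lemma Rintegral_itv_bound (g z : R -> R) (a e M : R) :
  measurable_fun D g -> leb.-integrable D (EFin \o z) ->
  (forall s, 0 <= s <= tau -> `|g s - a| <= e + M * z s) ->
  leb.-integrable D (EFin \o g) /\
  `|\int[leb]_(s in D) g s - a * tau| <= e * tau + M * \int[leb]_(s in D) z s.
Proof.
move=> mg hz gz.
have mD : measurable D by exact: measurable_itv.
have hMz : leb.-integrable D (EFin \o fun s => M * z s).
  by have := integrableZl mD M hz.
have hb : leb.-integrable D (EFin \o fun s => e + M * z s).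
  by have := integrableD mD (integrable_itv_cst e) hMz.
have hga : leb.-integrable D (EFin \o fun s => g s - a).
  apply: (le_integrable mD _ _ hb).
    by apply/measurable_EFinP; apply: measurable_funB => //; exact: measurable_cst.
  move=> s; rewrite /= in_itv/= => sD; rewrite lee_fin.
  by apply: le_trans (gz s sD) _; exact: ler_norm.
have hg : leb.-integrable D (EFin \o g).
  have := integrableD mD hga (integrable_itv_cst a).
  apply: eq_integrable => // s _ /=; by rewrite -EFinD subrK.
split => //; rewrite -[X in _ - X]Rintegral_itv_cst -RintegralB//; last exact: integrable_itv_cst.
apply: le_trans (le_normr_Rintegral mD hga) _.
rewrite -Rintegral_itv_cst -RintegralZl// -RintegralD//; last exact: integrable_itv_cst.
apply: le_Rintegral => //; first by have := integrable_norm hga.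
Qed.

(** The family indexed by [th] is the integral of [(z s - th)^2 >= 0] divided by [th]; the choice of
    [th] as the mean value of [z] turns it into the Cauchy-Schwarz inequality. *)
Lemma Rintegral_itv_sqr (z : R -> R) :
  measurable_fun D z -> (forall s, 0 <= z s) ->
  leb.-integrable D (EFin \o fun s => z s ^+ 2) ->
  [/\ leb.-integrable D (EFin \o z), 0 <= \int[leb]_(s in D) z s,
    (forall th, 0 < th -> 2 * (\int[leb]_(s in D) z s) <=
       th * tau + th^-1 * \int[leb]_(s in D) (z s ^+ 2))
   & (\int[leb]_(s in D) z s) ^+ 2 <= tau * \int[leb]_(s in D) (z s ^+ 2)].
Proof.
move=> mz z0 hz2; have mD : measurable D by exact: measurable_itv.
have hz : leb.-integrable D (EFin \o z).
  apply: (le_integrable mD _ _ (integrableD mD (integrable_itv_cst 1) hz2)).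
    exact/measurable_EFinP.
  move=> s _ /=; rewrite lee_fin [leRHS]ger0_norm; last first.
    by rewrite addr_ge0// sqr_ge0.
  rewrite ger0_norm//; have := sqr_ge0 (z s - 1); have := z0 s; nra.
have R10 : 0 <= \int[leb]_(s in D) z s by apply: Rintegral_ge0 => s _.
have R20 : 0 <= \int[leb]_(s in D) (z s ^+ 2) by apply: Rintegral_ge0 => s _; exact: sqr_ge0.
have H th : 0 < th -> 2 * (\int[leb]_(s in D) z s) <=
       th * tau + th^-1 * \int[leb]_(s in D) (z s ^+ 2).
  move=> th0; have h2 : leb.-integrable D (EFin \o fun s => th^-1 * z s ^+ 2).
    by have := integrableZl mD th^-1 hz2.
  rewrite -RintegralZl// -[X in X + _]Rintegral_itv_cst -RintegralZl// -RintegralD//; last first.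
    exact: integrable_itv_cst.
  apply: le_Rintegral => //.
  - by have := integrableZl mD 2 hz.
  - by have := integrableD mD (integrable_itv_cst th) h2.
  move=> s _; rewrite -subr_ge0.
  have -> : th + th^-1 * z s ^+ 2 - 2 * z s = th^-1 * (z s - th) ^+ 2.
    by field; rewrite gt_eqF.
  by rewrite mulr_ge0 ?sqr_ge0// invr_ge0 ltW.
split => //.
set r1 := (\int[leb]_(s in D) z s) in R10 H *.
set r2 := (\int[leb]_(s in D) (z s ^+ 2)) in R20 H *.
have [t0|t0] := ltP 0 tau; last first.
  have t00 : tau = 0 by apply/le_anti; rewrite tau0 t0.
  have [r10|r10] := ltP 0 r1; last first.
    have -> : r1 = 0 by apply/le_anti; rewrite R10 r10.
    by rewrite expr0n /= mulr_ge0.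
  (* For [tau = 0] a large parameter [th] excludes a positive integral. *)
  exfalso; have := H ((r2 + 1) / r1) (divr_gt0 (ltr_wpDl R20 ltr01) r10).
  rewrite t00 mulr0 add0r invf_div.
  rewrite mulrAC ler_pdivlMr ?ltr_wpDl//; nra.
have [r10|r10] := ltP 0 r1; last first.
  have -> : r1 = 0 by apply/le_anti; rewrite R10 r10.
  by rewrite expr0n /= mulr_ge0.
have := H (r1 / tau) (divr_gt0 r10 t0); rewrite divfK ?gt_eqF// invf_div.
rewrite -lerBlDl mulrAC ler_pdivlMr//; nra.
Qed.

End time_integrals.

Section stieltjes.
Context {R : realType}.
Variables (k : cumulative R R) (tau : R).
Hypothesis tau0 : 0 <= tau.
Notation mu := (lebesgue_stieltjes_measure k).
Notation D := (`]0, tau]%classic : set (measurableTypeR R)).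

Lemma stieltjes_itv : mu D = (k tau - k 0)%:E.
Proof.
rewrite /lebesgue_stieltjes_measure /measure_extension/=.
by rewrite measurable_mu_extE/= ?wlength_itv_bnd//; exact: is_ocitv.
Qed.

Let mD : measurable D. Proof. exact: measurable_itv. Qed.

Lemma integrable_stieltjes (g : R -> R) C : measurable_fun setT (g : measurableTypeR R -> R) ->
  (forall s, 0 < s <= tau -> `|g s| <= C) -> mu.-integrable D (EFin \o g).
Proof.
move=> mg gC; apply: measurable_bounded_integrable => //.
- by have := ltry (k tau - k 0); rewrite -stieltjes_itv.
- exact: measurable_funTS.
- exists C; split; first exact: num_real.
  move=> M CM s; rewrite /= in_itv/= => sD; exact: le_trans (gC s sD) (ltW CM).
Qed.

Lemma Rintegral_stieltjes_bound (g : R -> R) C :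
  measurable_fun setT (g : measurableTypeR R -> R) ->
  (forall s, 0 < s <= tau -> `|g s| <= C) ->
  `|\int[mu]_(s in D) g s| <= C * (k tau - k 0).
Proof.
move=> mg gC; have hg := integrable_stieltjes mg gC.
apply: le_trans (le_normr_Rintegral mD hg) _.
have -> : C * (k tau - k 0) = \int[mu]_(s in D) C.
  by rewrite Rintegral_cst// [X in fine X]stieltjes_itv.
have [tau_0|tau_0] := ltP 0 tau; last first.
  have -> : tau = 0 by apply/le_anti; rewrite tau0 tau_0.
  by rewrite set_itvoc0 !Rintegral_set0.
apply: le_Rintegral => //.
- by have := integrable_norm hg.
- apply: (@integrable_stieltjes (fun=> C) C); first exact: measurable_cst.
  move=> s _; rewrite ger0_norm//; apply: le_trans (normr_ge0 (g tau)) (gC tau _).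
  by rewrite tau_0 lexx.
Qed.

(** The last premise says that the measure is carried by [B]. Then [g] is dominated by
    [|C| + (- c - |C|) 1_B], and since [1_B] integrates to the full mass, the two multiples of [|C|]
    cancel. *)
Lemma Rintegral_stieltjes_le (g : R -> R) (B : set (measurableTypeR R)) (c C : R) :
  measurable_fun setT (g : measurableTypeR R -> R) -> measurable B ->
  (forall s, 0 < s <= tau -> `|g s| <= C) ->
  (forall s, 0 < s <= tau -> B s -> g s <= - c) ->
  k tau - k 0 = \int[mu]_(s in D) \1_B s ->
  \int[mu]_(s in D) g s <= - c * (k tau - k 0).
Proof.
move=> mg mB gC gB hk.
have hg := integrable_stieltjes mg gC.
have mI : measurable_fun setT (\1_B : measurableTypeR R -> R) by exact: measurable_indic.
have hI : mu.-integrable D (EFin \o (\1_B : R -> R)).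
  apply: (@integrable_stieltjes _ 1) => // s _.
  by rewrite indicE; case: (_ \in _); rewrite ?normr1 ?normr0.
have hC : mu.-integrable D (EFin \o fun=> `|C|).
  apply: (@integrable_stieltjes (fun=> `|C|) `|C|); first exact: measurable_cst.
  by move=> s _; rewrite normr_id.
have hCI : mu.-integrable D (EFin \o fun s => (- c - `|C|) * \1_B s).
  by have := integrableZl mD (- c - `|C|) hI.
have le1 : \int[mu]_(s in D) g s <= \int[mu]_(s in D) (`|C| + (- c - `|C|) * \1_B s).
  apply: le_Rintegral => //; first by have := integrableD mD hC hCI.
  move=> s; rewrite /= in_itv/= => sD; rewrite indicE.
  have [sB|sB] := boolP (s \in B).
    rewrite mulr1 addrC subrK; apply: gB => //; exact/set_mem.
  rewrite mulr0 addr0; apply: le_trans (ler_norm _) _.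
  exact: le_trans (gC s sD) (ler_norm _).
apply: le_trans le1 _.
rewrite RintegralD// RintegralZl// -hk Rintegral_cst// [X in fine X]stieltjes_itv /=.
lra.
Qed.

End stieltjes.

Lemma Rintegral_lincomb (disp : measure_display) (T : measurableType disp) (R : realType)
    (mu : {measure set T -> \bar R}) (D : set T) n (p : 'I_n -> R) (g : 'I_n -> T -> R) :
  measurable D -> (forall i, mu.-integrable D (EFin \o g i)) ->
  mu.-integrable D (EFin \o fun s => \sum_i p i * g i s) /\
  \int[mu]_(s in D) (\sum_i p i * g i s) = \sum_i p i * \int[mu]_(s in D) g i s.
Proof.
move=> mD hg.
have hp i : mu.-integrable D (fun s => (p i)%:E * (g i s)%:E)%E by exact: integrableZl (hg i).
split.
  have := @integrable_sum _ _ _ mu D mD _ (index_enum 'I_n) xpredT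
    (fun i s => (p i)%:E * (g i s)%:E)%E (fun i _ => hp i).
  by apply: eq_integrable => // s _ /=; rewrite sumEFin.
rewrite /Rintegral.
have -> : (\int[mu]_(s in D) (\sum_i p i * g i s)%:E =
    \int[mu]_(s in D) (\sum_i (p i)%:E * (g i s)%:E))%E.
  by apply: eq_integral => s _; rewrite sumEFin.
rewrite integral_sum// -sum_fine => [|i _]; last exact: integrable_fin_num (hp i).
apply: eq_bigr => i _; rewrite integralZl//; last exact: hg.
by rewrite fineM//; exact: integrable_fin_num (hg i).
Qed.

(** * Quadratic forms and the estimate on a single path *)

Section quadratic_form.
Context {R : realType} {d : nat}.
Variable H : 'M[R]_d.
Implicit Types a b : 'I_d -> R.

Definition quad a : R := \sum_i \sum_j H i j * a i * a j.

Definition abs_sum : R := \sum_i \sum_j `|H i j|.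

Lemma abs_sum_ge0 : 0 <= abs_sum.
Proof. by apply: sumr_ge0 => i _; apply: sumr_ge0. Qed.

Lemma quad_diff a b (r e : R) : (forall i, `|a i| <= r) -> (forall i, `|b i| <= r) ->
  (forall i, `|a i - b i| <= e) -> quad a - quad b <= abs_sum * (2 * r * e).
Proof.
move=> ar br ab; rewrite /quad /abs_sum -sumrB mulr_suml; apply: ler_sum => i _.
rewrite -sumrB mulr_suml; apply: ler_sum => j _.
have -> : H i j * a i * a j - H i j * b i * b j =
  H i j * (a i * (a j - b j) + (a i - b i) * b j) by ring.
apply: le_trans (ler_norm _) _; rewrite normrM ler_wpM2l//.
apply: le_trans (ler_normD _ _) _; rewrite !normrM.
have h1 := ler_pM (normr_ge0 _) (normr_ge0 _) (ar i) (ab j).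
have h2 := ler_pM (normr_ge0 _) (normr_ge0 _) (ab i) (br j).
by lra.
Qed.

Lemma quad_abs a : `|quad a| <= abs_sum * \sum_i a i ^+ 2.
Proof.
apply: le_trans (ler_norm_sum _ _ _) _; rewrite /abs_sum mulr_suml.
apply: ler_sum => i _; apply: le_trans (ler_norm_sum _ _ _) _.
rewrite mulr_suml; apply: ler_sum => j _; rewrite -mulrA normrM ler_wpM2l//.
have h k : a k ^+ 2 <= \sum_i a i ^+ 2.
  by rewrite (bigD1 k)//= lerDl sumr_ge0// => l _; exact: sqr_ge0.
have := h i; have := h j; rewrite normrM -!(real_normK (num_real (a _))).
have := sqr_ge0 (`|a i| - `|a j|); nra.
Qed.

End quadratic_form.

Section pathwise.
Context {R : realType} {d : nat}.
Notation leb := (@lebesgue_measure R).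
Variables (x0 : 'cV[R]_d) (r : R) (p : 'rV[R]_d) (H : 'M[R]_d).
Variables (f : 'cV[R]_d -> 'cV[R]_d) (q : 'cV[R]_d -> 'rV[R]_d).
Variables (psi : 'cV[R]_d -> 'rV[R]_d -> R) (xi : 'cV[R]_d -> 'rV[R]_d).
Variables (lam M a0 eps Cf Mphi c : R) (gphi : 'cV[R]_d -> 'rV[R]_d).
Variables (Bd : set 'cV[R]_d) (v : 'cV[R]_d -> R).
Variables (X : R -> 'cV[R]_d) (tau : R) (k : cumulative R R) (I : 'I_d -> R) (NZ : R).
Hypothesis tau0 : 0 <= tau.
Hypothesis cX : continuous X.
Hypothesis Xr : forall s, 0 <= s <= tau -> `|X s - x0| <= r.
Hypothesis cf : forall i, continuous (fun x => f x i 0).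
Hypothesis fC : forall x i, `|x - x0| <= r -> `|f x i 0| <= Cf.
Hypothesis cgphi : forall i, continuous (fun x => gphi x 0 i).
Hypothesis gphiM : forall x i, `|gphi x 0 i| <= Mphi.
Hypothesis mxi : measurable_wrt (borel 'cV[R]_d) xi.
Hypothesis cpsi : forall z, continuous (fun x => psi x z).
Hypothesis lpsi : forall x z z', `|psi x z - psi x z'| <= M * enorm (z - z').
Hypothesis M0 : 0 <= M.
Hypothesis drift : forall x, `|x - x0| <= r ->
  `|psi x (q x) - lam + \sum_i p 0 i * f x i 0 - a0| <= eps.
Let z s := enorm (xi (X s) - q (X s)).
Notation D := (`[0, tau]%classic : set (measurableTypeR R)).
Hypothesis mz : measurable_fun D z.
Hypothesis hz2 : leb.-integrable D (EFin \o fun s => z s ^+ 2).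
Hypothesis mBd : measurable [set s : measurableTypeR R | Bd (X s)].
Hypothesis reflect_dir : forall x, `|x - x0| <= r -> Bd x ->
  \sum_i p 0 i * gphi x 0 i <= - c.
Notation mu := (lebesgue_stieltjes_measure k).
Notation D' := (`]0, tau]%classic : set (measurableTypeR R)).
Hypothesis hk : k tau - k 0 = \int[mu]_(s in D') (\1_Bd (X s)).
Let kap := k tau - k 0.
Hypothesis kap0 : 0 <= kap.
Let J i := \int[mu]_(s in D') (gphi (X s) 0 i).
Let Fi i := \int[leb]_(s in D) (f (X s) i 0).
Hypothesis eqX : forall i, (X tau - x0) i 0 = Fi i + I i + J i.
Hypothesis eqv : v (X tau) - v x0 = - (\int[leb]_(s in D) (psi (X s) (xi (X s)) - lam)) + NZ.
(** Martingale part of [v(X)] minus that of the linear part [p] of the test function. In the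
    application it is the stochastic integral of [xi(X) - q(X)], whose norm is [z]. *)
Let N := NZ - \sum_i p 0 i * I i.
Let R1 := \int[leb]_(s in D) z s.
Let Del i := (X tau - x0) i 0.
Let pabs := \sum_i `|p 0 i|.

Let mD : measurable D. Proof. exact: measurable_itv. Qed.
Let mD' : measurable D'. Proof. exact: measurable_itv. Qed.

Let mcomp (g : 'cV[R]_d -> R) : continuous g ->
  measurable_fun setT ((g \o X) : measurableTypeR R -> R).
Proof.
move=> cg; apply: continuous_measurable_fun => s.
by apply: continuous_comp; [exact: cX|exact: cg].
Qed.

Let Xtau : `|X tau - x0| <= r. Proof. by apply: Xr; rewrite tau0 lexx. Qed.

Let F_bound i : leb.-integrable D (EFin \o fun s => f (X s) i 0) /\ `|Fi i| <= Cf * tau.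
Proof.
have [] := @Rintegral_itv_bound _ _ tau0 (fun s => f (X s) i 0) (fun=> 0) 0 Cf 0.
- exact: measurable_funTS (mcomp (@cf i)).
- exact: integrable_itv_cst.
- by move=> s sD; rewrite subr0 mul0r addr0; apply: fC; exact: Xr.
by rewrite !mul0r subr0 addr0.
Qed.

Let J_bound i : `|J i| <= Mphi * kap.
Proof. by apply: Rintegral_stieltjes_bound => //; exact: (mcomp (@cgphi i)). Qed.

Let sum_bound (a : 'I_d -> R) b : (forall i, `|a i| <= b) ->
  `|\sum_i p 0 i * a i| <= pabs * b.
Proof.
move=> ab; apply: le_trans (ler_norm_sum _ _ _) _; rewrite /pabs mulr_suml.
by apply: ler_sum => i _; rewrite normrM ler_wpM2l.
Qed.

(** The reflection measure lives on the times at which the path is in [Bd], where the direction of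
    reflection lowers the linear part at rate at least [c]. *)
Let pJ_le : \sum_i p 0 i * J i <= - c * kap.
Proof.
pose g s := \sum_i p 0 i * gphi (X s) 0 i.
have mg i : measurable_fun setT ((fun s => gphi (X s) 0 i) : measurableTypeR R -> R).
  exact: (mcomp (@cgphi i)).
have hi i : mu.-integrable D' (EFin \o fun s => gphi (X s) 0 i).
  by apply: (@integrable_stieltjes R k tau _ _ Mphi).
have -> : \sum_i p 0 i * J i = \int[mu]_(s in D') g s.
  by rewrite (Rintegral_lincomb (mu := mu) _ mD' hi).2.
apply: (@Rintegral_stieltjes_le R k tau tau0 g [set s | Bd (X s)] c (pabs * Mphi)) => //.
- by apply: measurable_sum => i; apply: measurable_funM.
- by move=> s _; apply: sum_bound => i.
- move=> s /andP[s0 sT] BX; apply: reflect_dir => //; apply: Xr.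
  by rewrite (ltW s0).
Qed.

(** Replacing [xi] by [q] in the driver costs [M z] by the Lipschitz condition; after that the drift
    is within [eps] of the constant [a0]. *)
Let A_bound : leb.-integrable D (EFin \o z) /\
  `|\int[leb]_(s in D) (psi (X s) (xi (X s)) - lam) + \sum_i p 0 i * Fi i - a0 * tau|
    <= eps * tau + M * R1.
Proof.
have [hz _ _ _] := Rintegral_itv_sqr tau0 mz (fun s => enorm_ge0 _) hz2.
split => //.
pose g s := psi (X s) (xi (X s)) - lam.
pose g' s := g s + \sum_i p 0 i * f (X s) i 0.
have mpsi : measurable_fun D (fun s => psi (X s) (xi (X s))).
  apply: measurable_funS (measurable_psi_path cX mxi cpsi lpsi) => //.
  by move=> s; rewrite /= !in_itv/= => /andP[->].
have mg' : measurable_fun D g'.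
  apply: measurable_funD; first by apply: measurable_funB => //; exact: measurable_cst.
  apply: measurable_sum => i; apply: measurable_funM; first exact: measurable_cst.
  exact: measurable_funTS (mcomp (@cf i)).
have bd s : 0 <= s <= tau -> `|g' s - a0| <= eps + M * z s.
  move=> sD; have h1 := drift (Xr sD); have h2 := lpsi (X s) (xi (X s)) (q (X s)).
  rewrite /g' /g; move: h1 h2; rewrite -/(z s).
  set u := psi _ (q _); set w := psi _ _; set S := \sum_i _ => h1 h2.
  have -> : w - lam + S - a0 = (u - lam + S - a0) + (w - u) by ring.
  by apply: le_trans (ler_normD _ _) _; rewrite lerD.
have [hg' le'] := Rintegral_itv_bound tau0 mg' hz bd.
have [hf Ef] := Rintegral_lincomb (mu := leb) (p 0) mD (fun i => (F_bound i).1).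
have Eg : \int[leb]_(s in D) g s + \sum_i p 0 i * Fi i = \int[leb]_(s in D) g' s.
  have hg : leb.-integrable D (EFin \o g).
    have := integrableB mD hg' hf; apply: eq_integrable => // s _ /=.
    by rewrite -EFinB /g' addrK.
  by rewrite /g' RintegralD// Ef.
by rewrite -/(g _) Eg.
Qed.

Let NE : N = v (X tau) - v x0 - \sum_i p 0 i * Del i +
  (\int[leb]_(s in D) (psi (X s) (xi (X s)) - lam) + \sum_i p 0 i * Fi i) +
  \sum_i p 0 i * J i.
Proof.
have -> : \sum_i p 0 i * Del i = \sum_i p 0 i * Fi i + \sum_i p 0 i * I i + \sum_i p 0 i * J i.
  by rewrite -!big_split/=; apply: eq_bigr => i _; rewrite /Del eqX; ring.
by rewrite eqv /N; ring.
Qed.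

(** In the Taylor bound the displacement [Del] is replaced by its martingale part [I]. The
    difference is at most [b = Cf tau + Mphi kap] while both are of size [r], so for small [r] the
    second-order terms change by at most [eps tau + c kap]; the part in [kap] is paid for by the
    gain [- c kap] from the reflection. *)
Lemma pathwise_upper :
  v (X tau) - v x0 <= \sum_i p 0 i * Del i + 2^-1 * quad H Del + eps * `|X tau - x0| ^+ 2 ->
  (forall i, `|I i| <= r) -> 0 <= eps -> 0 <= r ->
  (abs_sum H + 2 * eps * d%:R) * r * Cf <= eps ->
  (abs_sum H + 2 * eps * d%:R) * r * Mphi <= c ->
  N <= 2^-1 * quad H I + eps * (\sum_i I i ^+ 2) + (a0 + 2 * eps) * tau + M * R1.
Proof.
move=> hv Ir eps0 r0 hCf hMphi.
have [_ hA] := A_bound.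
pose b := Cf * tau + Mphi * kap.
have DI i : `|Del i - I i| <= b.
  have -> : Del i - I i = Fi i + J i by rewrite /Del eqX; ring.
  by apply: le_trans (ler_normD _ _) _; apply: lerD; [case: (F_bound i)|exact: J_bound].
have Dr i : `|Del i| <= r by apply: le_trans Xtau; exact: coord_le_mx_norm.
have hQ := quad_diff H Dr Ir DI.
have hS : `|X tau - x0| ^+ 2 <= \sum_i I i ^+ 2 + d%:R * (2 * r * b).
  apply: (@le_trans _ _ (\sum_i Del i ^+ 2)).
    rewrite -enorm_colE lerXn2r ?nnegrE ?enorm_ge0//; exact: mx_norm_le_enorm.
  apply: (@le_trans _ _ (\sum_(i < d) (I i ^+ 2 + 2 * r * b))); last first.
    by rewrite big_split/= sumr_const card_ord -[_ *+ d]mulr_natl.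
  apply: ler_sum => i _; rewrite -lerBlDl.
  have -> : Del i ^+ 2 - I i ^+ 2 = (Del i + I i) * (Del i - I i) by ring.
  apply: le_trans (ler_norm _) _; rewrite normrM; apply: ler_pM => //.
  by apply: le_trans (ler_normD _ _) _; have := Dr i; have := Ir i; lra.
have hSe := ler_wpM2l eps0 hS.
have hA' := le_trans (ler_norm _) hA.
set A := _ + \sum_i _ in hA'; set S := \sum_i I i ^+ 2 in hS hSe *.
set QD := quad H Del in hQ hv; set QI := quad H I in hQ *.
have N1 : N <= 2^-1 * QD + eps * `|X tau - x0| ^+ 2 + A + - c * kap.
  rewrite NE -/A; have := pJ_le; lra.
have t1 := ler_wpM2r tau0 hCf; have t2 := ler_wpM2r kap0 hMphi.
have E : abs_sum H * (2 * r * b) / 2 + eps * (d%:R * (2 * r * b)) <= eps * tau + c * kap.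
  apply: le_trans (lerD t1 t2); rewrite /b le_eqVlt; apply/orP; left; apply/eqP.
  by field.
lra.
Qed.

(** Crude and two-sided: in [NE] the increment of [v], the linear term, the constant drift and the
    reflection each contribute at most [eta / 4]. *)
Lemma pathwise_bound (eta T : R) : tau <= T -> 0 <= eps -> kap <= r -> 0 <= Mphi ->
  `|v (X tau) - v x0| <= eta / 4 -> pabs * r <= eta / 4 ->
  (`|a0| + eps) * T <= eta / 4 -> pabs * Mphi * r <= eta / 4 ->
  `|N| <= eta + M * R1.
Proof.
move=> tT eps0 kr Mp hv hp hT hM.
have [_ hA] := A_bound.
have Dr i : `|Del i| <= r by apply: le_trans Xtau; exact: coord_le_mx_norm.
have hD := sum_bound Dr; have hJ := sum_bound J_bound.
have pa : 0 <= pabs by apply: sumr_ge0.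
set A := _ + \sum_i p 0 i * Fi i in hA.
have hA' : `|A| <= `|a0| * tau + eps * tau + M * R1.
  have := ler_normD (A - a0 * tau) (a0 * tau); rewrite subrK normrM (ger0_norm tau0).
  by move=> /le_trans; apply; lra.
have aT : (`|a0| + eps) * tau <= eta / 4.
  by apply: le_trans hT; rewrite ler_wpM2l// addr_ge0.
have kM : pabs * (Mphi * kap) <= eta / 4.
  by apply: le_trans hM; rewrite mulrA ler_wpM2l// mulr_ge0.
rewrite NE -/A.
apply: le_trans (ler_normD _ _) _.
apply: le_trans (lerD (ler_normD _ _) (lexx _)) _.
apply: le_trans (lerD (lerD (ler_normB _ _) (lexx _)) (lexx _)) _.
lra.
Qed.

End pathwise.

(** * Expectations and the contradiction *)

Section endgame.
Context {R : realType} {d : nat} {disp : measure_display}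
  {Omega : measurableType disp} (P : probability Omega R).

Lemma le_Exp_ae (f g : Omega -> R) : igr P f -> igr P g ->
  {ae P, forall w, f w <= g w} -> Exp P f <= Exp P g.
Proof.
move=> hf hg fg.
have hd : igr P (fun w => f w - g w) by apply: igrD => //; exact: igrN.
have md := igr_measurable hd.
pose h w := Num.max 0 (f w - g w).
have mh : measurable_fun setT h by apply: measurable_maxr.
have h0 : {ae P, forall w, h w = 0}.
  apply: filterS fg => w fgw; rewrite /h; apply/max_idPl; by rewrite subr_le0.
have [hh Eh] := igr_ae0 mh h0.
have : Exp P (fun w => f w - g w) <= Exp P h.
  by apply: le_Exp => // w; rewrite /h le_max lexx orbT.
by rewrite ExpB// Eh subr_le0.
Qed.

Variables (H S : 'M[R]_d) (M F a0 eps eps' eta T : R).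
Variables (tau N R1 R2 : Omega -> R) (I : 'I_d -> Omega -> R).
Let Hs := abs_sum H.
Let A := \sum_i S i i.
(** Coefficient of [T] in the bound [absN] on the first absolute moment of [N]. *)
Let C2 := (Hs + 2) * (A + d%:R) + 2 * (`|a0| + 2) + M.
Hypothesis M1 : 1 <= M.
Hypothesis T0 : 0 < T.
Hypothesis F0 : 0 < F.
Hypothesis a0F : a0 + 2^-1 * \sum_i \sum_j H i j * S i j = - F.
Hypothesis eps01 : 0 <= eps <= 1.
Hypothesis eps'01 : 0 <= eps' <= 1.
Hypothesis epsF : Hs * eps' + 2 * eps * (A + d%:R + 2) <= F / 4.
Hypothesis S0 : forall i, 0 <= S i i.
Hypothesis eta0 : 0 <= eta.
Hypothesis etaM : eta * M <= 1 / 8.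
Hypothesis MT : M ^+ 2 * T <= 1 / 8.
Hypothesis etaF : 32 * M ^+ 2 * eta * C2 < 3 * F ^+ 2.
Hypothesis mtau : measurable_fun setT tau.
Hypothesis tau0T : forall w, 0 <= tau w <= T.
Hypothesis Etau : T / 2 <= Exp P tau.
Hypothesis sN : sqi P N.
Hypothesis EN : Exp P N = 0.
Hypothesis sI : forall i, sqi P (I i).
Hypothesis EI : forall i j,
  `|Exp P (fun w => I i w * I j w) - S i j * Exp P tau| <= eps' * Exp P tau.
Hypothesis hR2 : igr P R2.
Hypothesis EN2 : Exp P (fun w => N w ^+ 2) = Exp P R2.
Hypothesis hae : {ae P, forall w,
  [/\ N w <= 2^-1 * quad H (I^~ w) + eps * (\sum_i I i w ^+ 2) +
        (a0 + 2 * eps) * tau w + M * R1 w,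
      `|N w| <= eta + M * R1 w,
      (forall th, 0 < th -> 2 * R1 w <= th * tau w + th^-1 * R2 w)
    & R1 w ^+ 2 <= tau w * R2 w] /\ 0 <= R1 w /\ 0 <= R2 w}.

Let e := Exp P tau.
Let a2 := Exp P R2.
Let M0 : 0 < M. Proof. exact: lt_le_trans M1. Qed.

Let htau : igr P tau.
Proof.
apply: (@igr_bounded _ _ _ P T tau) => // w; case/andP: (tau0T w) => t0 tT.
by rewrite ger0_norm.
Qed.

Let e0T : 0 <= e <= T.
Proof.
apply/andP; split; first by apply: Exp_ge0 => w; case/andP: (tau0T w).
rewrite -(Exp_cst P T); apply: le_Exp => //; first exact: igr_cst.
by move=> w; case/andP: (tau0T w).
Qed.

Let hII i j : igr P (fun w => I i w * I j w). Proof. exact: sqiM_igr. Qed.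

Let ES : Exp P (fun w => \sum_i I i w ^+ 2) <= (A + d%:R) * e.
Proof.
rewrite Exp_sum => [|i]; last by case: (sI i).
have -> : (A + d%:R) * e = \sum_i (S i i * e + e).
  by rewrite big_split/= sumr_const card_ord -mulr_suml -[e *+ d]mulr_natl mulrDl.
apply: ler_sum => i _.
have /(le_trans (ler_norm _)) := EI i i.
rewrite -/e -lerBlDl; under eq_Rintegral do rewrite -expr2.
move=> /le_trans; apply; case/andP: e0T => e0 _; case/andP: eps'01 => _ h.
by rewrite ler_piMl.
Qed.

Let hS : igr P (fun w => \sum_i I i w ^+ 2).
Proof. by apply: igr_sum => i; case: (sI i). Qed.

Let hquad : igr P (fun w => quad H (I^~ w)).
Proof.
apply: igr_sum => i; apply: igr_sum => j.
have := igrZ (H i j) (hII i j); apply: eq_integrable => // w _ /=.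
by rewrite mulrA.
Qed.

Let Equad : Exp P (fun w => quad H (I^~ w)) <=
  (\sum_i \sum_j H i j * S i j) * e + Hs * eps' * e.
Proof.
rewrite Exp_sum => [|i]; last first.
  apply: igr_sum => j; have := igrZ (H i j) (hII i j).
  by apply: eq_integrable => // w _ /=; rewrite mulrA.
rewrite /Hs /abs_sum -mulrA !mulr_suml -big_split/=; apply: ler_sum => i _.
rewrite Exp_sum => [|j]; last first.
  have := igrZ (H i j) (hII i j).
  by apply: eq_integrable => // w _ /=; rewrite mulrA.
rewrite !mulr_suml -big_split/=; apply: ler_sum => j _.
under eq_Rintegral do rewrite -mulrA.
rewrite ExpZ// -mulrA -lerBlDl -mulrBr; apply: le_trans (ler_norm _) _.
by rewrite normrM ler_wpM2l//; exact: EI.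
Qed.

(** Expectation of the pathwise upper bound, with [R1] split by Young's inequality; the left side is
    the mean of [N]. *)
Let upper th : 0 < th ->
  0 <= 2^-1 * Exp P (fun w => quad H (I^~ w)) + eps * Exp P (fun w => \sum_i I i w ^+ 2)
    + (a0 + 2 * eps) * e + M / 2 * (th * e + th^-1 * a2).
Proof.
move=> th0.
have h1 := igrZ 2^-1 hquad; have h2 := igrZ eps hS.
have h3 := igrZ (a0 + 2 * eps) htau.
have h4 := igrZ (M / 2) (igrD (igrZ th htau) (igrZ th^-1 hR2)).
have h12 := igrD h1 h2; have h123 := igrD h12 h3; have h := igrD h123 h4.
suff : Exp P N <= Exp P (fun w => 2^-1 * quad H (I^~ w) + eps * (\sum_i I i w ^+ 2) +
    (a0 + 2 * eps) * tau w + M / 2 * (th * tau w + th^-1 * R2 w)).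
  rewrite EN !ExpD// !ExpZ//; last by apply: igrD; exact: igrZ.
  by rewrite ExpD ?ExpZ//; exact: igrZ.
apply: le_Exp_ae => //; first exact: sqi_igr.
apply: filterS hae => w [[hU _ hR _] _].
by have := ler_wpM2l (ltW M0) (hR th th0); lra.
Qed.

(** Since [|N| = 2 N^+ - N] and [N] has mean 0, the one-sided pathwise bound controls the absolute
    moment. Here [R1] is bounded with the parameter 1, by half of [tau + R2]. *)
Let absN : Exp P (fun w => `|N w|) <= C2 * T + M * a2.
Proof.
have hN := sqi_igr sN.
have haN : igr P (fun w => `|N w|) by have := integrable_norm hN.
have h1 := igrZ (Hs + 2 * eps) hS; have h2 := igrZ (2 * (`|a0| + 2 * eps)) htau.
have h3 := igrZ M (igrD htau hR2); have h4 := igrN hN.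
have h12 := igrD h1 h2; have h123 := igrD h12 h3; have h := igrD h123 h4.
case/andP: e0T => e0 eT; case/andP: eps01 => ep0 ep1.
have Hs0 : 0 <= Hs := abs_sum_ge0 H.
have A0 : 0 <= A by apply: sumr_ge0.
have Ad0 : 0 <= A + d%:R by rewrite addr_ge0.
apply: (@le_trans _ _ (Exp P (fun w => (Hs + 2 * eps) * (\sum_i I i w ^+ 2) +
   2 * (`|a0| + 2 * eps) * tau w + M * (tau w + R2 w) + - N w))).
  apply: le_Exp_ae => //; apply: filterS hae => w [[hU _ hR _] [r10 r20]].
  have := hR 1 ltr01; rewrite invr1 !mul1r => hR1.
  have hq := le_trans (ler_norm _) (quad_abs H (I^~ w)).
  have MR := ler_wpM2l (ltW M0) hR1.
  case/andP: (tau0T w) => t0 tT.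
  have S0' : 0 <= \sum_i I i w ^+ 2 by apply: sumr_ge0 => i _; exact: sqr_ge0.
  have ha := ler_wpM2r t0 (ler_norm a0).
  have u1 : 0 <= Hs * \sum_i I i w ^+ 2 by exact: mulr_ge0.
  have u2 : 0 <= eps * \sum_i I i w ^+ 2 by exact: mulr_ge0.
  have u3 : 0 <= `|a0| * tau w by exact: mulr_ge0.
  have u4 : 0 <= eps * tau w by exact: mulr_ge0.
  have u5 : 0 <= M * R1 w by apply: mulr_ge0 => //; exact: ltW.
  rewrite -/Hs in hq.
  by case: (lerP 0 (N w)) => n0; rewrite ?(ger0_norm n0) ?(ltr0_norm n0); lra.
rewrite (ExpD h123 h4) (ExpD h12 h3) (ExpD h1 h2) !ExpZ//; last exact: igrD.
rewrite ExpD// ExpN// EN oppr0 addr0 -/e -/a2.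
have b1 : (Hs + 2 * eps) * Exp P (fun w => \sum_i I i w ^+ 2) <= (Hs + 2) * (A + d%:R) * T.
  apply: le_trans (ler_wpM2l _ ES) _; first by lra.
  rewrite mulrA ler_pM//; first by apply: mulr_ge0 => //; lra.
  by rewrite ler_wpM2r//; lra.
have b2 : 2 * (`|a0| + 2 * eps) * e <= 2 * (`|a0| + 2) * T.
  by apply: ler_pM => //; have := normr_ge0 a0; lra.
have b3 := ler_wpM2l (ltW M0) eT.
by rewrite /C2; lra.
Qed.

(** One has [N^2 <= |N| (eta + M R1)]. The product of [|N|] and [M R1] is at most
    [N^2 / 4 + M^2 R1^2], and [R1^2 <= T R2]. As [N^2] and [R2] have the same expectation [a2], this
    gives [3/4 a2 <= eta E|N| + M^2 T a2]; with [absN], the two multiples of [a2] on the right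
    amount to at most [a2 / 4]. *)
Let a2_small : a2 <= 2 * eta * C2 * T.
Proof.
have hN := sqi_igr sN; have [_ hN2] := sN.
have haN : igr P (fun w => `|N w|) by have := integrable_norm hN.
have : Exp P (fun w => 3 / 4 * N w ^+ 2) <= Exp P (fun w => eta * `|N w| + M ^+ 2 * T * R2 w).
  apply: le_Exp_ae; [exact: igrZ|by apply: igrD; exact: igrZ|].
  apply: filterS hae => w [[_ hB _ hR] [r10 r20]].
  case/andP: (tau0T w) => t0 tT.
  have hR' : R1 w ^+ 2 <= T * R2 w by apply: le_trans hR _; exact: ler_wpM2r.
  have h1 := ler_wpM2l (normr_ge0 (N w)) hB.
  have h2 := ler_wpM2l (sqr_ge0 M) hR'.
  have h3 := sqr_ge0 (`|N w| / 2 - M * R1 w).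
  rewrite -(real_normK (num_real (N w))); lra.
rewrite ExpZ// ExpD; [|exact: igrZ|exact: igrZ].
rewrite ExpZ// ExpZ// EN2 -/a2 => h.
have a20 : 0 <= a2 by rewrite /a2 -EN2; apply: Exp_ge0 => w; exact: sqr_ge0.
have h1 := ler_wpM2l eta0 absN; have h2 := ler_wpM2r a20 etaM; have h3 := ler_wpM2r a20 MT.
lra.
Qed.

Lemma endgame : False.
Proof.
(* This value makes the [tau] part of the Young term equal to [F / 8] times [e]. With the error
   terms of [epsF], also at most [F / 8] times [e], there remains [3/4 F e <= 2 M^2 / F a2], to be
   compared with [e >= T / 2] and [a2_small]. *)
pose th := F / (4 * M).
have th0 : 0 < th by rewrite divr_gt0// mulr_gt0.
have := upper th0.
case/andP: e0T => e0 eT; case/andP: eps01 => ep0 ep1; case/andP: eps'01 => ep'0 ep'1.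
have h1 := ler_wpM2l ep0 ES; have h2 := Equad.
have h3 := ler_wpM2r e0 epsF.
have h4 : (a0 + 2^-1 * \sum_i \sum_j H i j * S i j) * e = - F * e by rewrite a0F.
have -> : M / 2 * (th * e + th^-1 * a2) = F / 8 * e + 2 * M ^+ 2 / F * a2.
  by rewrite /th; field; rewrite !gt_eqF.
move=> h5.
have h6 : 3 / 4 * F * e <= 2 * M ^+ 2 / F * a2.
  move: h1 h2 h3 h4 h5; set s := Exp P _; set q := Exp P _; lra.
have h7 : 3 / 8 * F * T <= 2 * M ^+ 2 / F * a2.
  apply: le_trans h6; have := ler_wpM2l (ltW F0) Etau; rewrite -/e; lra.
have h8 : 2 * M ^+ 2 / F * a2 <= 2 * M ^+ 2 / F * (2 * eta * C2 * T).
  by rewrite ler_wpM2l// mulr_ge0 ?invr_ge0 ?(ltW F0)// mulr_ge0// sqr_ge0.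
have := le_trans h7 h8.
have -> : 2 * M ^+ 2 / F * (2 * eta * C2 * T) = 4 * M ^+ 2 * eta * C2 * T / F.
  by field; rewrite gt_eqF.
rewrite ler_pdivlMr//.
have -> : 3 / 8 * F * T * F = (3 / 8 * F ^+ 2) * T by ring.
rewrite ler_pM2r//; move: etaF; lra.
Qed.

End endgame.

(** * Stopped time integrals and covariances *)

Section stopped_fubini.
Context {R : realType} {disp : measure_display}
  {Omega : measurableType disp} (P : probability Omega R).
Notation leb := (@lebesgue_measure R).
Variables (T : R) (tau : Omega -> R).
Hypothesis mtau : measurable_fun setT tau.
Hypothesis tau0T : forall w, 0 <= tau w <= T.

Lemma integrable_itv_obnd_cbnd (a b : R) (f : measurableTypeR R -> R) :
  leb.-integrable `]a, b] (EFin \o f) -> leb.-integrable `[a, b] (EFin \o f).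
Proof.
move/integrableP => [mf ff]; apply/integrableP; split.
  exact/emeasurable_fun_itv_obnd_cbndP.
by rewrite -integral_itv_obnd_cbnd//; exact: measurableT_comp.
Qed.

(** Fubini for the integrand cut at [tau]. For almost every [w] the section is integrable and its
    real integral agrees with the extended one; the left endpoint is then added, being
    Lebesgue-null. *)
Lemma stopped_fubini (g : R -> Omega -> R) :
  igr (PT P) (fun p => \1_(`]0, T]) p.2 * g p.2 p.1) ->
  [/\ igr (PT P) (fun p => \1_(`]0, tau p.1]) p.2 * g p.2 p.1),
     igr P (fun w => \int[leb]_(s in `]0, tau w]) g s w),
    Exp (PT P) (fun p => \1_(`]0, tau p.1]) p.2 * g p.2 p.1) =
      Exp P (fun w => \int[leb]_(s in `]0, tau w]) g s w)
   & {ae P, forall w, leb.-integrable `[0, tau w] (EFin \o fun s => g s w) /\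
        \int[leb]_(s in `]0, tau w]) g s w = \int[leb]_(s in `[0, tau w]) g s w}].
Proof.
move=> hg; pose F (p : Omega * measurableTypeR R) := \1_(`]0, tau p.1]) p.2 * g p.2 p.1.
have FE p : F p = \1_(`]0, tau p.1]) p.2 * (\1_(`]0, T]) p.2 * g p.2 p.1).
  rewrite /F mulrA !indicE !mem_setE !in_itv/=; have /andP[_ tT] := tau0T p.1.
  case: (ltP 0 p.2) => //= [s0|_]; last by rewrite !mul0r.
  case: (leP p.2 (tau p.1)) => [st|_]; last by rewrite !mul0r.
  by rewrite (le_trans st tT) mulr1.
have hg' : igr (PT P) (fun p => `|\1_(`]0, T]) p.2 * g p.2 p.1|).
  by have := integrable_norm hg.
have hF : igr (PT P) F.
  apply: (@igr_le _ _ _ (PT P) F _ _ hg').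
    rewrite (_ : F = fun p => \1_(`]0, tau p.1]) p.2 * (\1_(`]0, T]) p.2 * g p.2 p.1)).
      apply: measurable_funM; last exact: igr_measurable hg.
      exact: (measurable_indic_stop (a := fun=> 0)).
    exact/funext.
  move=> p; rewrite FE normrM ler_piMl// indicE.
  by case: (_ \in _); rewrite ?normr1 ?normr0.
have E w : (EFin \o (fun s => F (w, s))) = ((EFin \o g^~ w) \_ `]0, tau w]).
  apply/funext => s; rewrite /F/= patchE indicE.
  by case: (_ \in _); rewrite ?mul1r ?mul0r.
have ae1 : {ae P, forall w, leb.-integrable `]0, tau w] (EFin \o fun s => g s w)}.
  have := ae_integrable1 hF; apply: filterS => w hw.
  apply: (@integrable_mkcond _ (measurableTypeR R) R leb `]0, tau w] _ _).2.
    exact: measurable_itv.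
  by rewrite -E.
have h1 := integrable_fubini_F hF.
have Eint w : fine (fubini_F leb (EFin \o F) w) = \int[leb]_(s in `]0, tau w]) g s w.
  rewrite /Rintegral [in RHS]integral_mkcond; congr fine; rewrite /fubini_F.
  by apply: eq_integral => s _; rewrite -E.
have h2 : ae_eq P setT (EFin \o fun w => \int[leb]_(s in `]0, tau w]) g s w)
    (fubini_F leb (EFin \o F)).
  apply: filterS ae1 => w hw _ /=; rewrite -Eint fineK//.
  rewrite /fubini_F; have := @integrable_fin_num _ (measurableTypeR R) R leb _ (measurable_itv _) _ hw.
  rewrite integral_mkcond; congr (_ \is a fin_num).
  by apply: eq_integral => s _; rewrite -E.
have m2 : measurable_fun setT (EFin \o fun w => \int[leb]_(s in `]0, tau w]) g s w).
  rewrite (_ : (fun w => _) = fine \o fubini_F leb (EFin \o F)); last first.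
    by apply/funext => w /=; rewrite Eint.
  apply/measurable_EFinP; apply: measurableT_comp; first exact: fine_measurable.
  exact: measurable_int h1.
split => //.
- apply/integrableP; split => //.
  have /integrableP[m1 f1] := h1; rewrite (ae_eq_integral (abse \o fubini_F leb (EFin \o F)))//.
  + exact: measurableT_comp.
  + exact: measurableT_comp.
  + by apply: filterS h2 => w h _ /=; rewrite -h.
- rewrite /Rintegral; congr fine.
  rewrite -(integral12_prod_meas1 hF); apply: ae_eq_integral => //.
  + exact: measurable_int h1.
  + by apply: filterS h2 => w h _; exact: esym (h _).
- apply: filterS ae1 => w hw; split; first exact: integrable_itv_obnd_cbnd.
  by rewrite Rintegral_itv_obnd_cbnd.
Qed.

End stopped_fubini.

Section stopped_integrals.
Context {R : realType} {d : nat} {disp : measure_display}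
  {Omega : measurableType disp} (P : probability Omega R).
Notation leb := (@lebesgue_measure R).
Variable W : R -> Omega -> 'cV[R]_d.
Hypothesis hP : measure_is_complete P.
Hypothesis hW : brownian P W.
Implicit Types (Z : R -> Omega -> 'rV[R]_d) (N : R -> Omega -> R).

Definition path_continuous N : Prop :=
  (forall w, {within `[0, +oo[, continuous (fun t => N t w)}) /\ forall w, N 0 w = 0.

(** Quantified over all pairs because it is applied to several integrals and, for polarization, to
    their sums. *)
Definition ito_isometry_at (tau : Omega -> R) : Prop := forall Z N,
  ito_pair P W Z N -> path_continuous N ->
  [/\ sqi P (fun w => N (tau w) w), Exp P (fun w => N (tau w) w) = 0 &
      Exp P (fun w => N (tau w) w ^+ 2) =
        Exp (PT P) (fun p => \1_(`]0, tau p.1]) p.2 * enorm (Z p.2 p.1) ^+ 2)].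

Lemma ito_pair_lincomb n (p : 'I_n -> R) Z N (Zi : 'I_n -> R -> Omega -> 'rV[R]_d)
    (Ni : 'I_n -> R -> Omega -> R) :
  ito_pair P W Z N -> path_continuous N ->
  (forall i, ito_pair P W (Zi i) (Ni i) /\ path_continuous (Ni i)) ->
  ito_pair P W (fun s w => Z s w + \sum_i p i *: Zi i s w)
     (fun s w => N s w + \sum_i p i * Ni i s w) /\
  path_continuous (fun s w => N s w + \sum_i p i * Ni i s w).
Proof.
move=> hZ cN hi; elim: (index_enum _) => [|i s [ih ch]].
  have -> : (fun s w => Z s w + \sum_(i <- [::]) p i *: Zi i s w) = Z.
    by apply/funext => s; apply/funext => w; rewrite big_nil addr0.
  have -> : (fun s w => N s w + \sum_(i <- [::]) p i * Ni i s w) = N => //.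
  by apply/funext => s; apply/funext => w; rewrite big_nil addr0.
have -> : (fun s0 w => Z s0 w + \sum_(j <- i :: s) p j *: Zi j s0 w) =
   (fun s0 w => p i *: Zi i s0 w + (Z s0 w + \sum_(j <- s) p j *: Zi j s0 w)).
  by apply/funext => s0; apply/funext => w; rewrite big_cons addrCA.
have -> : (fun s0 w => N s0 w + \sum_(j <- i :: s) p j * Ni j s0 w) =
   (fun s0 w => p i * Ni i s0 w + (N s0 w + \sum_(j <- s) p j * Ni j s0 w)).
  by apply/funext => s0; apply/funext => w; rewrite big_cons addrCA.
have [hi1 [ci1 ci0]] := hi i.
split; first exact: ito_pairD.
split=> w; last by have [_ ch0] := ch; rewrite ci0 ch0 mulr0 addr0.
move=> t; apply: cvgD; last by have [ch1 _] := ch; exact: ch1.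
by apply: cvgM; [exact: cvg_cst|exact: ci1].
Qed.

Variables (T : R) (tau : Omega -> R).
Hypothesis mtau : measurable_fun setT tau.
Hypothesis tau0T : forall w, 0 <= tau w <= T.
Hypothesis hiso : ito_isometry_at tau.

(** Polarization: the isometry is used for the two integrals and for their sum, and the squares are
    subtracted. *)
Lemma stopped_covariance Z1 N1 Z2 N2 :
  ito_pair P W Z1 N1 -> path_continuous N1 ->
  ito_pair P W Z2 N2 -> path_continuous N2 ->
  let C w := \int[leb]_(s in `]0, tau w]) inner (Z1 s w) (Z2 s w) in
  [/\ igr P C, Exp P (fun w => N1 (tau w) w * N2 (tau w) w) = Exp P C
   & {ae P, forall w, leb.-integrable `[0, tau w] (EFin \o fun s => inner (Z1 s w) (Z2 s w)) /\
       C w = \int[leb]_(s in `[0, tau w]) inner (Z1 s w) (Z2 s w)}].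
Proof.
move=> h1 c1 h2 c2 C.
have hq Z Z' N N' : ito_pair P W Z N -> ito_pair P W Z' N' ->
   igr (PT P) (fun p => \1_(`]0, T]) p.2 * inner (Z p.2 p.1) (Z' p.2 p.1)).
  move=> hZ hZ'; have : igr (PT P) (fun p => \sum_j
     (\1_(`]0, T]) p.2 * Z p.2 p.1 0 j) * (\1_(`]0, T]) p.2 * Z' p.2 p.1 0 j)).
    by apply: igr_sum => j; apply: sqiM_igr; [exact: ito_sqi hZ T j|exact: ito_sqi hZ' T j].
  apply: eq_integrable => // p _ /=; congr EFin; rewrite inner_row mulr_sumr.
  by apply: eq_bigr => j _; rewrite indicE; case: (_ \in _); rewrite ?mul1r ?mul0r.
have [i12 iC EC aeC] := @stopped_fubini _ _ _ P T tau mtau tau0T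
  (fun s w => inner (Z1 s w) (Z2 s w)) (hq _ _ _ _ h1 h2).
split => //; rewrite -/C in EC *; rewrite -EC.
have [i11 _ _ _] := @stopped_fubini _ _ _ P T tau mtau tau0T
  (fun s w => inner (Z1 s w) (Z1 s w)) (hq _ _ _ _ h1 h1).
have [i22 _ _ _] := @stopped_fubini _ _ _ P T tau mtau tau0T
  (fun s w => inner (Z2 s w) (Z2 s w)) (hq _ _ _ _ h2 h2).
have h3 := ito_pairD hP hW 1 h1 h2.
have c3 : path_continuous (fun t w => 1 * N1 t w + N2 t w).
  case: c1 c2 => c1 c10 [c2 c20]; split=> w; last by rewrite c10 c20 mulr0 addr0.
  by move=> t; apply: cvgD; [apply: cvgM; [exact: cvg_cst|exact: c1]|exact: c2].
have [s1 _ E1] := hiso h1 c1; have [s2 _ E2] := hiso h2 c2; have [_ _ E3] := hiso h3 c3.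
have e1 : Exp P (fun w => (1 * N1 (tau w) w + N2 (tau w) w) ^+ 2) =
   Exp P (fun w => N1 (tau w) w ^+ 2) + Exp P (fun w => N2 (tau w) w ^+ 2) +
   2 * Exp P (fun w => N1 (tau w) w * N2 (tau w) w).
  have [_ q1] := s1; have [_ q2] := s2; have q12 := sqiM_igr s1 s2.
  rewrite -ExpZ// -(ExpD q1 q2) -(ExpD (igrD q1 q2) (igrZ 2 q12)).
  by apply: eq_Rintegral => w _; ring.
have e2 : Exp (PT P) (fun p => \1_(`]0, tau p.1]) p.2 * enorm (1 *: Z1 p.2 p.1 + Z2 p.2 p.1) ^+ 2) =
   Exp (PT P) (fun p => \1_(`]0, tau p.1]) p.2 * enorm (Z1 p.2 p.1) ^+ 2) +
   Exp (PT P) (fun p => \1_(`]0, tau p.1]) p.2 * enorm (Z2 p.2 p.1) ^+ 2) +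
   2 * Exp (PT P) (fun p => \1_(`]0, tau p.1]) p.2 * inner (Z1 p.2 p.1) (Z2 p.2 p.1)).
  under [X in _ = X + _ + _]eq_Rintegral do rewrite enorm_sqr.
  under [X in _ = _ + X + _]eq_Rintegral do rewrite enorm_sqr.
  rewrite -ExpZ// -(ExpD i11 i22) -(ExpD (igrD i11 i22) (igrZ 2 i12)).
  apply: eq_Rintegral => p _; rewrite scale1r enorm_sqr innerDl.
  rewrite !(innerC _ (Z1 _ _ + Z2 _ _)) !innerDl (innerC (Z2 _ _) (Z1 _ _)).
  by ring.
by move: e1; rewrite E3 e2 E1 E2 => /addrI; lra.
Qed.

End stopped_integrals.

(** * Estimates near [x0] up to a confining time *)

Section local_estimate.
Context {R : realType} {d : nat}.
Notation leb := (@lebesgue_measure R).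
Variables (x0 : 'cV[R]_d) (r : R) (p : 'rV[R]_d) (H : 'M[R]_d).
Variables (f : 'cV[R]_d -> 'cV[R]_d) (q : 'cV[R]_d -> 'rV[R]_d).
Variables (psi : 'cV[R]_d -> 'rV[R]_d -> R) (xi : 'cV[R]_d -> 'rV[R]_d).
Variables (lam M a0 eps eta Cf Mphi c T : R) (gphi : 'cV[R]_d -> 'rV[R]_d).
Variables (A Bd : set 'cV[R]_d) (v : 'cV[R]_d -> R).

(** In the application [A] is the closure of [G], [Bd] its boundary, [gphi] the gradient of [phi]
    and [q x] is [p sigma(x)]. The last five fields are the smallness conditions on [r] and [T]
    required by the two pathwise estimates. *)
Record local_data : Prop := LocalData {
  loc_f : forall i, continuous (fun x => f x i 0) ;
  loc_fC : forall x i, `|x - x0| <= r -> `|f x i 0| <= Cf ;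
  loc_gphi : forall i, continuous (fun x => gphi x 0 i) ;
  loc_gphiM : forall x i, `|gphi x 0 i| <= Mphi ;
  loc_xi : measurable_wrt (borel 'cV[R]_d) xi ;
  loc_q : forall i, continuous (fun x => q x 0 i) ;
  loc_psi : forall z, continuous (fun x => psi x z) ;
  loc_psiM : forall x z z', `|psi x z - psi x z'| <= M * enorm (z - z') ;
  loc_drift : forall x, `|x - x0| <= r ->
    `|psi x (q x) - lam + \sum_i p 0 i * f x i 0 - a0| <= eps ;
  loc_Bd : closed Bd ;
  loc_reflect : forall x, `|x - x0| <= r -> Bd x -> \sum_i p 0 i * gphi x 0 i <= - c ;
  loc_v : forall x, A x -> `|x - x0| <= r -> `|v x - v x0| <= eta / 4 ;
  loc_taylor : forall x, A x -> `|x - x0| <= r ->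
    v x - v x0 <= \sum_i p 0 i * (x - x0) i 0 + 2^-1 * quad H (fun i => (x - x0) i 0) +
      eps * `|x - x0| ^+ 2 ;
  loc_M0 : 0 <= M ; loc_eps0 : 0 <= eps ; loc_r0 : 0 <= r ; loc_Mphi0 : 0 <= Mphi ;
  loc_rCf : (abs_sum H + 2 * eps * d%:R) * r * Cf <= eps ;
  loc_rMphi : (abs_sum H + 2 * eps * d%:R) * r * Mphi <= c ;
  loc_pr : (\sum_i `|p 0 i|) * r <= eta / 4 ;
  loc_aT : (`|a0| + eps) * T <= eta / 4 ;
  loc_pMr : (\sum_i `|p 0 i|) * Mphi * r <= eta / 4 }.

Hypothesis L : local_data.
Variables (X : R -> 'cV[R]_d) (K : R -> R) (tau : R) (k : cumulative R R).
Variables (I : 'I_d -> R) (NZ : R).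
Hypothesis tau0T : 0 <= tau <= T.
Hypothesis cX : {within `[0, +oo[, continuous X}.
Hypothesis Xr : forall s, 0 <= s <= tau -> `|X s - x0| <= r.
Hypothesis AX : A (X tau).
Hypothesis kK : forall t, 0 <= t -> k t = K t.
Hypothesis K0 : K 0 = 0.
Hypothesis Kr : 0 <= K tau <= r.
Hypothesis eqX : X tau = x0 + \col_i (\int[leb]_(s in `[0, tau]) (f (X s) i 0)) + \col_i I i
  + \col_i (\int[lebesgue_stieltjes_measure k]_(s in `]0, tau]) (gphi (X s) 0 i)).
Hypothesis eqK : K tau = \int[lebesgue_stieltjes_measure k]_(s in `]0, tau]) (\1_Bd (X s)).
Hypothesis Ir : forall i, `|I i| <= r.
Hypothesis eqv : v (X tau) - v x0 =
  - (\int[leb]_(s in `[0, tau]) (psi (X s) (xi (X s)) - lam)) + NZ.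
Let zeta s := xi (X s) - q (X s).
Hypothesis hz2 : leb.-integrable `[0, tau] (EFin \o fun s => inner (zeta s) (zeta s)).
Let R2 := \int[leb]_(s in `[0, tau]) inner (zeta s) (zeta s).
Let R1 := \int[leb]_(s in `[0, tau]) enorm (zeta s).
Let N := NZ - \sum_i p 0 i * I i.

Lemma local_estimate :
  [/\ N <= 2^-1 * quad H I + eps * (\sum_i I i ^+ 2) +
        (a0 + 2 * eps) * tau + M * R1,
      `|N| <= eta + M * R1,
      (forall th, 0 < th -> 2 * R1 <= th * tau + th^-1 * R2)
    & R1 ^+ 2 <= tau * R2] /\ 0 <= R1 /\ 0 <= R2.
Proof.
have [t0 tT] := andP tau0T.
(* The pathwise lemmas ask for a path continuous on the whole line; [Y] agrees with [X] at
   nonnegative times, hence inside every integral. *)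
pose Y s := X (Num.max 0 s).
have cY : continuous Y by exact: path_extend.
have YE s : 0 <= s -> Y s = X s by move=> s0; rewrite /Y max_r.
have YD s : s \in (`[0, tau]%classic : set R) -> Y s = X s.
  by rewrite mem_setE in_itv/= => /andP[s0 _]; exact: YE.
have YD' s : s \in (`]0, tau]%classic : set R) -> Y s = X s.
  by rewrite mem_setE in_itv/= => /andP[s0 _]; apply: YE; exact: ltW.
have Yr s : 0 <= s <= tau -> `|Y s - x0| <= r.
  by move=> /andP[s0 st]; rewrite YE//; apply: Xr; rewrite s0.
pose z s := enorm (xi (Y s) - q (Y s)).
have mxi i : measurable_fun setT (fun s : measurableTypeR R => xi (Y s) 0 i).
  apply: (measurability (@RGenOpens.G R)); first exact: RGenOpens.measurableE.
  move=> _ [U [a [b ->]] <-]; rewrite setTI.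
  apply: (measurable_path_borel cY (B := xi @^-1` [set y : 'rV[R]_d | `]a, b[%classic (y 0 i)])).
  apply: (loc_xi L); apply: open_comp; last exact: interval_open.
  by move=> y _; exact: coord_continuous.
have cq i : continuous (fun x => q x 0 i) by move=> x; exact: (loc_q L).
have mq i : measurable_fun setT (fun s : measurableTypeR R => q (Y s) 0 i).
  apply: continuous_measurable_fun => s; apply: (@continuous_comp _ _ _ Y (fun x => q x 0 i)); [exact: cY|exact: cq].
have mz : measurable_fun setT (z : measurableTypeR R -> R).
  have -> : z = (fun s => Num.sqrt (\sum_i (xi (Y s) 0 i - q (Y s) 0 i) ^+ 2)).
    apply/funext => s; rewrite -[z s]ger0_norm ?enorm_ge0// -sqrtr_sqr enorm_rowE.
    by congr Num.sqrt; apply: eq_bigr => i _; rewrite !mxE.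
  apply: measurableT_comp; first exact: (@continuous_measurable_fun _ _ (@sqrt_continuous R)).
  by apply: measurable_sum => i; apply: measurable_funX; apply: measurable_funB.
have zE s : s \in (`[0, tau]%classic : set R) -> z s = enorm (zeta s).
  by move=> sD; rewrite /z /zeta YD.
have hz2' : leb.-integrable `[0, tau] (EFin \o fun s => z s ^+ 2).
  apply: eq_integrable hz2 => //.
  by move=> s sD /=; rewrite zE// enorm_sqr.
have E1 : \int[leb]_(s in `[0, tau]) z s = R1 by apply: eq_Rintegral => s /zE.
have E2 : \int[leb]_(s in `[0, tau]) (z s ^+ 2) = R2.
  by apply: eq_Rintegral => s sD; rewrite zE// enorm_sqr.
have mzD := measurable_funTS mz : measurable_fun (`[0, tau] : set (measurableTypeR R)) z.
have [_ R10 hR1 hR2] := Rintegral_itv_sqr t0 mzD (fun s => enorm_ge0 _) hz2'.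
rewrite E1 E2 in R10 hR1 hR2.
have R20 : 0 <= R2 by rewrite -E2; apply: Rintegral_ge0 => s _; exact: sqr_ge0.
have mBd : measurable [set s : measurableTypeR R | Bd (Y s)].
  apply: (measurable_path_borel cY (B := Bd)).
  rewrite -[Bd]setCK -setTD; apply: (sigma_algebraCD (G := @open _)).
  by apply: sub_sigma_algebra; exact: closed_openC (loc_Bd L).
have eqX' i : (Y tau - x0) i 0 = \int[leb]_(s in `[0, tau]) (f (Y s) i 0) + I i +
   \int[lebesgue_stieltjes_measure k]_(s in `]0, tau]) (gphi (Y s) 0 i).
  rewrite YE// eqX !mxE.
  have -> : \int[leb]_(s in `[0, tau]) (f (Y s) i 0) = \int[leb]_(s in `[0, tau]) (f (X s) i 0).
    by apply: eq_Rintegral => s sD; rewrite YD.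
  have -> : \int[lebesgue_stieltjes_measure k]_(s in `]0, tau]) (gphi (Y s) 0 i) =
     \int[lebesgue_stieltjes_measure k]_(s in `]0, tau]) (gphi (X s) 0 i).
    by apply: eq_Rintegral => s sD; rewrite YD'.
  by ring.
have eqv' : v (Y tau) - v x0 =
    - (\int[leb]_(s in `[0, tau]) (psi (Y s) (xi (Y s)) - lam)) + NZ.
  rewrite YE// eqv; congr (- _ + _).
  by apply: eq_Rintegral => s sD; rewrite YD.
have kap0 : k tau - k 0 = K tau by rewrite !kK// K0 subr0.
have hk : k tau - k 0 = \int[lebesgue_stieltjes_measure k]_(s in `]0, tau]) (\1_Bd (Y s)).
  by rewrite kap0 eqK; apply: eq_Rintegral => s sD; rewrite YD'.
have [Kt0 Ktr] := andP Kr.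
have kge0 : 0 <= k tau - k 0 by rewrite kap0.
have Xt : `|Y tau - x0| <= r by apply: Yr; rewrite t0 lexx.
have AY : A (Y tau) by rewrite YE.
split; last by split.
split => //.
- rewrite -E1; apply: (pathwise_upper t0 cY Yr (loc_f L) (loc_fC L) (loc_gphi L) (loc_gphiM L)
    (loc_xi L) (loc_psi L) (loc_psiM L) (loc_drift L) mzD hz2' mBd (loc_reflect L) hk kge0
    eqX' eqv') => //.
  + exact: (loc_taylor L AY Xt).
  + exact: loc_eps0 L.
  + exact: loc_r0 L.
  + exact: loc_rCf L.
  + exact: loc_rMphi L.
- rewrite -E1; apply: (pathwise_bound t0 cY Yr (loc_f L) (loc_fC L) (loc_gphi L) (loc_gphiM L)
    (loc_xi L) (loc_psi L) (loc_psiM L) (loc_drift L) mzD hz2' eqX' eqv' (T := T)) => //.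
  + exact: loc_eps0 L.
  + by rewrite kap0.
  + exact: loc_Mphi0 L.
  + exact: (loc_v L AY Xt).
  + exact: loc_pr L.
  + exact: loc_aT L.
  + exact: loc_pMr L.
Qed.

End local_estimate.

(** * The contradiction on a horizon, and existence of the horizon *)

Section horizon.
Context {R : realType} {d : nat} {disp : measure_display}
  {Omega : measurableType disp} (P : probability Omega R).
Notation leb := (@lebesgue_measure R).
Variable W : R -> Omega -> 'cV[R]_d.
Hypothesis hP : measure_is_complete P.
Hypothesis hW : brownian P W.
Variables (x0 : 'cV[R]_d) (r : R) (p : 'rV[R]_d) (H S : 'M[R]_d).
Variables (f : 'cV[R]_d -> 'cV[R]_d) (sigma : 'cV[R]_d -> 'M[R]_d).
Variables (psi : 'cV[R]_d -> 'rV[R]_d -> R) (xi : 'cV[R]_d -> 'rV[R]_d).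
Variables (lam M F a0 eps eps' eta Cf Mphi c T : R) (gphi : 'cV[R]_d -> 'rV[R]_d).
Variables (A Bd : set 'cV[R]_d) (v : 'cV[R]_d -> R).
Let q x := p *m sigma x.
Hypothesis L : local_data x0 r p H f q psi xi lam M a0 eps eta Cf Mphi c T gphi A Bd v.
Hypothesis sigma_close : forall x, `|x - x0| <= r -> forall i j,
  `|inner (row i (sigma x)) (row j (sigma x)) - S i j| <= eps'.
Hypothesis M1 : 1 <= M.
Hypothesis T0 : 0 < T.
Hypothesis F0 : 0 < F.
Hypothesis a0F : a0 + 2^-1 * \sum_i \sum_j H i j * S i j = - F.
Hypothesis eps01 : 0 <= eps <= 1.
Hypothesis eps'01 : 0 <= eps' <= 1.
Hypothesis epsF : abs_sum H * eps' + 2 * eps * (\sum_i S i i + d%:R + 2) <= F / 4.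
Hypothesis S0 : forall i, 0 <= S i i.
Hypothesis eta0 : 0 <= eta.
Hypothesis etaM : eta * M <= 1 / 8.
Hypothesis MT : M ^+ 2 * T <= 1 / 8.
Hypothesis etaF : 32 * M ^+ 2 * eta *
  ((abs_sum H + 2) * (\sum_i S i i + d%:R) + 2 * (`|a0| + 2) + M) < 3 * F ^+ 2.
Variables (X : R -> Omega -> 'cV[R]_d) (K : R -> Omega -> R).
Variables (NI : 'I_d -> R -> Omega -> R) (NZ : R -> Omega -> R).
Hypothesis hNI : forall i, ito_pair P W (fun s w => row i (sigma (X s w))) (NI i) /\
  path_continuous (NI i).
Hypothesis hNZ : ito_pair P W (fun s w => xi (X s w)) NZ.
Hypothesis cNZ : path_continuous NZ.
Variable tau : Omega -> R.
Hypothesis mtau : measurable_fun setT tau.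
Hypothesis tau0T : forall w, 0 <= tau w <= T.
Hypothesis hiso : ito_isometry_at P W tau.
Hypothesis Etau : T / 2 <= Exp P tau.

Definition good_path w (t : R) (k : cumulative R R) : Prop :=
  [/\ A (X t w),
      X t w = x0 + \col_i (\int[leb]_(s in `[0, t]) (f (X s w) i 0)) + \col_i NI i t w
        + \col_i (\int[lebesgue_stieltjes_measure k]_(s in `]0, t]) (gphi (X s w) 0 i)),
      K t w = \int[lebesgue_stieltjes_measure k]_(s in `]0, t]) (\1_Bd (X s w))
    & v (X t w) - v x0 =
       - (\int[leb]_(s in `[0, t]) (psi (X s w) (xi (X s w)) - lam)) + NZ t w].

Hypothesis hae : {ae P, forall w, exists k : cumulative R R,
  [/\ {within `[0, +oo[, continuous (X^~ w)},
     (forall s, 0 <= s <= tau w -> `|X s w - x0| <= r),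
     (forall t, 0 <= t -> k t = K t w),
     [/\ K 0 w = 0, 0 <= K (tau w) w <= r & forall i, `|NI i (tau w) w| <= r]
   & good_path w (tau w) k]}.

(** Feeds [endgame]. By linearity [N] is the stochastic integral of [xi(X) - p sigma(X)], which
    gives its mean and second moment at [tau]. The covariance of two components of the martingale
    part of [X] is the mean time integral of an entry of [sigma sigma^T], which stays within [eps']
    of [S i j] up to [tau]. *)
Lemma horizon_contradiction : False.
Proof.
pose Z s w := xi (X s w) - q (X s w).
pose N t w := NZ t w - \sum_i p 0 i * NI i t w.
have [hN cN] : ito_pair P W Z N /\ path_continuous N.
  have := ito_pair_lincomb hP hW (fun i => - p 0 i) hNZ cNZ hNI.
  have -> : (fun s w => xi (X s w) + \sum_i (- p 0 i) *: row i (sigma (X s w))) = Z.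
    apply/funext => s; apply/funext => w; rewrite /Z /q mulmx_sum_row -sumrN.
    by congr (_ + _); apply: eq_bigr => i _; rewrite scaleNr.
  have -> // : (fun t w => NZ t w + \sum_i (- p 0 i) * NI i t w) = N.
  apply/funext => t; apply/funext => w; rewrite /N -sumrN.
  by congr (_ + _); apply: eq_bigr => i _; rewrite mulNr.
have [sN EN _] := hiso hN cN.
have [iR ER aeR] := stopped_covariance hP hW mtau tau0T hiso hN cN hN cN.
have htau : igr P tau.
  by apply: (@igr_bounded _ _ _ P T tau) => // w; case/andP: (tau0T w) => t0 tT; rewrite ger0_norm.
have EI i j : `|Exp P (fun w => NI i (tau w) w * NI j (tau w) w) - S i j * Exp P tau| <=
    eps' * Exp P tau.
  have [hi ci] := hNI i; have [hj cj] := hNI j.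
  have [iC -> aeC] := stopped_covariance hP hW mtau tau0T hiso hi ci hj cj.
  set C := (fun w => \int[leb]_(s in `]0, tau w]) _) in iC aeC *.
  have b : {ae P, forall w, `|C w - S i j * tau w| <= eps' * tau w}.
    apply: filterS2 aeC hae => w [hint CE] [k [_ Xr _ _ _]].
    rewrite [C w]CE; have [t0 _] := andP (tau0T w).
    have mg : measurable_fun (`[0, tau w] : set (measurableTypeR R))
       (fun s => inner (row i (sigma (X s w))) (row j (sigma (X s w)))).
      by apply/measurable_EFinP; exact: measurable_int hint.
    have [] := @Rintegral_itv_bound _ _ t0 _ (fun=> 0) (S i j) eps' 0 mg (integrable_itv_cst t0 0).
      by move=> s sD; rewrite mul0r addr0; apply: sigma_close; exact: Xr.
    by rewrite mul0r addr0.
  rewrite ler_distl -mulrBl -mulrDl -!ExpZ//; apply/andP; split.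
    apply: le_Exp_ae => //; first exact: igrZ.
    by apply: filterS b => w; rewrite ler_distl mulrBl => /andP[].
  apply: le_Exp_ae => //; first exact: igrZ.
  by apply: filterS b => w; rewrite ler_distl mulrDl => /andP[].
apply: (@endgame R d _ _ P H S M F a0 eps eps' eta T tau (fun w => N (tau w) w)
  (fun w => \int[leb]_(s in `[0, tau w]) enorm (Z s w))
  (fun w => \int[leb]_(s in `]0, tau w]) inner (Z s w) (Z s w))
  (fun i w => NI i (tau w) w)) => //.
- by move=> i; have [hi ci] := hNI i; have [] := hiso hi ci.
apply: filterS2 aeR hae => w [hint ->] [k [cX Xr kK [K0 Kr NIr] [AX eqX eqK eqv]]].
exact: (local_estimate L (tau0T w) cX Xr AX kK K0 Kr eqX eqK NIr eqv hint).
Qed.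

End horizon.

Section horizon_exists.
Context {R : realType} {d : nat} {disp : measure_display}
  {Omega : measurableType disp} (P : probability Omega R).
Variable W : R -> Omega -> 'cV[R]_d.
Hypothesis hP : measure_is_complete P.
Hypothesis hW : brownian P W.
Variables (X : R -> Omega -> 'cV[R]_d) (K : R -> Omega -> R) (I : R -> Omega -> 'cV[R]_d).
Variables (NI : 'I_d -> R -> Omega -> R) (x0 : 'cV[R]_d) (r T1 : R).
Hypothesis r0 : 0 < r.
Hypothesis T10 : 0 < T1.
Hypothesis aX : adapted P W X.
Hypothesis aK : adapted P W K.
Hypothesis aI : forall i, adapted P W (fun t w => I t w i 0).
Hypothesis cNI : forall i, path_continuous (NI i).
Hypothesis hae : {ae P, forall w,
  [/\ {within `[0, +oo[, continuous (X^~ w)}, {within `[0, +oo[, continuous (K^~ w)},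
      X 0 w = x0, K 0 w = 0 & forall i t, 0 <= t -> NI i t w = I t w i 0]}.

(** Written with [I], which is adapted, and not with its continuous version [NI]; the two agree
    almost surely at all times, so on almost every path the condition is closed in time. *)
Definition confined (w : Omega) (s : R) : Prop :=
  [/\ `|X s w - x0| <= r, forall i, `|I s w i 0| <= r & K s w <= r].

Let F_closed (U : topologicalType) (Y : R -> Omega -> U) s (B : set U) : 0 <= s ->
  adapted P W Y -> closed B -> natural_filtration P W s (Y s @^-1` B).
Proof.
move=> s0 aY cB; rewrite -[B]setCK preimage_setC.
apply: (@measurableC _ (g_sigma_algebraType (filtration_gen P W s))).
exact: (aY s s0 (~` B) (closed_openC cB)).
Qed.

Let okF s : 0 <= s -> natural_filtration P W s [set w | confined w s].
Proof.
move=> s0; pose G := g_sigma_algebraType (filtration_gen P W s).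
have cl : closed [set y : R | `|y| <= r].
  apply: ((continuous_closedP (fun y : R => `|y|)).1 _ _ (@closed_le R r)) => y.
  exact: norm_continuous.
have clX : closed [set y : 'cV[R]_d | `|y - x0| <= r].
  apply: ((continuous_closedP (fun y : 'cV[R]_d => `|y - x0|)).1 _ _ (@closed_le R r)) => y.
  by have := cvg_norm (cvgB (@cvg_id _ (nbhs y)) (cvg_cst x0)); apply.
have -> : [set w | confined w s] = X s @^-1` [set y | `|y - x0| <= r] `&`
    ((\bigcap_(i in [set: 'I_d]) (fun w => I s w i 0) @^-1` [set y : R | `|y| <= r]) `&`
     K s @^-1` [set y | y <= r]).
  apply/seteqP; split => w.
    by move=> [h1 h2 h3]; split => //; split => // i _; exact: h2.
  by move=> [h1 [h2 h3]]; split => // i; exact: (h2 i).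
apply: (@measurableI _ G); first exact: F_closed.
apply: (@measurableI _ G); last exact: (F_closed s0 aK (@closed_le R r)).
apply: (@fin_bigcap_measurable _ G) => // i _; exact: (F_closed s0 (@aI i) cl).
Qed.

Let ok_near : {ae P, forall w, exists2 e : R, 0 < e & forall s, 0 <= s <= e -> confined w s}.
Proof.
apply: filterS hae => w [cX cK X0 K0 hI].
have h0 : (0 : R) <= 0 by [].
have n1 : \forall s \near within `[0, +oo[ (nbhs (0 : R)), `|X s w - x0| <= r.
  have := path_within cX h0; rewrite X0 => /cvgrPdist_le/(_ r r0).
  by apply: filterS => s; rewrite distrC.
have n2 : \forall s \near within `[0, +oo[ (nbhs (0 : R)), K s w <= r.
  have := path_within cK h0; rewrite K0 => /cvgrPdist_le/(_ r r0).
  by apply: filterS => s; rewrite sub0r normrN => /(le_trans (ler_norm _)).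
have n3 : \forall s \near within `[0, +oo[ (nbhs (0 : R)), forall i, `|NI i s w| <= r.
  apply: filter_forall => i.
  have [ci ci0] := cNI i.
  have := path_within (ci w) h0; rewrite ci0 => /cvgrPdist_le/(_ r r0).
  by apply: filterS => s; rewrite sub0r normrN.
have [e /= e0 he] := (nbhs_ballP _ _).1 (filterI n1 (filterI n2 n3)).
exists (e / 2); first by rewrite divr_gt0.
move=> s /andP[s0 se].
have sD : s \in `[0, +oo[ by rewrite in_itv/= s0.
have bs : ball 0 e s by rewrite /ball/= sub0r normrN ger0_norm//; lra.
have [h1 [h2 h3]] := he s bs sD.
by split => // i; rewrite -hI.
Qed.

(** Almost every path is confined on some interval starting at 0, so the exit time for the horizon
    [t k] equals [t k] for large [k]. By dominated convergence the mean of their ratio tends to 1,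
    and some small horizon has ratio at least [1 / 2]. *)
Lemma horizon_exists : exists (T : R) (tau : Omega -> R), [/\ 0 < T <= T1, measurable_fun setT tau,
   forall w, 0 <= tau w <= T, ito_isometry_at P W tau & T / 2 <= Exp P tau] /\
   {ae P, forall w, forall s, 0 <= s <= tau w -> confined w s}.
Proof.
pose t (k : nat) := T1 * k.+1%:R^-1.
have t0 k : 0 < t k by rewrite mulr_gt0.
have /choice[tau htau] k := stopping_time hP hW (t0 k) okF.
have tau_small : {ae P, forall w, \forall k \near \oo, tau k w = t k}.
  apply: filterS ok_near => w [e e0 he].
  have := cvg0Ml T1 (@cvg_harmonic R) => /cvgrPdist_le/(_ e e0).
  apply: filterS => k; rewrite sub0r normrN ger0_norm ?(ltW (t0 k))// => tke.
  have [_ _ _ h _] := htau k; apply: h => s /andP[s0 st]; apply: he.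
  by rewrite s0 (le_trans st).
have [k hk] : exists k, t k / 2 <= Exp P (tau k).
  pose g k w := tau k w / t k.
  have gP k w : 0 <= g k w <= 1.
    have [_ /(_ w)/andP[h1 h2] _ _ _] := htau k.
    by rewrite divr_ge0 ?(ltW (t0 k))//= ler_pdivrMr// mul1r.
  have mg k : measurable_fun setT (g k).
    by apply: measurable_funM => //; have [] := htau k.
  have [|||||_ _ H3] := @dominated_convergence _ _ _ P setT measurableT
     (fun m x => (g m x)%:E) (fun x => 1%:E) (fun x => 1%:E).
  - by move=> m; exact/measurable_EFinP.
  - exact: measurable_cst.
  - apply: filterS tau_small => w hw _; apply: cvg_EFin; first exact: nearW.
    apply: cvg_near_cst; apply: filterS hw => m /= h.
    by rewrite /g h divff// gt_eqF.
  - exact: finite_measure_integrable_cst.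
  - by apply: aeW => x m _; rewrite lee_fin; case/andP: (gP m x) => h1 h2; rewrite ger0_norm.
  have ig m : igr P (g m).
    by apply: (@igr_bounded _ _ _ P 1) => // w; case/andP: (gP m w) => h1 h2; rewrite ger0_norm.
  have : Exp P (g m) @[m --> \oo] --> (1 : R).
    apply: fine_cvg; move: H3; rewrite integral_cst// [X in (_ * X)%E]probability_setT mule1.
    by under eq_fun do rewrite -EFin_Exp//.
  move=> /cvgrPdist_le/(_ (1 / 2))[|k _ hk]; first by rewrite divr_gt0.
  exists k; have := hk k (leqnn k); rewrite /= ler_distl => /andP[_].
  have -> : Exp P (g k) = (t k)^-1 * Exp P (tau k).
    rewrite -ExpZ; last first.
      have := igrZ (t k) (ig k); apply: eq_integrable => // w _ /=.
      by rewrite /g mulrC divfK// gt_eqF.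
    by apply: eq_Rintegral => w _; rewrite /g mulrC.
  rewrite -lerBlDr ler_pdivlMl//; lra.
have [mtau tauT cl _ iso] := htau k.
exists (t k), (tau k); split.
  split => //; first by rewrite t0 /= ler_piMr ?(ltW T10)// invf_le1// ler1n.
  by move=> Z N hZ [cN N0]; exact: iso.
apply: filterS2 hae ok_near => w [cX cK X0 K0 hI] [e e0 he] s st.
apply: (cl w _ _ s st); last by apply: he; rewrite lexx ltW.
move=> u a hu ua; have a0 : 0 <= a.
  by apply: (cvgr_to_ge ua); apply: nearW => m; case: (hu m).
have u0 m : 0 <= u m by case: (hu m).
have c1 := path_cvg cX a0 u0 ua; have c2 := path_cvg cK a0 u0 ua.
split.
- apply: (cvgr_to_le (cvg_norm (cvgB c1 (cvg_cst x0)))); apply: nearW => m.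
  by case: (hu m) => _ [].
- move=> i; have [ci _] := cNI i; rewrite -hI//.
  apply: (cvgr_to_le (cvg_norm (path_cvg (ci w) a0 u0 ua))); apply: nearW => m.
  by rewrite hI//; case: (hu m) => _ [].
- apply: (cvgr_to_le c2); apply: nearW => m; by case: (hu m) => _ [].
Qed.

End horizon_exists.

Lemma cvg_sumr (R : realType) (T : Type) (F : set_system T) (FF : Filter F) (J : Type)
    (s : seq J) (g : J -> T -> R) (a : J -> R) :
  (forall j, g j x @[x --> F] --> a j) ->
  \sum_(j <- s) g j x @[x --> F] --> \sum_(j <- s) a j.
Proof.
move=> h; elim: s => [|j s ih].
  by under eq_fun do rewrite big_nil; rewrite big_nil; exact: cvg_cst.
by under eq_fun do rewrite big_cons; rewrite big_cons; apply: cvgD.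
Qed.

(** * Choice of the radius and of the time bound *)

Section local_data_small.
Context {R : realType} {d : nat}.
Variables (G : set 'cV[R]_d) (phi : 'cV[R]_d -> R).
Variables (f : 'cV[R]_d -> 'cV[R]_d) (sigma : 'cV[R]_d -> 'M[R]_d).
Variables (psi : 'cV[R]_d -> 'rV[R]_d -> R) (xi : 'cV[R]_d -> 'rV[R]_d).
Variables (lam M : R) (v chi : 'cV[R]_d -> R) (x0 : 'cV[R]_d).
Hypothesis oG : open G.
Hypothesis phi2 : is_C2 phi.
Hypothesis phiM : exists Mp : R, forall x i, `|partial i phi x| <= Mp.
Hypothesis cf : forall i, continuous (fun x => f x i 0).
Hypothesis cs : forall i j, continuous (fun x => sigma x i j).
Hypothesis cpsi : forall z, continuous (fun x => psi x z).
Hypothesis lpsi : forall x z z', `|psi x z - psi x z'| <= M * enorm (z - z').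
Hypothesis M1 : 1 <= M.
Hypothesis mxi : measurable_wrt (borel 'cV[R]_d) xi.
Hypothesis cv : continuous v.
Hypothesis chi2 : is_C2 chi.
Hypothesis locmax : \forall x \near within (closure G) (nbhs x0), v x - chi x <= v x0 - chi x0.
Let p := grad chi x0.
Let H := hess chi x0.
Let q x := p *m sigma x.
Let S := sigma x0 *m (sigma x0)^T.
Let a0 := psi x0 (q x0) - lam + \sum_i p 0 i * f x0 i 0.
Hypothesis dir : G x0 \/ inner (grad phi x0) p < 0.

Let small (a b : R) : 0 <= a -> 0 < b -> \forall s \near 0^'+, a * s <= b.
Proof.
move=> a0' b0; have h : 0 < b / (a + 1) by rewrite divr_gt0// ltr_wpDl.
near=> s; apply: (@le_trans _ _ ((a + 1) * s)).
  by rewrite ler_wpM2r// ?lerDl//; near: s; exact: nbhs_right_ge.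
by rewrite mulrC -ler_pdivlMr ?ltr_wpDl//; near: s; exact: nbhs_right_le.
Unshelve. all: by end_near. Qed.

Let cq i : continuous (fun x => q x 0 i).
Proof.
move=> x; rewrite /q; under eq_fun do rewrite mxE.
apply: (cvg_sumr (nbhs_filter x)) => j; apply: cvgM; [exact: cvg_cst|exact: cs].
Qed.

(** Two errors: with the second argument of [psi] fixed at [q x0], continuity in [x]; then the
    change from [q x0] to [q x], by the Lipschitz condition. *)
Let near_drift eps : 0 < eps -> \forall x \near x0,
  `|psi x (q x) - lam + \sum_i p 0 i * f x i 0 - a0| <= eps.
Proof.
move=> e0.
have c1 : psi x (q x0) - lam + \sum_i p 0 i * f x i 0 @[x --> x0] --> a0.
  have h1 : psi x (q x0) - lam @[x --> x0] --> psi x0 (q x0) - lam.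
    by have := cvgB (@cpsi (q x0) x0) (cvg_cst lam); apply.
  have h2 i : p 0 i * f x i 0 @[x --> x0] --> p 0 i * f x0 i 0.
    by have := cvgM (cvg_cst (p 0 i)) (@cf i x0); apply.
  have h3 := @cvg_sumr _ _ _ (nbhs_filter x0) _ (index_enum 'I_d) _ _ h2.
  by have := cvgD h1 h3; apply.
have c2 : \sum_i `|q x 0 i - q x0 0 i| @[x --> x0] --> \sum_(i < d) `|q x0 0 i - q x0 0 i|.
  apply: (cvg_sumr (nbhs_filter x0)) => i.
  by have := cvg_norm (cvgB (@cq i x0) (cvg_cst (q x0 0 i))); apply.
have s0 : \sum_(i < d) `|q x0 0 i - q x0 0 i| = 0.
  by rewrite big1// => i _; rewrite subrr normr0.
have sle z : enorm (z : 'rV[R]_d) <= \sum_i `|z 0 i|.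
  rewrite -[leRHS]ger0_norm ?sumr_ge0// -sqrtr_sqr ler_wsqrtr// -enorm_sqr enorm_rowE.
  have : forall s : seq 'I_d, \sum_(i <- s) z 0 i ^+ 2 <= (\sum_(i <- s) `|z 0 i|) ^+ 2.
    elim=> [|i s ih]; first by rewrite !big_nil expr0n.
    rewrite !big_cons -(real_normK (num_real (z 0 i))).
    have : 0 <= \sum_(j <- s) `|z 0 j| by rewrite sumr_ge0.
    have := normr_ge0 (z 0 i); move: ih; nra.
  exact.
have e2 : 0 < eps / (2 * M) by rewrite divr_gt0// mulr_gt0//; exact: lt_le_trans M1.
rewrite s0 in c2.
move/cvgrPdist_le : c1 => /(_ (eps / 2) (divr_gt0 e0 (ltr0Sn _ 1))) c1.
move/cvgrPdist_le : c2 => /(_ _ e2) c2.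
near=> x.
have h1 : `|a0 - (psi x (q x0) - lam + \sum_i p 0 i * f x i 0)| <= eps / 2 by near: x.
have h2 : `|0 - \sum_i `|q x 0 i - q x0 0 i| | <= eps / (2 * M) by near: x.
have h3 := lpsi x (q x) (q x0).
have h4 : enorm (q x - q x0) <= eps / (2 * M).
  apply: le_trans (sle _) _; move: h2; rewrite sub0r normrN => /(le_trans (ler_norm _)).
  by apply: le_trans; apply: ler_sum => i _; rewrite !mxE.
have M0 : 0 < M by exact: lt_le_trans M1.
have h5 : M * enorm (q x - q x0) <= eps / 2.
  apply: le_trans (ler_wpM2l (ltW M0) h4) _.
  by rewrite le_eqVlt; apply/orP; left; apply/eqP; field; rewrite gt_eqF.
have h6 := le_trans h3 h5; move: h1 h6; rewrite !ler_distl.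
set s := \sum_i _; set u := psi x (q x0); set w := psi x (q x); lra.
Unshelve. all: by end_near. Qed.

(** If [x0] is in the open set [G], no boundary point is near and any [c] serves; otherwise
    continuity keeps the derivative of [chi] along [grad phi] below half of its negative value. *)
Let near_reflect : exists2 c, 0 < c & \forall x \near x0,
  boundary G x -> \sum_i p 0 i * grad phi x 0 i <= - c.
Proof.
have [G0|lt0] := dir.
  exists 1 => //; have : \forall x \near x0, G x by exact: open_nbhs_nbhs.
  by apply: (@filterS _ (nbhs x0) (nbhs_filter x0)) => x Gx [_ nG]; exfalso; apply: nG; exact: open_nbhs_nbhs.
exists (- inner (grad phi x0) p / 2); first by rewrite divr_gt0// oppr_gt0.
have c1 : \sum_i p 0 i * grad phi x 0 i @[x --> x0] --> \sum_i p 0 i * grad phi x0 0 i.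
  apply: (cvg_sumr (nbhs_filter x0)) => i; apply: cvgM; first exact: cvg_cst.
  under eq_fun do rewrite mxE; rewrite mxE; have [h _] := phi2; exact: ((h i).2 x0).
have E : \sum_i p 0 i * grad phi x0 0 i = inner (grad phi x0) p.
  by rewrite inner_row; apply: eq_bigr => i _; rewrite mulrC.
rewrite E in c1.
have e0 : 0 < - inner (grad phi x0) p / 2 by rewrite divr_gt0// oppr_gt0.
move/cvgrPdist_le : c1 => /(_ _ e0); apply: (@filterS _ (nbhs x0) (nbhs_filter x0)) => x.
by rewrite ler_distl => /andP[h1 h2] _; move: h1 h2; set s := \sum_i _; lra.
Qed.

(** At a local maximum of [v - chi] the increment of [v] is at most that of [chi], so the upper
    Taylor bound passes from [chi] to [v]; [v] itself need not be differentiable. *)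
Let near_taylor eps : 0 < eps -> \forall x \near x0, closure G x ->
  v x - v x0 <= \sum_i p 0 i * (x - x0) i 0 + 2^-1 * quad H (fun i => (x - x0) i 0) +
      eps * `|x - x0| ^+ 2.
Proof.
move=> e0; have [r r0 hr] := C2_taylor x0 chi2 e0.
have : \forall x \near x0, `|x - x0| < r.
  apply/nbhs_ballP; exists r => //= x; rewrite -ball_normE /ball_/= distrC//.
have lm : \forall x \near x0, closure G x -> v x - chi x <= v x0 - chi x0 := locmax.
move=> rr; apply: (@filterS _ (nbhs x0) (nbhs_filter x0) _ _ _ (@filterI _ (nbhs x0) (nbhs_filter x0) _ _ lm rr)) => x [hm xr] Gx; have := hr _ xr; rewrite subrKC.
have := hm Gx; rewrite ler_distl => hm' /andP[_].
have -> : \sum_i partial i chi x0 * (x - x0) i 0 = \sum_i p 0 i * (x - x0) i 0.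
  by apply: eq_bigr => i _; rewrite [p 0 i]mxE.
rewrite -/(quad (hess chi x0) (fun i => (x - x0) i 0)) -/H.
set a := \sum_i _; set b := quad _ _; lra.
Qed.

(** Order of choice: the tolerances are given, the bounds [Cf], [Mphi] and [c] depend only on the
    data near [x0], then [r] is taken small with respect to all of these, and [T1] is chosen from
    [a0], [eps] and [eta]. *)
Lemma local_data_small (eps eps' eta : R) : 0 < eps -> 0 < eps' -> 0 < eta ->
  exists r T1 Cf Mphi c, [/\ 0 < r, 0 < T1,
   (forall T, T <= T1 -> local_data x0 r p H f q psi xi lam M a0 eps eta Cf Mphi c T
     (grad phi) (closure G) (boundary G) v)
   & forall x, `|x - x0| <= r -> forall i j,
     `|inner (row i (sigma x)) (row j (sigma x)) - S i j| <= eps'].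
Proof.
move=> e0 e'0 eta0.
have [Mp hMp] := phiM; pose Mphi := Num.max 0 Mp.
pose Cf := 1 + \sum_i `|f x0 i 0|.
have [c c0 nref] := near_reflect.
have n1 : \forall x \near x0, forall i, `|f x i 0| <= Cf.
  apply: (filter_forall (nbhs_filter x0)) => i.
  have /cvgrPdist_le/(_ 1 ltr01) := @cf i x0; apply: (@filterS _ (nbhs x0) (nbhs_filter x0)) => x h.
  have : `|f x0 i 0| <= \sum_i `|f x0 i 0| by rewrite (bigD1 i)//= lerDl sumr_ge0.
  have := ler_normD (f x i 0 - f x0 i 0) (f x0 i 0); rewrite subrK distrC in h *.
  by rewrite /Cf; move: h; rewrite distrC; lra.
have n4 : \forall x \near x0, `|v x - v x0| <= eta / 4.
  have eta4 : 0 < eta / 4 by rewrite divr_gt0.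
  by have /cvgrPdist_le/(_ _ eta4) := @cv x0; apply: (@filterS _ (nbhs x0) (nbhs_filter x0)) => x; rewrite distrC.
have n6 : \forall x \near x0, forall i, forall j,
    `|inner (row i (sigma x)) (row j (sigma x)) - S i j| <= eps'.
  apply: (filter_forall (nbhs_filter x0)) => i; apply: (filter_forall (nbhs_filter x0)) => j.
  have c1 : \sum_k sigma x i k * sigma x j k @[x --> x0] --> \sum_k sigma x0 i k * sigma x0 j k.
    by apply: (cvg_sumr (nbhs_filter x0)) => k; apply: cvgM; [exact: (@cs i k x0)|exact: (@cs j k x0)].
  move/cvgrPdist_le : c1 => /(_ _ e'0); apply: (@filterS _ (nbhs x0) (nbhs_filter x0)) => x; rewrite distrC.
  have -> : \sum_k sigma x0 i k * sigma x0 j k = S i j.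
    by rewrite /S mxE; apply: eq_bigr => k _; rewrite mxE.
  by rewrite inner_row; under [X in _ -> `|X - _| <= _]eq_bigr do rewrite !mxE.
have FI := @filterI _ (nbhs x0) (nbhs_filter x0).
have := FI _ _ n1 (FI _ _ (near_drift e0) (FI _ _ nref (FI _ _ n4
   (FI _ _ (near_taylor e0) n6)))).
move=> /nbhs_ballP[rho /= rho0 hrho].
have pabs0 : 0 <= \sum_i `|p 0 i| by exact: sumr_ge0.
have Hs0 : 0 <= abs_sum H + 2 * eps * d%:R.
  by rewrite addr_ge0 ?abs_sum_ge0// !mulr_ge0// ltW.
have Mphi0 : 0 <= Mphi by rewrite /Mphi le_max lexx.
have Cf0 : 0 <= Cf by rewrite addr_ge0// sumr_ge0.
have eta4 : 0 < eta / 4 by rewrite divr_gt0.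
have rho2 : 0 < rho / 2 by rewrite divr_gt0.
(* The conditions on [r] are all of the form [a r <= b] with [b > 0], hence hold together for all
   small positive [r]. *)
have [r [r0 [k1 [k2 [k3 [k4 k5]]]]]] : exists r, 0 < r /\ (1 * r <= rho / 2 /\
   ((abs_sum H + 2 * eps * d%:R) * Cf * r <= eps /\
   ((abs_sum H + 2 * eps * d%:R) * Mphi * r <= c /\
   ((\sum_i `|p 0 i|) * r <= eta / 4 /\
   ((\sum_i `|p 0 i|) * Mphi * r <= eta / 4))))).
  apply: (@filter_ex _ (0 : R)^'+).
  apply: filterI; first exact: nbhs_right_gt.
  apply: filterI; first exact: small.
  apply: filterI; first by apply: small => //; exact: mulr_ge0.
  apply: filterI; first by apply: small => //; exact: mulr_ge0.
  by apply: filterI; apply: small => //; exact: mulr_ge0.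
have aT0 : 0 <= `|a0| + eps by rewrite addr_ge0// ltW.
have [T1 [T10 hT1]] : exists T1, 0 < T1 /\ (`|a0| + eps) * T1 <= eta / 4.
  by apply: (@filter_ex _ (0 : R)^'+); apply: filterI; [exact: nbhs_right_gt|exact: small].
have inr x : `|x - x0| <= r -> ball x0 rho x.
  move=> xr; rewrite -ball_normE /ball_/= distrC; apply: le_lt_trans xr _; lra.
exists r, T1, Cf, Mphi, c; split => //; last first.
  by move=> x /inr/hrho[_ [_ [_ [_ [_]]]]].
move=> T TT1; split => //.
- by move=> x i /inr/hrho[].
- move=> i x; under eq_fun do rewrite mxE.
  by have [h _] := phi2; exact: ((h i).2 x).
- by move=> x i; rewrite mxE /Mphi le_max hMp orbT.
- by move=> x /inr/hrho[_ []].
- rewrite /boundary setDE; apply: closedI; first exact: closed_closure.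
  exact: open_closedC (@open_interior _ G).
- by move=> x /inr/hrho[_ [_ []]].
- by move=> x _ /inr/hrho[_ [_ [_ []]]].
- by move=> x Gx /inr/hrho[_ [_ [_ [_ [/(_ Gx)]]]]].
- exact: le_trans M1.
- exact: ltW.
- exact: ltW.
- by rewrite mulrAC.
- by rewrite mulrAC.
- by apply: le_trans hT1; rewrite ler_wpM2l.
Qed.

End local_data_small.

(** * The subsolution property *)

Section subsolution.
Context {R : realType} {d : nat} {disp : measure_display}
  {Omega : measurableType disp} (P : probability Omega R).
Notation leb := (@lebesgue_measure R).
Variable W : R -> Omega -> 'cV[R]_d.
Hypothesis hP : measure_is_complete P.
Hypothesis hW : brownian P W.
Variables (G : set 'cV[R]_d) (phi : 'cV[R]_d -> R).
Variables (f : 'cV[R]_d -> 'cV[R]_d) (sigma : 'cV[R]_d -> 'M[R]_d).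
Variables (psi : 'cV[R]_d -> 'rV[R]_d -> R) (xi : 'cV[R]_d -> 'rV[R]_d).
Variables (lam M : R) (v chi : 'cV[R]_d -> R) (x0 : 'cV[R]_d).
Hypothesis oG : open G.
Hypothesis phi2 : is_C2 phi.
Hypothesis phiM : exists Mp : R, forall x i, `|partial i phi x| <= Mp.
Hypothesis cf : forall i, continuous (fun x => f x i 0).
Hypothesis cs : forall i j, continuous (fun x => sigma x i j).
Hypothesis cpsi : forall z, continuous (fun x => psi x z).
Hypothesis lpsi : forall x z z', `|psi x z - psi x z'| <= M * enorm (z - z').
Hypothesis M1 : 1 <= M.
Hypothesis mxi : measurable_wrt (borel 'cV[R]_d) xi.
Hypothesis cv : continuous v.
Hypothesis chi2 : is_C2 chi.
Hypothesis locmax : \forall x \near within (closure G) (nbhs x0), v x - chi x <= v x0 - chi x0.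
Variables (X : R -> Omega -> 'cV[R]_d) (K : R -> Omega -> R) (NZ : R -> Omega -> R).
Hypothesis hX : reflected_sde P W G phi f sigma x0 X K.
Hypothesis hNZ : ito_pair P W (fun s w => xi (X s w)) NZ.
Hypothesis cNZ : path_continuous NZ.
Hypothesis hY : {ae P, forall w, forall t, 0 <= t -> v (X t w) - v (X 0 w) =
  - (\int[leb]_(s in `[0, t]) (psi (X s w) (xi (X s w)) - lam)) + NZ t w}.

(** By contradiction from [F > 0]: fix the tolerances from [F], then the radius by
    [local_data_small], then the horizon by [horizon_exists], and apply [horizon_contradiction]. *)
Lemma subsolution : G x0 \/ inner (grad phi x0) (grad chi x0) < 0 ->
  - Lop f sigma chi x0 - psi x0 (grad chi x0 *m sigma x0) + lam <= 0.
Proof.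
move=> dir; rewrite leNgt; apply/negP.
set F := _ + lam => F0.
pose p := grad chi x0; pose H := hess chi x0; pose S := sigma x0 *m (sigma x0)^T.
pose a0 := psi x0 (p *m sigma x0) - lam + \sum_i p 0 i * f x0 i 0.
have a0F : a0 + 2^-1 * \sum_i \sum_j H i j * S i j = - F.
  rewrite /F /Lop -/p -/H -/S.
  have -> : \tr (S *m H) = \sum_i \sum_j H i j * S i j.
    (* The trace of [H S] pairs [H i j] with [S j i]; the symmetry of [S] exchanges the indices. *)
    rewrite mxtrace_mulC; apply: eq_bigr => i _; rewrite mxE; apply: eq_bigr => j _.
    congr (_ * _); rewrite /S -[in LHS](trmxK (sigma x0)) -trmx_mul trmxK mxE//.
  have -> : (p *m f x0) 0 0 = \sum_i p 0 i * f x0 i 0 by rewrite mxE.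
  by rewrite /a0; ring.
have S0 i : 0 <= S i i.
  by rewrite mxE; apply: sumr_ge0 => j _; rewrite mxE -expr2 sqr_ge0.
have M0 : 0 < M by exact: lt_le_trans M1.
pose Hs := abs_sum H; pose A := \sum_i S i i.
have Hs0 : 0 <= Hs by exact: abs_sum_ge0.
have A0 : 0 <= A by apply: sumr_ge0.
have d0 : (0 : R) <= d%:R by [].
pose C2 := (Hs + 2) * (A + d%:R) + 2 * (`|a0| + 2) + M.
have C20 : 0 < C2.
  have u1 : 0 <= (Hs + 2) * (A + d%:R) by rewrite mulr_ge0// addr_ge0.
  have u2 : 0 <= 2 * (`|a0| + 2) by rewrite mulr_ge0// addr_ge0.
  by rewrite /C2 ltr_wpDl// addr_ge0.
have Ad2 : 0 < A + d%:R + 2 by rewrite ltr_wpDl// addr_ge0.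
have Hs1 : 0 < Hs + 1 by rewrite ltr_wpDl.
(* [eps] and [eps'] each use [F / 8] of the allowance [F / 4] for the error terms. In [eta] the
   first entry gives [eta M <= 1 / 8], and the second makes [32 M^2 eta C2] at most [2 F^2], below
   [3 F^2]. *)
pose eps := Num.min 1 (F / (16 * (A + d%:R + 2))).
pose eps' := Num.min 1 (F / (8 * (Hs + 1))).
pose eta := Num.min (1 / (8 * M)) (F ^+ 2 / (16 * M ^+ 2 * C2)).
have e0 : 0 < eps by rewrite lt_min ltr01 divr_gt0// mulr_gt0.
have e'0 : 0 < eps' by rewrite lt_min ltr01 divr_gt0// mulr_gt0.
have eta0 : 0 < eta by rewrite lt_min !divr_gt0// ?exprn_gt0// !mulr_gt0// exprn_gt0.
have h1 : Hs * eps' <= F / 8.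
  apply: (@le_trans _ _ ((Hs + 1) * (F / (8 * (Hs + 1))))).
    by rewrite ler_pM//; [exact: ltW|rewrite lerDl|rewrite ge_min lexx orbT].
  by rewrite le_eqVlt; apply/orP; left; apply/eqP; field; rewrite gt_eqF.
have h2 : 2 * eps * (A + d%:R + 2) <= F / 8.
  apply: (@le_trans _ _ (2 * (F / (16 * (A + d%:R + 2))) * (A + d%:R + 2))).
    rewrite ler_wpM2r ?(ltW Ad2)//.
    by rewrite ler_pM2l// ge_min lexx orbT.
  by rewrite le_eqVlt; apply/orP; left; apply/eqP; field; rewrite gt_eqF.
have h3 : eta * M <= 1 / 8.
  apply: (@le_trans _ _ (1 / (8 * M) * M)); first by rewrite ler_pM2r// ge_min lexx.
  by rewrite le_eqVlt; apply/orP; left; apply/eqP; field; rewrite gt_eqF.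
have h4 : 32 * M ^+ 2 * eta * C2 < 3 * F ^+ 2.
  apply: (@le_lt_trans _ _ (32 * M ^+ 2 * (F ^+ 2 / (16 * M ^+ 2 * C2)) * C2)).
    rewrite ler_pM2r// ler_pM2l ?mulr_gt0 ?exprn_gt0//.
    by rewrite ge_min lexx orbT.
  have -> : 32 * M ^+ 2 * (F ^+ 2 / (16 * M ^+ 2 * C2)) * C2 = 2 * F ^+ 2.
    by field; rewrite !gt_eqF.
  by rewrite ltr_pM2r ?exprn_gt0// ltr_nat.
have [r [T1 [Cf [Mphi [c [r0 T10 L sc]]]]]] := local_data_small lam oG phi2 phiM
  cf cs cpsi lpsi M1 mxi cv chi2 locmax dir e0 e'0 eta0.
have [aX aK cX cK [I [hI aeX]]] := hX.
have /choice[NI hNI] i := ito_pair_version hP hW (hI i).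
have cNI i : path_continuous (NI i) by have [_ h5 h6 _] := hNI i; split.
have aI i : adapted P W (fun t w => I t w i 0) by have [_ h5 _ _] := hI i.
have aeI : {ae P, forall w, forall i t, 0 <= t -> NI i t w = I t w i 0}.
  by apply: filter_forall => i; have [_ _ _] := hNI i.
have aeX0 : {ae P, forall w,
  [/\ {within `[0, +oo[, continuous (X^~ w)}, {within `[0, +oo[, continuous (K^~ w)},
      X 0 w = x0, K 0 w = 0 & forall i t, 0 <= t -> NI i t w = I t w i 0]}.
  have cXK : {ae P, forall w, {within `[0, +oo[, continuous (X^~ w)} /\
      {within `[0, +oo[, continuous (K^~ w)}} by apply: filterS2 cX cK.
  apply: filterS3 cXK aeI aeX => w [c1 c2] eI [_ K0 _ [k [_ eq]]].
  (* The initial value is read off the equation at time 0, where the integrals run over a point or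
     the empty set and the martingale part vanishes. *)
  split => //; have [-> _] := eq 0 (lexx 0).
  apply/matrixP => i j; rewrite !mxE !ord1 set_itv1 set_itvoc0 Rintegral_set1 Rintegral_set0.
  by rewrite -eI//; have [_ ->] := cNI i; rewrite !addr0.
(* The second entry gives [M^2 T <= 1 / 8], which absorbs the second moment in [a2_small]. *)
pose T2 := Num.min T1 (1 / (8 * M ^+ 2)).
have T20 : 0 < T2 by rewrite lt_min T10 divr_gt0// mulr_gt0// exprn_gt0.
have [T [tau [[/andP[T0 TT2] mtau tauT hiso Et] conf]]] :=
  horizon_exists hP hW r0 T20 aX aK aI cNI aeX0.
have TT1 : T <= T1 by apply: le_trans TT2 _; rewrite ge_min lexx.
have MT : M ^+ 2 * T <= 1 / 8.
  apply: (@le_trans _ _ (M ^+ 2 * (1 / (8 * M ^+ 2)))).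
    rewrite ler_pM2l ?exprn_gt0//; apply: le_trans TT2 _; by rewrite ge_min lexx orbT.
  by rewrite le_eqVlt; apply/orP; left; apply/eqP; field; rewrite gt_eqF.
apply: (@horizon_contradiction R d _ _ P W hP hW x0 r p H S f sigma psi xi lam M F a0 eps eps'
  eta Cf Mphi c T (grad phi) (closure G) (boundary G) v (L T TT1) sc M1 T0 F0 a0F _ _ _ S0
  (ltW eta0) h3 MT h4 X K NI NZ _ hNZ cNZ tau mtau tauT hiso Et).
- by rewrite ltW//= ge_min lexx.
- by rewrite ltW//= ge_min lexx.
- by rewrite -/Hs -/A; lra.
- by move=> i; have [h5 _ _ _] := hNI i.
have ae1 : {ae P, forall w, (forall t, 0 <= t -> v (X t w) - v (X 0 w) =
  - (\int[leb]_(s in `[0, t]) (psi (X s w) (xi (X s w)) - lam)) + NZ t w) /\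
  forall s, 0 <= s <= tau w -> confined X K I x0 r w s} by apply: filterS2 hY conf.
apply: filterS3 aeX0 aeX ae1.
move=> w [c1 c2 X0 K0 eI] [GX _ Kinc [k [kK eq]]] [eY cw].
have [t0 _] := andP (tauT w).
have ct : confined X K I x0 r w (tau w) by apply: cw; rewrite t0 lexx.
exists k; split => //.
- by move=> s /cw[].
- split => //; first by have [_ _ ->] := ct; rewrite andbT -K0; apply: Kinc; rewrite lexx.
  by move=> i; rewrite eI//; have [_ + _] := ct.
have [eX eK] := eq _ t0; split => //.
- exact: GX.
- rewrite eX; congr (_ + _ + _); apply/matrixP => i j; by rewrite !mxE !ord1 eI.
- by rewrite -eY// X0.
Qed.

End subsolution.

(** No integrability is needed: when one of the two parts of [f] has an infinite
    integral, both sides are the junk value [0]. *)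
Lemma RintegralN_total (disp : measure_display) (T : measurableType disp) (R : realType)
    (mu : {measure set T -> \bar R}) (D : set T) (f : T -> R) :
  \int[mu]_(x in D) (- f x) = - \int[mu]_(x in D) f x.
Proof.
rewrite /Rintegral.
have -> : (\int[mu]_(x in D) (- f x)%:E = \int[mu]_(x in D) (\- (EFin \o f)) x)%E by [].
rewrite integralE [in RHS]integralE funeposN funenegN.
have := @integral_ge0 _ _ R mu D (EFin \o f)^\+%E (fun x _ => funepos_ge0 _ x).
have := @integral_ge0 _ _ R mu D (EFin \o f)^\-%E (fun x _ => funeneg_ge0 _ x).
move: (integral _ _ _) (integral _ _ _) => [a| |] [b| |] //= _ _; rewrite ?oppr0//.
by rewrite opprB.
Qed.

(** * Continuity of the data and change of sign *)

Section regularity.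
Context {R : realType} {d : nat}.

Lemma loc_elipschitz_continuous m n (h : 'cV[R]_d -> 'M[R]_(m, n)) i j :
  loc_elipschitz h -> continuous (fun x => h x i j).
Proof.
move=> lh x0; have [L [r [r0 hL]]] := lh x0.
apply: (@cvgrPdist_le _ _ _ (nbhs x0) (nbhs_filter x0) (fun x => h x i j) (h x0 i j)).2.
move=> eps eps0 /=.
pose D : R := d%:R + 1; have D0 : 0 < D by rewrite ltr_wpDl.
have L0 : 0 < `|L| + 1 by rewrite ltr_wpDl.
pose e := Num.min (r / D) (eps / ((`|L| + 1) * D)).
have e0 : 0 < e by rewrite lt_min !divr_gt0// mulr_gt0.
apply/nbhs_ballP; exists e => //= x; rewrite -ball_normE /ball_/= => xe.
have xD : enorm (x - x0) <= D * `|x0 - x|.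
  rewrite distrC; apply: le_trans (enorm_le_mx_norm _) _.
  by rewrite muln1 ler_wpM2r// lerDl.
have xr : enorm (x - x0) < r.
  apply: le_lt_trans xD _; rewrite mulrC -ltr_pdivlMr//.
  by apply: lt_le_trans xe _; rewrite ge_min lexx.
have x0r : enorm (x0 - x0) < r.
  have -> : enorm (x0 - x0) = 0 => //.
  by apply/eqP; rewrite sqrtr_eq0 subrr /inner big1// => k _; rewrite big1// => l _; rewrite mxE mul0r.
have := hL _ _ xr x0r => hx.
have -> : h x0 i j - h x i j = - ((h x - h x0) i j) by rewrite !mxE opprB.
rewrite normrN; apply: le_trans (coord_le_enorm _ _ _) _; apply: le_trans hx _.
apply: (@le_trans _ _ ((`|L| + 1) * (D * `|x0 - x|))).
  apply: (@le_trans _ _ ((`|L| + 1) * enorm (x - x0))).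
    by rewrite ler_wpM2r ?enorm_ge0// (le_trans (ler_norm _))// lerDl.
  by rewrite ler_pM2l.
rewrite mulrA mulrC -ler_pdivlMr ?mulr_gt0//; apply: ltW.
by apply: lt_le_trans xe _; rewrite ge_min lexx orbT.
Qed.

Lemma partialN (u : 'cV[R]_d -> R) i : (forall x, derivable u x (delta_mx i 0)) ->
  partial i (fun x => - u x) = (fun x => - partial i u x).
Proof. by move=> du; apply/funext => x; rewrite /partial deriveN. Qed.

Lemma is_C1N (u : 'cV[R]_d -> R) : is_C1 u -> is_C1 (fun x => - u x).
Proof.
move=> hu i; have [du cu] := hu i; split; first by move=> x; exact: derivableN.
by rewrite partialN// => x; have := cvgN (@cu x); apply.
Qed.

Lemma is_C2N (u : 'cV[R]_d -> R) : is_C2 u -> is_C2 (fun x => - u x).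
Proof.
move=> [h1 h2]; split; first exact: is_C1N.
by move=> i; rewrite partialN; [exact: is_C1N|case: (h1 i)].
Qed.

Lemma gradN (u : 'cV[R]_d -> R) x : is_C2 u -> grad (fun x => - u x) x = - grad u x.
Proof.
move=> [h1 _]; apply/rowP => i; rewrite !mxE partialN//; by case: (h1 i).
Qed.

Lemma LopN f sigma (u : 'cV[R]_d -> R) x : is_C2 u ->
  Lop f sigma (fun x => - u x) x = - Lop f sigma u x.
Proof.
move=> hu; have [h1 h2] := hu.
have -> : Lop f sigma (fun x => - u x) x =
   2^-1 * \tr (sigma x *m (sigma x)^T *m (- hess u x)) + (- grad u x *m f x) 0 0.
  rewrite /Lop gradN//; congr (_ * \tr (_ *m _) + _); apply/matrixP => i j.
  rewrite !mxE partialN; last by case: (h1 i).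
  by rewrite partialN//; case: (h2 i j).
by rewrite mulmxN mulNmx mxE raddfN /= mulrN -opprD.
Qed.

End regularity.

Theorem theorem4p11 (R : realType) (d : nat) (hd : (0 < d)%N)
    (disp : measure_display) (Omega : measurableType disp)
    (P : probability Omega R) (hP : measure_is_complete P)
    (W : R -> Omega -> 'cV[R]_d) (hW : brownian P W)
    (dd b : 'cV[R]_d -> 'cV[R]_d) (sigma : 'cV[R]_d -> 'M[R]_d)
    (hA : hypA dd b sigma)
    (psi : 'cV[R]_d -> 'rV[R]_d -> R) (hpsi : hypP psi)
    (G : set 'cV[R]_d) (phi : 'cV[R]_d -> R) (hG : hypG G phi)
    (X : 'cV[R]_d -> R -> Omega -> 'cV[R]_d)
    (K : 'cV[R]_d -> R -> Omega -> R)
    (hX : forall x, closure G x ->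
       reflected_sde P W G phi (fun y => dd y + b y) sigma x (X x) (K x))
    (lam : R) (v : 'cV[R]_d -> R) (hv : loc_lipschitz v)
    (xi : 'cV[R]_d -> 'rV[R]_d) (hxi : measurable_wrt (borel 'cV[R]_d) xi)
    (hYZ : forall x, closure G x ->
       M2 P W (fun t w => xi (X x t w)) /\
       ergodic_bsde P W psi lam (X x)
         (fun t w => v (X x t w)) (fun t w => xi (X x t w))) :
  viscosity_solution G phi (fun y => dd y + b y) sigma psi lam v.
Proof.
have eloc m n (h : 'cV[R]_d -> 'M[R]_(m, n)) : elipschitz h -> loc_elipschitz h.
  by move=> [L hL] x0; exists L, 1; split => // x y _ _; exact: hL.
have cv : continuous v.
  have -> : v = fun x => ((v x)%:M : 'M[R]_1) 0 0 by apply/funext => x; rewrite mxE.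
  exact: loc_elipschitz_continuous.
have [[_ ldd _] [lb _] [ls _ _] _] := hA.
have cf i : continuous (fun y => (dd y + b y) i 0).
  move=> y; under eq_fun do rewrite mxE.
  have h1 := loc_elipschitz_continuous (i := i) (j := 0) ldd (x := y).
  have h2 := loc_elipschitz_continuous (i := i) (j := 0) (eloc _ _ _ lb) (x := y).
  by have := cvgD h1 h2; apply.
have cs i j : continuous (fun x => sigma x i j).
  exact: loc_elipschitz_continuous (eloc _ _ _ ls).
have [_ [M0 hM]] := hpsi.
have cpsi z : continuous (fun x => psi x z) by have [] := hM 0 z 0.
(* The constant is raised to at least 1, which keeps the Lipschitz bound and makes it positive for
   later divisions. *)
pose M := Num.max 1 M0.
have M1 : 1 <= M by rewrite le_max lexx.
have lpsi x z z' : `|psi x z - psi x z'| <= M * enorm (z - z').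
  have [_ _ h] := hM x z z'; apply: le_trans h _.
  by rewrite ler_wpM2r ?enorm_ge0// le_max lexx orbT.
have [oG _ phi2 [Mp hMp] _] := hG.
have phiM : exists Mp : R, forall x i, `|partial i phi x| <= Mp.
  by exists Mp => x i; have [] := hMp x i i.
have hNZ x0 : closure G x0 -> exists NZ, [/\ ito_pair P W (fun s w => xi (X x0 s w)) NZ,
    path_continuous NZ & {ae P, forall w, forall t, 0 <= t ->
      v (X x0 t w) - v (X x0 0 w) =
      - (\int[lebesgue_measure]_(s in `[0, t]) (psi (X x0 s w) (xi (X x0 s w)) - lam)) + NZ t w}].
  move=> Gx; have [_ [I hI aeY]] := hYZ _ Gx.
  have [NZ [h1 h2 h3 h4]] := ito_pair_version hP hW hI.
  exists NZ; split => //; apply: filterS2 h4 aeY => w eI eY t t0.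
  have := eY 0 t; rewrite lexx t0 => /(_ isT).
  rewrite -!eI// h3 => ->; ring.
split; first exact: continuous_subspaceT.
move=> chi x0 chi2 Gx; have [NZ [hZ cZ aeY]] := hNZ _ Gx.
have hX0 := hX _ Gx.
split => lm.
  have sub := subsolution hP hW oG phi2 phiM cf cs cpsi lpsi M1 hxi cv chi2 lm hX0 hZ cZ aeY.
  split=> [G0|_]; first by apply: sub; left.
  (* The minimum is nonpositive at once if the derivative along [grad phi] is nonnegative; otherwise
     the strict sign is the boundary case of [subsolution]. *)
  rewrite ge_min oppr_le0; have [lt0|ge0] := ltP (inner (grad phi x0) (grad chi x0)) 0.
    by rewrite sub//; right.
  by rewrite orbT.
(* The processes [- v(X)] and [- xi(X)] solve the backward equation with driver [psi'] and constant
   [- lam], for the same forward process. Since [- v + chi] has a local maximum at [x0], the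
   subsolution property for these data is the supersolution property for the original ones. *)
pose psi' x z := - psi x (- z).
have cpsi' z : continuous (fun x => psi' x z).
  by move=> x; have := cvgN (@cpsi (- z) x); apply.
have lpsi' x z z' : `|psi' x z - psi' x z'| <= M * enorm (z - z').
  rewrite /psi' -opprD normrN; apply: le_trans (lpsi _ _ _) _.
  by rewrite -opprD enormN.
have hxi' : measurable_wrt (borel 'cV[R]_d) (fun x => - xi x).
  move=> U oU; apply: (hxi ((fun z => - z) @^-1` U)).
  by apply: open_comp => // z _; exact: oppr_continuous.
have cv' : continuous (fun x => - v x) by move=> x; have := cvgN (@cv x); apply.
have lm' : \forall x \near within (closure G) (nbhs x0), - v x - - chi x <= - v x0 - - chi x0.
  move: lm; apply: filterS => x; lra.
have hZ' : ito_pair P W (fun s w => - xi (X x0 s w)) (fun t w => - NZ t w).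
  (* The opposite of a pair is obtained as [- 2] times the pair plus the pair itself. *)
  have := ito_pairD hP hW (-2) hZ hZ; congr ito_pair.
    by apply/funext => s; apply/funext => w; rewrite scaleNr scaler_nat mulr2n opprD -addrA addNr addr0.
  by apply/funext => s; apply/funext => w; ring.
have cZ' : path_continuous (fun t w => - NZ t w).
  case: cZ => c1 c2; split=> w; last by rewrite c2 oppr0.
  by move=> t; apply: cvgN; exact: c1.
have aeY' : {ae P, forall w, forall t, 0 <= t -> - v (X x0 t w) - - v (X x0 0 w) =
    - (\int[lebesgue_measure]_(s in `[0, t]) (psi' (X x0 s w) (- xi (X x0 s w)) - (- lam)))
    + - NZ t w}.
  apply: filterS aeY => w h t t0; have := h t t0.
  have -> : \int[lebesgue_measure]_(s in `[0, t]) (psi' (X x0 s w) (- xi (X x0 s w)) - (- lam)) =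
      - \int[lebesgue_measure]_(s in `[0, t]) (psi (X x0 s w) (xi (X x0 s w)) - lam).
    by rewrite -RintegralN_total; apply: eq_Rintegral => s _; rewrite /psi' opprK; ring.
  by move=> h'; rewrite -opprD h'; ring.
have := subsolution hP hW oG phi2 phiM cf cs cpsi' lpsi' M1 hxi' cv' (is_C2N chi2) lm'
  hX0 hZ' cZ' aeY'.
rewrite LopN// gradN// mulNmx /psi' !opprK.
have -> : inner (grad phi x0) (- grad chi x0) = - inner (grad phi x0) (grad chi x0).
  by rewrite innerC -scaleN1r innerZl innerC mulN1r.
move=> super.
have super' : G x0 \/ 0 < inner (grad phi x0) (grad chi x0) ->
    0 <= - Lop (fun y => dd y + b y) sigma chi x0 - psi x0 (grad chi x0 *m sigma x0) + lam.
  by rewrite -[0 < _]oppr_lt0 => /super; lra.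
split=> [G0|_]; first by apply: super'; left.
rewrite le_max oppr_ge0; have [lt0|le0] := ltP 0 (inner (grad phi x0) (grad chi x0)).
  by rewrite super'//; right.
by rewrite orbT.
Qed.
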